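(* Let $A$ be a compactly generated locally compact abelian group. Every sheer LC $A$-module $M$ has a unique decomposition as a topological direct sum of closed submodules $M=P\oplus E\oplus V$ with $P$ polycontractable, $E$ amorphic and $V$ distal Euclidean.
   Context: An LC $A$-module is an LCA group $M$ with a continuous action of the LCA group $A$ by topological automorphisms. Compact parafinite: compact with no nonzero finite quotient module; purely discrete: discrete with no nonzero finite submodule. $\mathrm{W}^\flat(M)$ is the sum of all compact parafinite submodules; $\Omega^\sharp(M)$ is the intersection of all open submodules $U$ with $M/U$ purely discrete; $M$ is sheer if $\mathrm{W}^\flat(M)=0$ and $\Omega^\sharp(M)=M$. An automorphism $\phi$ of an LC group is contracting if $\phi^n(x)\to 0$ as $n\to+\infty$ for every $x$ (uniformly on compact sets). $M$ is contractable if some $a\in A$ acts on $M$ as a contracting automorphism; polycontractable if it is a finite topological direct sum of closed contractable submodules (possibly contracted by different elements). $M$ is amorphic if it is sheer and has a compact open submodule. $M$ is Euclidean if its underlying group is isomorphic to $\mathbf{R}^d$ for some $d$, and distal Euclidean if moreover every element of $A$ acts by a linear map all of whose complex eigenvalues have modulus $1$. *)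

(* Defs.v *)
From HB Require Import structures.
From mathcomp Require Import all_boot all_order all_algebra.
From mathcomp Require Import all_classical all_reals all_analysis.
From mathcomp Require Import Rstruct Rstruct_topology.
From mathcomp Require Import complex.


Set Implicit Arguments.
Unset Strict Implicit.
Unset Printing Implicit Defensive.

Import Order.TTheory GRing.Theory Num.Theory.
Local Open Scope classical_set_scope.
Local Open Scope ring_scope.

Definition LCA_group (G : topologicalZmodType) : Prop :=
  hausdorff_space G /\ locally_compact [set: G].

Definition is_subgroup (G : zmodType) (H : set G) : Prop :=
  H 0 /\ (forall x y, H x -> H y -> H (x - y)).

Definition compactly_generated (G : topologicalZmodType) : Prop :=
  exists K : set G, compact K /\
    (forall H : set G, is_subgroup H -> K `<=` H -> H = setT).

Definition open_in (T : topologicalType) (S U : set T) : Prop :=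
  exists O : set T, open O /\ U = O `&` S.

Definition finite_index (G : zmodType) (N' N : set G) : Prop :=
  exists F : set G, finite_set F /\ F `<=` N /\
    (forall x, N x -> exists2 f, F f & N' (x - f)).

Section LCModule.
Variables (A M : topologicalZmodType) (act : A -> M -> M).

Definition is_action : Prop :=
  [/\ (forall a x y, act a (x + y) = act a x + act a y),
      (forall x, act 0 x = x),
      (forall a b x, act (a + b) x = act a (act b x)) &
      continuous (fun p : A * M => act p.1 p.2)].

Definition alg_submodule (N : set M) : Prop :=
  is_subgroup N /\ (forall a x, N x -> N (act a x)).

Definition submodule (N : set M) : Prop := alg_submodule N /\ closed N.

(* compact parafinite: compact, and no nonzero finite quotient module *)
Definition compact_parafinite (N : set M) : Prop :=
  [/\ submodule N, compact N &
      forall N', submodule N' -> N' `<=` N -> finite_index N' N -> N' = N].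

Definition Wflat (S : set M) : set M :=
  [set x | forall H : set M, is_subgroup H ->
     (forall N, N `<=` S -> compact_parafinite N -> N `<=` H) -> H x].

(* U open submodule of S such that S/U (discrete, as U is open in S) has
   no nonzero finite submodule *)
Definition purely_discrete_quotient (S U : set M) : Prop :=
  [/\ alg_submodule U, U `<=` S, open_in S U &
      forall N, alg_submodule N -> U `<=` N -> N `<=` S ->
        finite_index U N -> N `<=` U].

Definition Omega_sharp (S : set M) : set M :=
  [set x | forall U, purely_discrete_quotient S U -> U x].

Definition sheer (S : set M) : Prop :=
  Wflat S = [set 0] /\ Omega_sharp S = S.

Definition contracting_on (a : A) (S : set M) : Prop :=
  (forall x, S x -> S (act a x)) /\
  forall K : set M, K `<=` S -> compact K ->
    forall W : set M, nbhs (0 : M) W ->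
      exists n0 : nat, forall n : nat, (n0 <= n)%N -> forall x, K x ->
        W (iter n (act a) x).

Definition contractable (S : set M) : Prop := exists a, contracting_on a S.

Definition topdirsum (S : set M) (n : nat) (F : 'I_n -> set M) : Prop :=
  [/\ (forall i, F i `<=` S),
      (forall y z : 'I_n -> M, (forall i, F i (y i)) -> (forall i, F i (z i)) ->
         \sum_(i < n) y i = \sum_(i < n) z i -> y = z) &
      exists pi : 'I_n -> M -> M,
        [/\ (forall i x, S x -> F i (pi i x)),
            (forall x, S x -> x = \sum_(i < n) pi i x) &
            (forall i, {within S, continuous (pi i)})]].

Definition polycontractable (S : set M) : Prop :=
  exists (n : nat) (F : 'I_n -> set M),
    (forall i, submodule (F i) /\ contractable (F i)) /\ @topdirsum S n F.

Definition amorphic (S : set M) : Prop :=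
  sheer S /\ exists N, [/\ alg_submodule N, N `<=` S, compact N & open_in S N].

Definition euclidean_chart (S : set M) (d : nat)
    (f : M -> 'rV[Rdefinitions.R]_d) (g : 'rV[Rdefinitions.R]_d -> M) : Prop :=
  [/\ (forall x y, S x -> S y -> f (x + y) = f x + f y),
      {within S, continuous f}, continuous g,
      (forall v, S (g v) /\ f (g v) = v) &
      (forall x, S x -> g (f x) = x)].

Definition euclidean (S : set M) : Prop :=
  exists d f g, @euclidean_chart S d f g.

Definition distal_euclidean (S : set M) : Prop :=
  exists d f g, @euclidean_chart S d f g /\
    forall a : A, exists B : 'M[Rdefinitions.R]_d,
      (forall v, f (act a (g v)) = v *m B) /\
      (forall z : (Rdefinitions.R)[i], root (map_poly (real_complex Rdefinitions.R) (char_poly B)) z ->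
         `|z| = 1).

Definition PEV_decomposition (P E V : set M) : Prop :=
  [/\ submodule P, submodule E, submodule V,
      topdirsum setT (fun i : 'I_3 => nth set0 [:: P; E; V] i) &
      [/\ polycontractable P, amorphic E & distal_euclidean V]].

End LCModule.

(* Main.v *)
(* Let L be the union of the compact subgroups of M. An open subgroup of M admits a
   proper homomorphism to some R^n, and as M is sheer this splits M as L + R^d with
   L totally disconnected. On R^d everything is linear algebra: the generalized
   eigenspaces of modulus different from 1 are contracted by some a or - a, and what
   remains after finitely many steps is distal. On L each a in A yields, through tidy
   subgroups, the contraction subgroups of a and - a and the level subgroup of
   elements with relatively compact orbit. W^flat(M) = 0 kills the nub of a, so that
   these three are closed with direct sum an open submodule, and Omega^sharp(M) = M
   forces the sum to be L. Since A is compactly generated, finitely many elements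
   control the action of A on a given compact open subgroup of L; splitting off their
   contraction subgroups leaves a level part having a compact open submodule.

   Uniqueness comes from the vanishing of equivariant maps between parts of different
   kinds: contracted vectors vanish in an amorphic or distal module, and a map from an
   amorphic module to a contractable or Euclidean one has an open kernel with purely
   discrete quotient. *)

Require Import Defs.
From HB Require Import structures.
From mathcomp Require Import all_boot all_order all_algebra.
From mathcomp Require Import all_classical all_reals all_analysis.
From mathcomp Require Import Rstruct Rstruct_topology complex ring lra zify.

Set Implicit Arguments.
Unset Strict Implicit.
Unset Printing Implicit Defensive.

Import Order.TTheory GRing.Theory Num.Theory.
Import numFieldNormedType.Exports.

Local Open Scope classical_set_scope.
Local Open Scope ring_scope.

(** * Linear identities in abelian groups *)

(** Both halves of sheerness are used through one recurring test each. For Omega^sharp: the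
    candidate submodule U is open, and in a finite submodule above U the pigeonhole principle makes
    the multiples or the translates of an element y recur modulo U; the resulting equation is solved
    inside U up to a remainder that lies in U again, so y lies in U. For W^flat: an intersection
    indexed by all compact open subgroups of L is a compact submodule, and any submodule of finite
    index in it is relatively open, which is enough to see that it is everything. A single compact
    open subgroup of L is not A-invariant; invariance returns only after such intersections or
    unions. As M need not be metrizable, limits are taken along directed families of compact sets.
    Since A is commutative, the contraction and level subgroups of one element are submodules, and
    every continuous equivariant endomorphism preserves them. Hence the projections commute with all
    equivariant maps, and summands can be carried along as images of equivariant idempotents. *)

Inductive zexp := ZVar of nat | ZZero | ZAdd of zexp & zexp | ZOpp of zexp.

Fixpoint zeval (M : zmodType) (env : seq M) e : M :=
  match e with
  | ZVar i => env`_i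
  | ZZero => 0
  | ZAdd a b => zeval env a + zeval env b
  | ZOpp a => - zeval env a
  end.

Fixpoint zcoef e (i : nat) : int :=
  match e with
  | ZVar j => (i == j)%:Z
  | ZZero => 0
  | ZAdd a b => zcoef a i + zcoef b i
  | ZOpp a => - zcoef a i
  end.

Lemma zevalE (M : zmodType) (env : seq M) e :
  zeval env e = \sum_(i < size env) env`_i *~ zcoef e i.
Proof.
elim: e => [j||a IHa b IHb|a IHa] /=.
- have [lt|ge] := ltnP j (size env).
    rewrite (bigD1 (Ordinal lt)) //= eqxx big1 ?addr0 // => i.
    by rewrite -val_eqE /= => /negPf->.
  rewrite nth_default // big1 // => i _.
  by rewrite (ltn_eqF (leq_trans (ltn_ord i) ge)).
- by rewrite big1.
- by rewrite IHa IHb -big_split /=; apply: eq_bigr => i _; rewrite mulrzDr.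
- by rewrite IHa -sumrN; apply: eq_bigr => i _; rewrite mulrNz.
Qed.

(** Reflection: with both sides reified over one list of atoms, an identity between linear terms
    reduces to a computation of integer coefficients. *)
Lemma zmod_eq (M : zmodType) (env : seq M) e f :
  all (fun i => zcoef e i == zcoef f i) (iota 0 (size env)) ->
  zeval env e = zeval env f.
Proof.
move=> /allP h; rewrite !zevalE; apply: eq_bigr => i _.
by rewrite (eqP (h i _)) // mem_iota add0n ltn_ord.
Qed.

(* Atoms are compared up to conversion: the same scalar multiple may carry
   different canonical structures. *)
Ltac zindex x env :=
  match env with
  | ?y :: _ => let _ := match goal with _ => unify x y end in constr:(O)
  | _ :: ?t => let n := zindex x t in constr:(S n)
  end.
Ltac zadd x env :=
  match env with
  | _ => let _ := zindex x env in env
  | _ => constr:(x :: env)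
  end.
Ltac zvars t env :=
  lazymatch t with
  | (?a + ?b)%R => let e := zvars a env in zvars b e
  | (- ?a)%R => zvars a env
  | 0%R => env
  | ?x => zadd x env
  end.
Ltac zreify t env :=
  lazymatch t with
  | (?a + ?b)%R => let x := zreify a env in let y := zreify b env in
      constr:(ZAdd x y)
  | (- ?a)%R => let x := zreify a env in constr:(ZOpp x)
  | 0%R => constr:(ZZero)
  | ?x => let n := zindex x env in constr:(ZVar n)
  end.
Ltac zmod :=
  lazymatch goal with
  | |- @eq ?T ?l ?r =>
    let env := zvars l constr:(@nil T) in
    let env := zvars r env in
    let e := zreify l env in
    let f := zreify r env in
    exact (@zmod_eq _ env e f isT)
  end.

(** * Topological abelian groups *)

Section TopologicalGroup.
Variable M : topologicalZmodType.
Implicit Types (W V K H O : set M) (x y z : M).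

Lemma nbhs0_split W : nbhs (0 : M) W -> exists V,
  [/\ nbhs (0 : M) V, forall x, V x -> V (- x) &
      forall x y, V x -> V y -> W (x + y)].
Proof.
move=> W0.
have W0' : nbhs ((0 : M) + 0) W by rewrite addr0.
have /= [[A B] /= [nA nB] AB] := @add_continuous M ((0 : M), (0 : M)) W W0'.
have nN : nbhs (0 : M) ((A `&` B) `&` (-%R @^-1` (A `&` B))).
  apply: filterI; first exact: filterI.
  by apply: (@opp_continuous M 0); rewrite oppr0; exact: filterI.
exists ((A `&` B) `&` (-%R @^-1` (A `&` B))); split => //.
- by move=> x [? ?]; split => //=; rewrite opprK.
- by move=> x y [[Ax _] _] [[_ By] _]; exact: (AB (x, y)).
Qed.

Lemma nbhs_shift x W : nbhs x W <-> nbhs (0 : M) [set y | W (x + y)].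
Proof.
split => nW.
- have c : {for (0 : M), continuous (fun y => x + y)}.
    apply: (continuous_comp (f := fun y : M => (x, y))
      (g := fun p : M * M => p.1 + p.2)); last exact: add_continuous.
    by apply: cvg_pair => /=; [exact: cvg_cst|exact: cvg_id].
  by have := c W; rewrite addr0; apply.
- have c : {for x, continuous (fun y => - x + y)}.
    apply: (continuous_comp (f := fun y : M => (- x, y))
      (g := fun p : M * M => p.1 + p.2)); last exact: add_continuous.
    by apply: cvg_pair => /=; [exact: cvg_cst|exact: cvg_id].
  have := c [set y | W (x + y)]; rewrite addNr => /(_ nW) h.
  have : nbhs x [set y | W (x + (- x + y))] by [].
  by apply: filterS => y /=; rewrite addNKr.
Qed.

Lemma closureP0 H x :
  closure H x <-> forall W, nbhs (0 : M) W -> exists h, H h /\ W (x - h).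
Proof.
split => [cH W /nbhs0_split[V [V0 sV VV]]|cH B /nbhs_shift nB].
- have /cH [h [Hh]] : nbhs x [set y | V (y - x)].
    by apply/nbhs_shift; apply: filterS V0 => y /=; rewrite addrC addKr.
  move=> /= Vh; exists h; split => //.
  rewrite -(addr0 (x - h)); apply: VV; last exact: nbhs_singleton.
  by rewrite -opprB; exact: sV.
- have /nbhs0_split[V [V0 sV VV]] := nB.
  have [h [Hh Vh]] := cH V V0; exists h; split => //.
  have := VV _ 0 (sV _ Vh) (nbhs_singleton V0).
  by rewrite addr0 /= opprB addrC subrK.
Qed.

Definition addS A B : set M := [set z | exists x y, [/\ A x, B y & z = x + y]].

Lemma addSP A B x y : A x -> B y -> addS A B (x + y).
Proof. by move=> *; exists x, y. Qed.

Lemma compact_addS K H : compact K -> compact H -> compact (addS K H).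
Proof.
move=> cK cH.
have -> : addS K H = (fun p : M * M => p.1 + p.2) @` (K `*` H).
  rewrite predeqE => z; split => [[x [y [Kx Hy ->]]]|[[x y] [/= Kx Hy] <-]].
    by exists (x, y).
  by exists x, y.
apply: continuous_compact; last exact: compact_setX.
by apply: continuous_subspaceT; exact: add_continuous.
Qed.

Lemma compact_image (f : M -> M) K : continuous f -> compact K -> compact (f @` K).
Proof. by move=> cf cK; apply: continuous_compact => //; exact: continuous_subspaceT. Qed.

Lemma sg0 H : is_subgroup H -> H 0. Proof. by case. Qed.
Lemma sgB H x y : is_subgroup H -> H x -> H y -> H (x - y).
Proof. by case=> _; apply. Qed.
Lemma sgN H x : is_subgroup H -> H x -> H (- x).
Proof. by move=> sH Hx; rewrite -sub0r; apply: sgB => //; exact: sg0. Qed.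
Lemma sgD H x y : is_subgroup H -> H x -> H y -> H (x + y).
Proof. by move=> sH Hx Hy; rewrite -(opprK y); apply: sgB => //; exact: sgN. Qed.
Lemma sgMn H x n : is_subgroup H -> H x -> H (x *+ n).
Proof.
move=> sH Hx; elim: n => [|n IH]; first by rewrite mulr0n; exact: sg0.
by rewrite mulrS; exact: sgD.
Qed.
Lemma sgMz H x (n : int) : is_subgroup H -> H x -> H (x *~ n).
Proof.
move=> sH Hx; case: n => n; first exact: sgMn.
by rewrite NegzE mulrNz; apply: sgN => //; exact: sgMn.
Qed.
Lemma sg_sum H (I : Type) (r : seq I) (P : pred I) (F : I -> M) : is_subgroup H ->
  (forall i, P i -> H (F i)) -> H (\sum_(i <- r | P i) F i).
Proof.
move=> sH HF; apply: (big_ind H) => //; first exact: sg0.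
by move=> *; exact: sgD.
Qed.
Lemma sgI H K : is_subgroup H -> is_subgroup K -> is_subgroup (H `&` K).
Proof.
move=> sH sK; split; first by split; exact: sg0.
by move=> x y [? ?] [? ?]; split; exact: sgB.
Qed.
Lemma sg_addS H K : is_subgroup H -> is_subgroup K -> is_subgroup (addS H K).
Proof.
move=> sH sK; split; first by exists 0, 0; rewrite addr0; split => //; exact: sg0.
move=> _ _ [x [y [? ? ->]]] [z [t [? ? ->]]].
by exists (x - z), (y - t); split; [exact: sgB|exact: sgB|rewrite opprD addrACA].
Qed.
Lemma addSl H K : is_subgroup K -> H `<=` addS H K.
Proof. by move=> sK x Hx; rewrite -(addr0 x); apply: addSP => //; exact: sg0. Qed.
Lemma addSr H K : is_subgroup H -> K `<=` addS H K.
Proof. by move=> sK x Hx; rewrite -(add0r x); apply: addSP => //; exact: sg0. Qed.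
Lemma addS_sub H K L : is_subgroup L -> H `<=` L -> K `<=` L -> addS H K `<=` L.
Proof. by move=> sL HL KL _ [x [y [? ? ->]]]; apply: sgD; auto. Qed.

Lemma sg_closure H : is_subgroup H -> is_subgroup (closure H).
Proof.
move=> sH; split; first by apply: subset_closure; exact: sg0.
move=> x y /closureP0 cx /closureP0 cy; apply/closureP0 => W nW.
have [V [V0 sV VV]] := nbhs0_split nW.
have [h [Hh Vh]] := cx V V0; have [k [Hk Vk]] := cy V V0.
exists (h - k); split; first exact: sgB.
have -> : x - y - (h - k) = (x - h) + - (y - k) by zmod.
by apply: VV => //; exact: sV.
Qed.

(** Total boundedness, with centres in [X] itself although [X] need not be closed. Without a finite
    net the uncovered parts of [X] generate a filter; near a cluster point [p] there are a point [y]
    of [X] and a point not covered by [y], which are nevertheless close. *)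
Lemma compact_net K W X : compact K -> X `<=` K -> nbhs (0 : M) W ->
  exists s : seq M, (forall y, y \in s -> X y) /\
    forall x, X x -> exists2 y, y \in s & W (x - y).
Proof.
move=> cK XK nW.
have [V [V0 sV VV]] := nbhs0_split nW.
pose bad (s : seq M) := [set x | X x /\ forall y, y \in s -> X y -> ~ W (x - y)].
apply: contrapT => nos.
have badn s : bad s !=set0.
  apply: contrapT => bs; apply: nos; exists [seq y <- s | `[<X y>]].
  split => [y|x Xx]; first by rewrite mem_filter => /andP[/asboolP].
  apply: contrapT => nx; apply: bs; exists x; split => // y ys Xy Wy.
  by apply: nx; exists y => //; rewrite mem_filter ys andbT; exact/asboolP.
pose F : set_system M := [set S | exists s, bad s `<=` S].
have FF : ProperFilter F.
  apply: Build_ProperFilter_ex.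
    by move=> S [s bS]; have [x /bS] := badn s; exists x.
  split.
  - by exists [::].
  - move=> S T [s sS] [t tT]; exists (s ++ t) => x [Xx bx]; split.
      by apply: sS; split => // y ys; apply: bx; rewrite mem_cat ys.
    by apply: tT; split => // y ys; apply: bx; rewrite mem_cat ys orbT.
  - by move=> S T ST [s sS]; exists s => x /sS /ST.
have FK : F K by exists [::] => x [/XK].
have [p [Kp clp]] := cK F FF FK.
have np : nbhs p [set x | V (x - p)].
  by apply/nbhs_shift; apply: filterS V0 => y /=; rewrite addrC addKr.
have [y [[Xy _] Vy]] := clp _ _ (ex_intro _ [::] (fun x h => h) : F (bad [::])) np.
have [x [[_ bx] Vx]] := clp _ _ (ex_intro _ [:: y] (fun x h => h) : F (bad [:: y])) np.
apply: (bx y); rewrite ?inE // (_ : x - y = (x - p) + - (y - p)).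
  by apply: VV => //; exact: sV.
by rewrite opprB addrA subrK.
Qed.

(** The finite intersection property for directed families, the substitute for convergent
    subsequences; [i0] makes the index type nonempty. *)
Lemma compact_dir (I : Type) (i0 : I) K (F : I -> set M) : compact K ->
  (forall i, closed (F i)) ->
  (forall i j, exists k, F k `<=` F i /\ F k `<=` F j) ->
  (forall i, exists x, K x /\ F i x) ->
  exists x, K x /\ forall i, F i x.
Proof.
move=> cK clF dF neF.
pose G : set_system M := [set S | exists i, K `&` F i `<=` S].
have GG : ProperFilter G.
  apply: Build_ProperFilter_ex.
    by move=> S [i iS]; have [x [Kx Fx]] := neF i; exists x; exact: iS.
  split.
  - by exists i0.
  - move=> S T [i iS] [j jT]; have [k [ki kj]] := dF i j.
    by exists k => x [Kx Fx]; split; [apply: iS; split => //; exact: ki|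
      apply: jT; split => //; exact: kj].
  - by move=> S T ST [s sS]; exists s => x /sS /ST.
have GK : G K by exists i0 => x [].
have [p [Kp clp]] := cK G GG GK.
exists p; split => // i; apply: clF => B nB.
have GFi : G (F i) by exists i => x [].
have [y [Fy By]] := clp (F i) B GFi nB.
by exists y.
Qed.

Lemma compact_cluster_seq K (u : nat -> M) :
  compact K -> (forall n, K (u n)) -> exists p, K p /\
  forall W, nbhs (0 : M) W -> forall N, exists n, (N <= n)%N /\ W (p - u n).
Proof.
move=> cK Ku.
have [] := @compact_dir nat 0%N K (fun n => closure [set y | exists m, (n <= m)%N /\ y = u m]).
- exact: cK.
- by move=> n; exact: closed_closure.
- move=> i j; exists (maxn i j); split; apply: closureS => y [m [lm ->]]; exists m;
    split => //; apply: leq_trans lm; rewrite ?leq_maxl ?leq_maxr //.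
- by move=> n; exists (u n); split => //; apply: subset_closure; exists n.
move=> p [Kp hp]; exists p; split => // W nW N.
by have [_ [[m [Nm ->]] Wm]] := (closureP0 _ _).1 (hp N) W nW; exists m.
Qed.

Lemma compact_dir_open (I : Type) (i0 : I) (F : I -> set M) O :
  hausdorff_space M -> (forall i, compact (F i)) ->
  (forall i j, exists k, F k `<=` F i /\ F k `<=` F j) ->
  open O -> (forall x, (forall i, F i x) -> O x) ->
  exists i, F i `<=` O.
Proof.
move=> hM cF dF oO FO; apply: contrapT => nF.
have := @compact_dir I i0 (F i0) (fun i => F i `\` O) (cF i0).
case.
- by move=> i; apply: closedI; [exact: compact_closed|exact: open_closedC].
- by move=> i j; have [k [ki kj]] := dF i j; exists k; split => x [Fx Ox];
    split => //; [exact: ki|exact: kj].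
- move=> i; have [k [ki kj]] := dF i i0.
  apply: contrapT => nx; apply: nF; exists k => x Fx; apply: contrapT => nO.
  by apply: nx; exists x; split; [exact: kj|split => //; exact: ki].
- by move=> x [_ Fx]; have [] := Fx i0 => _; apply; apply: FO => i; have [] := Fx i.
Qed.

(** The topological pigeonhole principle behind the periodicity arguments: two terms near one
    cluster point are near each other. *)
Lemma compact_recurrence K (u : nat -> M) W : compact K -> (forall n, K (u n)) ->
  nbhs (0 : M) W -> exists i j, (i < j)%N /\ W (u i - u j).
Proof.
move=> cK Ku nW; have [V [V0 sV VV]] := nbhs0_split nW.
have [p [Kp clp]] : exists p, K p /\ cluster (u @ \oo) p.
  have [|p []] := cK (u @ \oo); last by exists p.
  by exists 0%N => // n _ /=; exact: Ku.
have np : nbhs p [set x | V (x - p)].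
  by apply/nbhs_shift; apply: filterS V0 => y /=; rewrite addrC addKr.
have key n : exists m, (n <= m)%N /\ V (u m - p).
  have Fn : (u @ \oo) [set x | exists m, (n <= m)%N /\ x = u m].
    by exists n => // m /= nm; exists m.
  by have [x [[m [nm ->]] Vx]] := clp _ _ Fn np; exists m.
have [i [_ Vi]] := key 0%N; have [j [ij Vj]] := key i.+1.
exists i, j; split => //; rewrite (_ : u i - u j = (u i - p) + - (u j - p)).
  by apply: VV => //; exact: sV.
by rewrite opprB addrA subrK.
Qed.

(** Closedness at 0 suffices: a limit point [x] has some [h] in [H] so near that [x - h] is a limit
    of elements of [H] inside [W], hence of [K]. *)
Lemma sg_locally_closed H K W : is_subgroup H -> nbhs (0 : M) W -> closed K ->
  H `&` W `<=` K -> K `<=` H -> closed H.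
Proof.
move=> sH nW cK HWK KH x /closureP0 cx.
have [V [V0 sV VV]] := nbhs0_split nW.
have [h [Hh Vh]] := cx V V0.
suff : H (x - h) by move=> Hxh; rewrite -(subrK h x); exact: sgD.
apply/KH/cK/closureP0 => U nU.
have [k [Hk [Uk Vk]]] := cx (U `&` V) (filterI nU V0).
exists (k - h); split.
  apply: HWK; split; first exact: sgB.
  rewrite (_ : k - h = - (x - k) + (x - h)); first by apply: VV => //; exact: sV.
  by rewrite opprB addrA subrK.
by rewrite opprB addrA subrK.
Qed.

Lemma sg_open H W : is_subgroup H -> nbhs (0 : M) W -> W `<=` H -> open H.
Proof.
move=> sH nW WH; rewrite openE => x Hx; apply/nbhs_shift.
by apply: filterS nW => y /WH Hy; exact: sgD.
Qed.

Lemma sg_open_closed H : is_subgroup H -> nbhs (0 : M) H -> closed H.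
Proof.
move=> sH nH x /closureP0 /(_ H nH)[h [Hh]] Hxh.
by rewrite -(subrK h x); exact: sgD.
Qed.

Lemma closed_subr K x : closed K -> closed [set y | K (x - y)].
Proof.
move=> cK y /closureP0 cy; apply/cK/closureP0 => W nW.
have [|h [Kh Wh]] := cy [set y | W (- y)].
  by apply: (@opp_continuous M 0); rewrite oppr0.
exists (x - h); split => //.
by have -> : x - y - (x - h) = - (y - h) by zmod.
Qed.

Lemma nbhs0_eq0 x : hausdorff_space M -> (forall W, nbhs (0 : M) W -> W x) -> x = 0.
Proof.
move=> hM h; apply/esym/hM => P Q nP nQ; exists x; split; first exact: h.
exact: nbhs_singleton.
Qed.

Lemma seq_pigeonhole (s : seq M) (f : nat -> M) : (forall n, f n \in s) ->
  exists i j, (i < j)%N /\ f i = f j.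
Proof.
move=> fs; have : ~~ uniq [seq f i | i <- iota 0 (size s).+1].
  apply/negP => u; have := uniq_leq_size u (s2 := s).
  rewrite size_map size_iota ltnn => h; suff : false by []; apply: h => _ /mapP[i _ ->].
  exact: fs.
case/(uniqPn 0) => i [j []]; rewrite size_map size_iota => ij js.
have is_ := ltn_trans ij js.
rewrite !(nth_map 0%N) ?size_iota // !nth_iota // !add0n => e.
by exists i, j.
Qed.

Lemma compact_set_seq (s : seq M) : compact [set x | x \in s].
Proof.
elim: s => [|y s IH].
  by rewrite (_ : [set _ | _] = set0); [exact: compact0|rewrite predeqE].
rewrite (_ : [set _ | _] = [set y] `|` [set x | x \in s]).
  by apply: compactU => //; exact: compact_set1.
rewrite predeqE => x /=; rewrite inE; split => [/orP[/eqP|]|[->|->]]; tauto || by rewrite ?eqxx ?orbT.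
Qed.

(** The finitely many cosets of [N'] that miss 0 are closed, so a neighbourhood of 0 avoids all of
    them. *)
Lemma closed_finite_index_open N' N : is_subgroup N' -> closed N' ->
  finite_index N' N -> exists W, nbhs (0 : M) W /\ W `&` N `<=` N'.
Proof.
move=> sN' cN' [F [/finite_seqP[s Fs] [FN NF]]].
have : exists W, nbhs (0 : M) W /\ forall f, f \in s -> ~ N' (- f) ->
    forall w, W w -> ~ N' (w - f).
  elim: s {F Fs FN NF} => [|f s [W [nW Ws]]]; first by exists setT; split => //; exact: filterT.
  have [Nf|Nf] := pselect (N' (- f)).
    by exists W; split => // g; rewrite inE => /predU1P[-> //|]; exact: Ws.
  have : ~ closure N' (- f) by move/cN'.
  move/closureP0 => /existsNP[V /not_implyP[nV hV]].
  have [U [U0 sU UU]] := nbhs0_split nV.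
  exists (W `&` U); split; first exact: filterI.
  move=> g; rewrite inE => /predU1P[->|gs] Ng w [Ww Uw]; last exact: Ws.
  move=> N'w; apply: hV; exists (w - f); split => //.
  have -> : - f - (w - f) = - w by zmod.
  by have := UU _ 0 (sU _ Uw) (nbhs_singleton U0); rewrite addr0 ?sub0r.
move=> [W [nW Ws]]; exists W; split => // x [Wx Nx].
have [f Ff N'x] := NF x Nx.
have fs : f \in s by move: Ff; rewrite Fs.
have [Nf|Nf] := pselect (N' (- f)); last by have := Ws f fs Nf x Wx.
have -> : x = (x - f) - (- f) by zmod.
exact: sgB.
Qed.

Lemma sg_open_in (S U W : set M) : is_subgroup S -> is_subgroup U -> U `<=` S ->
  nbhs (0 : M) W -> W `&` S `<=` U -> open_in S U.
Proof.
move=> sS sU US nW WU.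
exists (\bigcup_(x in U) [set y | W° (y - x)]); split.
  apply: bigcup_open => x _; rewrite openE => y Wy; apply/nbhs_shift.
  have := @nbhs_interior _ _ _ Wy; move/nbhs_shift; apply: filterS => z /=.
  by rewrite /interior /= addrAC.
apply/seteqP; split=> [x Ux|x [[y Uy Wy] Sx]].
  by split; [exists x => //=; rewrite subrr|exact: US].
rewrite -(subrK y x); apply: (sgD sU) => //; apply: WU; split.
  exact: nbhs_singleton Wy.
by apply: (sgB sS) => //; exact: US.
Qed.

Lemma open_in_nbhs (S U : set M) : open_in S U -> U 0 ->
  exists W, nbhs (0 : M) W /\ W `&` S `<=` U.
Proof.
move=> [ O [oO ->]] [ O0 _]; exists O; split => //.
exact: open_nbhs_nbhs.
Qed.

(** Turns a finite quotient [N / U] into a recurrence modulo [U], for any sequence in [N]. *)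
Lemma finite_index_recur (U N : set M) (f : nat -> M) : is_subgroup U ->
  finite_index U N -> (forall n, N (f n)) -> exists i j, (i < j)%N /\ U (f i - f j).
Proof.
move=> sU [Fs [/finite_seqP[l hl] [_ NF]]] Nf.
have /choice[r hr] : forall n, exists y, y \in l /\ U (f n - y).
  by move=> n; have [y Fy Uy] := NF _ (Nf n); exists y; split => //; rewrite hl in Fy.
have [i [j [ij e]]] := seq_pigeonhole (fun n => (hr n).1).
exists i, j; split => //.
have -> : f i - f j = (f i - r i) - (f j - r j) by rewrite e; zmod.
by apply: (sgB sU); [exact: (hr i).2|exact: (hr j).2].
Qed.

End TopologicalGroup.

(** A directed family of compact sets ends up in every open set around its intersection; here that
    open set is the union of [W]-translates of the intersection. *)
Lemma compact_dir_nbhs (M : topologicalZmodType) (I : Type) (i0 : I)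
    (F : I -> set M) (W : set M) :
  hausdorff_space M -> (forall i, compact (F i)) ->
  (forall i j, exists k, F k `<=` F i /\ F k `<=` F j) ->
  nbhs (0 : M) W ->
  exists i, forall x, F i x -> exists y, (forall j, F j y) /\ W (x - y).
Proof.
move=> hM cF dF nW.
pose O := \bigcup_(y in [set y | forall j, F j y]) [set x | W° (x - y)].
have oO : open O.
  apply: bigcup_open => y _; rewrite openE => x Wx; apply/nbhs_shift.
  have /= := @nbhs_interior _ _ _ Wx; move/nbhs_shift; apply: filterS => z /=.
  by rewrite /interior /= addrAC.
have [|i Fi] := compact_dir_open i0 hM cF dF oO.
  by move=> x Fx; exists x => //=; rewrite subrr.
exists i => x /Fi[y Fy Wy]; exists y; split => //; exact: nbhs_singleton.
Qed.

(** * Contraction and level subgroups of a module without connected part *)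

Section Action.
Variables (A M : topologicalZmodType) (act : A -> M -> M).
Hypothesis hM : hausdorff_space M.
Hypothesis hact : is_action act.
Implicit Types (a b : A) (x y z : M) (C D : set M).

Lemma actD a x y : act a (x + y) = act a x + act a y.
Proof. by case: hact. Qed.
Lemma act0 x : act 0 x = x. Proof. by case: hact. Qed.
Lemma actA a b x : act a (act b x) = act (a + b) x.
Proof. by case: hact. Qed.
Lemma actr0 a : act a 0 = 0.
Proof. by apply: (addrI (act a 0)); rewrite -actD !addr0. Qed.
Lemma actN a x : act a (- x) = - act a x.
Proof. by apply/eqP; rewrite -addr_eq0 -actD addNr actr0. Qed.
Lemma actB a x y : act a (x - y) = act a x - act a y.
Proof. by rewrite actD actN. Qed.
Lemma actC a b x : act a (act b x) = act b (act a x).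
Proof. by rewrite !actA addrC. Qed.
Lemma actK a : cancel (act a) (act (- a)).
Proof. by move=> x; rewrite actA addNr act0. Qed.
Lemma actNK a : cancel (act (- a)) (act a).
Proof. by move=> x; rewrite actA addrN act0. Qed.
Lemma act_sum a (I : Type) (r : seq I) (P : pred I) (F : I -> M) :
  act a (\sum_(i <- r | P i) F i) = \sum_(i <- r | P i) act a (F i).
Proof. by apply: (big_morph _ (actD a) (actr0 a)). Qed.

Lemma act_continuous a : continuous (act a).
Proof.
move=> x; apply: (continuous_comp (f := fun y : M => (a, y))
  (g := fun p : A * M => act p.1 p.2)).
  by apply: cvg_pair => /=; [exact: cvg_cst|exact: cvg_id].
by case: hact => _ _ _; apply.
Qed.

Lemma act_nbhs a W : nbhs (0 : M) W -> nbhs (0 : M) [set x | W (act a x)].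
Proof. by move=> nW; apply: (@act_continuous a); rewrite actr0. Qed.

Lemma actMnD a i j x : act (a *+ i) (act (a *+ j) x) = act (a *+ (i + j)) x.
Proof. by rewrite actA mulrnDr. Qed.
Lemma actMnl a i j x : (i <= j)%N ->
  act ((- a) *+ i) (act (a *+ j) x) = act (a *+ (j - i)) x.
Proof. by move=> ij; rewrite actA mulrnBr // mulNrn addrC. Qed.
Lemma actMnr a i j x : (j <= i)%N ->
  act ((- a) *+ i) (act (a *+ j) x) = act ((- a) *+ (i - j)) x.
Proof. by move=> ij; rewrite actA mulrnBr // !mulNrn opprK. Qed.
Lemma actMnl' a i j x : (i <= j)%N ->
  act (a *+ i) (act ((- a) *+ j) x) = act ((- a) *+ (j - i)) x.
Proof. by move=> ij; rewrite -{1}(opprK a) actMnl. Qed.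
Lemma actMnr' a i j x : (j <= i)%N ->
  act (a *+ i) (act ((- a) *+ j) x) = act (a *+ (i - j)) x.
Proof. by move=> ij; rewrite -{1 3}(opprK a) actMnr // opprK. Qed.
Lemma actMnK a n x : act ((- a) *+ n) (act (a *+ n) x) = x.
Proof. by rewrite actMnl // subnn mulr0n act0. Qed.
Lemma actMnNK a n x : act (a *+ n) (act ((- a) *+ n) x) = x.
Proof. by rewrite actMnl' // subnn mulr0n act0. Qed.

Lemma closure_act b (S T : set M) x : (forall y, S y -> T (act b y)) ->
  closure S x -> closure T (act b x).
Proof.
move=> ST /closureP0 cx; apply/closureP0 => W nW.
have [h [Sh Wh]] := cx _ (act_nbhs b nW).
by exists (act b h); split; [exact: ST|rewrite -actB].
Qed.

Lemma closed_act b (S : set M) : closed S -> closed [set x | S (act b x)].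
Proof. by move=> cS x cx; apply: cS; apply: closure_act cx => y. Qed.

Lemma compact_act b (S : set M) : compact S -> compact [set x | S (act b x)].
Proof.
move=> cS; rewrite (_ : [set _ | _] = act (- b) @` S).
  by apply: compact_image => //; exact: act_continuous.
rewrite predeqE => x; split => [Sx|[y Sy <-]] /=; last by rewrite actNK.
by exists (act b x); rewrite ?actK.
Qed.

Lemma sg_act b (S : set M) : is_subgroup S -> is_subgroup [set x | S (act b x)].
Proof.
move=> sS; split => /=; first by rewrite actr0; exact: sg0.
by move=> x y ? ?; rewrite actB; exact: sgB.
Qed.

(** * Compact relatively open subgroups of L and the orbits of one element *)

Variable L : set M.
Hypothesis mL : alg_submodule act L.
Hypothesis cL : closed L.

(** Openness is relative to [L]: in the application [L] is the union of the compact subgroups, which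
    is not open once there is a Euclidean part. *)
Definition osub C := [/\ is_subgroup C, C `<=` L, compact C &
  exists W, nbhs (0 : M) W /\ W `&` L `<=` C].

(** In Willis's notation, with [C] for U, [stays C (- a)] is U_+ and [stays C a] is U_-, while
    [enters C a] is U_--, the union of the backward translates of U_-. *)
Definition stays C a := [set x | forall n, C (act (a *+ n) x)].
Definition enters C a :=
  [set x | exists n0, forall n, (n0 <= n)%N -> C (act (a *+ n) x)].
Definition homoclinic C a := enters C a `&` enters C (- a).

Lemma osub_sg C : osub C -> is_subgroup C. Proof. by case. Qed.
Lemma osub_L C : osub C -> C `<=` L. Proof. by case. Qed.
Lemma osub_compact C : osub C -> compact C. Proof. by case. Qed.
Lemma osub_nbhs C : osub C -> exists W, nbhs (0 : M) W /\ W `&` L `<=` C.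
Proof. by case. Qed.
Lemma osub_closed C : osub C -> closed C.
Proof. by move=> oC; apply: compact_closed => //; exact: osub_compact. Qed.

Lemma L_act a x : L (act a x) <-> L x.
Proof.
by split=> [|h]; [move/(mL.2 (- a)); rewrite actK|exact: mL.2].
Qed.

Lemma osubI C D : osub C -> osub D -> osub (C `&` D).
Proof.
move=> oC oD; case: (oC) (oD) => sC CL kC [W [nW WC]] [sD DL kD [V [nV VD]]].
split; first exact: sgI.
- by move=> x [/CL].
- by apply: (subclosed_compact _ kC); [apply: closedI; exact: osub_closed|move=> x []].
- by exists (W `&` V); split; [exact: filterI|move=> x [[? ?] ?]; split;
    [exact: WC|exact: VD]].
Qed.

Lemma osub_act b C : osub C -> osub [set x | C (act b x)].
Proof.
case=> sC CL kC [W [nW WC]]; split.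
- exact: sg_act.
- by move=> x /CL /L_act.
- exact: compact_act.
- exists [set x | W (act b x)]; split; first exact: act_nbhs.
  by move=> x [Wx Lx]; apply: WC; split => //; exact/L_act.
Qed.

Lemma osub_range C a n : osub C ->
  osub [set x | forall i, (i <= n)%N -> C (act (a *+ i) x)].
Proof.
move=> oC; elim: n => [|n IH].
  rewrite (_ : [set _ | _] = C) // predeqE => x; split.
    by move=> /(_ 0%N isT); rewrite mulr0n act0.
  by move=> Cx [] // _; rewrite mulr0n act0.
rewrite (_ : [set _ | _] = [set x | forall i, (i <= n)%N -> C (act (a *+ i) x)]
  `&` [set x | C (act (a *+ n.+1) x)]).
  by apply: osubI => //; exact: osub_act.
rewrite predeqE => x; split => [h|[h1 h2] i] /=.
  by split => [i il|]; apply: h => //; exact: leqW.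
by rewrite leq_eqVlt => /predU1P[->|] //; exact: h1.
Qed.

Lemma osubU C D : osub C -> is_subgroup D -> compact D -> D `<=` L ->
  osub (addS C D).
Proof.
case=> sC CL kC [W [nW WC]] sD kD DL; split.
- exact: sg_addS.
- by apply: addS_sub => //; case: mL.
- exact: compact_addS.
- by exists W; split => // x /WC; apply: addSl.
Qed.

Lemma stays_sub C a : stays C a `<=` C.
Proof. by move=> x /(_ 0%N); rewrite mulr0n act0. Qed.
Lemma stays_sg C a : is_subgroup C -> is_subgroup (stays C a).
Proof.
move=> sC; split => [n|x y hx hy n]; first by rewrite actr0 //; exact: sg0.
by rewrite actB //; exact: sgB.
Qed.
Lemma stays_closed C a : closed C -> closed (stays C a).
Proof.
move=> cC x cx n.
suff : closure [set y | C (act (a *+ n) y)] x by move/(closed_act cC).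
by apply: closureS cx => y; exact.
Qed.
Lemma stays_compact C a : osub C -> compact (stays C a).
Proof.
move=> oC; apply: (subclosed_compact _ (osub_compact oC)).
  by apply: stays_closed; exact: osub_closed.
exact: stays_sub.
Qed.
Lemma stays_act C a k x : stays C a x -> stays C a (act (a *+ k) x).
Proof. by move=> h n; rewrite actMnD. Qed.
Lemma staysS C D a : C `<=` D -> stays C a `<=` stays D a.
Proof. by move=> CD x h n; exact: CD. Qed.
Lemma stays_step C a x : C x -> stays C a (act a x) -> stays C a x.
Proof.
by move=> Cx h [|n]; rewrite ?mulr0n ?act0 // mulrSr -actA.
Qed.

Lemma entersE C a x : enters C a x <-> exists k, stays C a (act (a *+ k) x).
Proof.
split=> [[k h]|[k h]]; exists k => n; first by rewrite actMnD //; apply: h; exact: leq_addl.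
by move=> kn; have := h (n - k)%N; rewrite actMnD // subnK.
Qed.
Lemma enters_sg C a : is_subgroup C -> is_subgroup (enters C a).
Proof.
move=> sC; split => [|x y [n hn] [m hm]].
  by exists 0%N => n _; rewrite actr0 //; exact: sg0.
exists (maxn n m) => k; rewrite geq_max => /andP[nk mk].
by rewrite actB //; apply: sgB => //; [exact: hn|exact: hm].
Qed.
Lemma stays_enters C a : stays C a `<=` enters C a.
Proof. by move=> x h; exists 0%N => n _. Qed.
Lemma entersS C D a : C `<=` D -> enters C a `<=` enters D a.
Proof. by move=> CD x [n h]; exists n => m /h /CD. Qed.
Lemma enters_act C a k x : enters C a x -> enters C a (act (a *+ k) x).
Proof.
move=> [n h]; exists n => m nm; rewrite actMnD //; apply: h.
exact: leq_trans nm (leq_addr _ _).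
Qed.
Lemma enters_actN C a k x : enters C a x -> enters C a (act ((- a) *+ k) x).
Proof.
move=> [n h]; exists (n + k)%N => m nm; rewrite actMnr' //; last first.
  exact: leq_trans (leq_addl _ _) nm.
by apply: h; rewrite -(addnK k n) leq_sub2r.
Qed.
Lemma enters_act' C a b x : enters [set y | C (act b y)] a x <-> enters C a (act b x).
Proof.
by split => -[n h]; exists n => m /h /=; rewrite actC.
Qed.
Lemma enters_L C a x : osub C -> enters C a x -> L x.
Proof. by move=> oC [n /(_ n (leqnn n)) /(osub_L oC)/L_act]. Qed.

Lemma homoclinicN C a : homoclinic C (- a) = homoclinic C a.
Proof. by rewrite /homoclinic opprK setIC. Qed.
Lemma homoclinic_sg C a : is_subgroup C -> is_subgroup (homoclinic C a).
Proof. by move=> sC; apply: sgI; exact: enters_sg. Qed.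
Lemma homoclinic_act C a k x : homoclinic C a x -> homoclinic C a (act (a *+ k) x).
Proof.
move=> [h1 h2]; split; first exact: enters_act.
by have := enters_actN k h2; rewrite opprK.
Qed.
Lemma homoclinic_actN C a k x :
  homoclinic C a x -> homoclinic C a (act ((- a) *+ k) x).
Proof. by rewrite -homoclinicN; exact: homoclinic_act. Qed.

(* Tidiness above in the sense of Willis: intersecting enough translates of C makes
   its elements split into a forward and a backward bounded part. *)
Lemma tidy_above C a : osub C -> exists C', [/\ osub C', C' `<=` C &
  C' `<=` addS (stays C' (- a)) (stays C' a)].
Proof.
move=> oC; have sC := osub_sg oC.
pose F n := [set x | forall i, (i <= n)%N -> C (act ((- a) *+ i) x)].
have oF n : osub (F n) by exact: osub_range.
have FS n m : (n <= m)%N -> F m `<=` F n.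
  by move=> nm x h i il; apply: h; exact: leq_trans il nm.
have [W [nW WC]] : exists W, nbhs (0 : M) W /\ W `&` L `<=` [set x | C (act a x)].
  by case: (osub_act a oC).
have [N FN] : exists N, forall x, F N x ->
    exists y, (forall j, F j y) /\ W (x - y).
  apply: (compact_dir_nbhs 0%N hM) => //; first by move=> i; exact: osub_compact.
  by move=> i j; exists (maxn i j); split; apply: FS; rewrite ?leq_maxl ?leq_maxr.
pose Cp := stays C (- a).
have sCp : is_subgroup Cp by exact: stays_sg.
have CpL : Cp `<=` L by move=> x /stays_sub /(osub_L oC).
have {WC}FN x : F N x -> exists p, Cp p /\ C (act a (x - p)).
  move=> Fx; have [y [Fy Wy]] := FN x Fx.
  have Cy : Cp y by move=> n; exact: (Fy n n).
  exists y; split => //; apply: WC; split => //.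
  by apply: sgB; [exact: mL.1|exact: osub_L Fx|exact: CpL].
(* If the orbit of [y] is in [C] up to time [k], the point at time [k] is again in [F N].
   Subtracting a nearby element of [Cp], moved back by [k] steps, brings the next point into [C] and
   keeps the earlier ones there. *)
have step k x : F N x -> exists y, [/\ Cp (x - y), F N y &
    forall j, (j <= k)%N -> C (act (a *+ j) y)].
  move=> Fx; elim: k => [|k [y [py Fy yk]]].
    exists x; split => //; first by rewrite subrr; exact: (sg0 sCp).
    by case=> // _; have := Fx 0%N isT; rewrite !mulr0n.
  have [|p [Cpp Cap]] := FN (act (a *+ k) y).
    move=> i iN; have [ik|ki] := leqP i k; first by rewrite actMnl //; apply: yk; exact: leq_subr.
    by rewrite actMnr //; [apply: Fy; apply: leq_trans (leq_subr _ _) iN|exact: ltnW].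
  pose q := act ((- a) *+ k) p.
  have Cpq : Cp q by exact: stays_act.
  exists (y - q); split.
  - by rewrite opprB addrA addrAC; exact: (sgD sCp).
  - by move=> i iN; rewrite actB //; apply: sgB => //; exact: Fy.
  - move=> j; rewrite leq_eqVlt => /predU1P[->|jk].
      move: Cap; rewrite mulrS -actA // [act (a *+ k) (_ - _)]actB //.
      by rewrite /q actMnNK.
    rewrite actB //; apply: sgB => //; first exact: yk.
    by rewrite /q actMnl' //; exact: Cpp.
exists (F N); split => //.
  by move=> x /(_ 0%N isT); rewrite mulr0n act0.
move=> x Fx.
(* Compactness of [F N] yields one [y] that works for all [k]; then [x - y] is the backward bounded
   part and [y] the forward bounded one. *)
have [] := @compact_dir M nat 0%N (F N)
  (fun k => [set y | Cp (x - y) /\ forall j, (j <= k)%N -> C (act (a *+ j) y)]).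
- exact: osub_compact.
- move=> k; apply: (@closedI _ [set y | Cp (x - y)]
    [set y | forall j, (j <= k)%N -> C (act (a *+ j) y)]).
    by apply: closed_subr; apply: stays_closed; exact: osub_closed.
  exact: osub_closed (osub_range _ _ oC).
- move=> i j; exists (maxn i j); split=> y [? h]; split => // l li; apply: h.
    exact: leq_trans li (leq_maxl _ _).
  exact: leq_trans li (leq_maxr _ _).
- by move=> k; have [y [? ? ?]] := step k x Fx; exists y.
- move=> y [Fy h]; exists (x - y), y; split; last by rewrite subrK.
    by move=> n i iN; rewrite actMnD //; have [] := h 0%N.
  move=> n i iN; have [ik|ki] := leqP i n.
    by rewrite actMnl //; have [_] := h n; apply; exact: leq_subr.
  by rewrite actMnr //; [apply: Fy; apply: leq_trans (leq_subr _ _) iN|exact: ltnW].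
Qed.

(** A homoclinic point leaves [Cp] through [X], the homoclinic points one step ahead of [Cp]. A
    finite net of [X] consists of points that share an entry time [k], and modulo such points the
    exit can be delayed until nothing is left. *)
Lemma homoclinic_bounded C a : osub C ->
  exists K, compact K /\ homoclinic C a `<=` K.
Proof.
move=> oC; have sC := osub_sg oC; have [W [nW WC]] := osub_nbhs oC.
pose H := homoclinic C a; pose Cp := stays C (- a).
have sCp : is_subgroup Cp by exact: stays_sg.
have sH : is_subgroup H by exact: homoclinic_sg.
have HL : H `<=` L by move=> x [/(enters_L oC)].
pose X := H `&` [set x | Cp (act (- a) x)].
have [||s [sX Xs]] := @compact_net M [set x | Cp (act (- a) x)] W X _ _ nW.
- by apply: compact_act => //; exact: stays_compact.
- by move=> x [].
have [k sk] : exists k, forall y, y \in s -> stays C a (act (a *+ k) y).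
  elim: s sX {Xs} => [|y s IH] sX; first by exists 0%N.
  have [|k hk] := IH; first by move=> z zs; apply: sX; rewrite inE zs orbT.
  have [[/entersE[l hl] _] _] := sX y (mem_head _ _).
  exists (k + l)%N => z; rewrite inE => /predU1P[->|zs].
    by rewrite -actMnD //; exact: stays_act.
  by rewrite addnC -actMnD //; apply: stays_act; exact: hk.
pose Km := [set y | stays C a (act (a *+ k) y)].
have sKm : is_subgroup Km by apply: sg_act => //; exact: stays_sg.
exists (addS Cp Km); split.
  apply: compact_addS; first exact: stays_compact.
  by apply: compact_act => //; exact: stays_compact.
have sR := sg_addS sCp sKm.
(* Induction on the number of backward steps needed to reach [Cp]. A net point [y] is split off at
   the exit; the rest [c] is in [C] with its predecessor in [Cp], hence in [Cp] itself, one step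
   earlier than before. *)
have claim n x : H x -> Cp (act ((- a) *+ n) x) -> addS Cp Km x.
  elim: n x => [|n IH] x Hx; first by rewrite mulr0n act0 // => /(addSl sKm).
  rewrite mulrS -actA // => Cpx.
  have Xx : X (act ((- a) *+ n) x) by split => //; exact: homoclinic_actN.
  have [y ys Wy] := Xs _ Xx; have [Hy Cy] := sX y ys.
  pose c := act ((- a) *+ n) x - y.
  have Hc : H c by apply: (sgB sH) => //; exact: Xx.1.
  have Cc : C c by apply: WC; split => //; exact: HL.
  have Cpc : Cp c.
    by apply: stays_step => //; rewrite /c actB //; exact: (sgB sCp).
  have -> : x = act (a *+ n) y + act (a *+ n) c.
    by rewrite -actD // /c addrC subrK actMnNK.
  apply: (sgD sR).
    apply: (addSr sCp); rewrite /Km /= actA // addrC -actA //; apply: stays_act.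
    exact: sk.
  apply: IH; first exact: homoclinic_act.
  by rewrite actMnK.
by move=> x Hx; have [_ /entersE[n hn]] := Hx; exact: (claim n).
Qed.

(** * Closures of homoclinic groups and the nub *)

Definition hcl C a := closure (homoclinic C a).

Lemma hcl_sg C a : is_subgroup C -> is_subgroup (hcl C a).
Proof. by move=> sC; apply: sg_closure; exact: homoclinic_sg. Qed.
Lemma hcl_closed C a : closed (hcl C a).
Proof. exact: closed_closure. Qed.
Lemma hcl_compact C a : osub C -> compact (hcl C a).
Proof.
move=> /(homoclinic_bounded a)[K [cK HK]].
apply: (subclosed_compact _ cK); first exact: hcl_closed.
by move=> x /(closureS HK); apply: compact_closed.
Qed.
Lemma hcl_L C a : osub C -> hcl C a `<=` L.
Proof.
move=> oC x cx; apply: cL; apply: closureS cx => y [/(enters_L oC)] //.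
Qed.
Lemma hclS C D a : C `<=` D -> hcl C a `<=` hcl D a.
Proof. by move=> CD; apply: closureS => x [? ?]; split; apply: entersS CD _ _. Qed.
Lemma hclN C a : hcl C (- a) = hcl C a.
Proof. by rewrite /hcl homoclinicN. Qed.
Lemma hcl_act C a k x : hcl C a x -> hcl C a (act (a *+ k) x).
Proof. by apply: closure_act => // y; exact: homoclinic_act. Qed.
Lemma hcl_actN C a k x : hcl C a x -> hcl C a (act ((- a) *+ k) x).
Proof. by apply: closure_act => // y; exact: homoclinic_actN. Qed.

Hypothesis basisL : forall W, nbhs (0 : M) W -> exists C, osub C /\ C `<=` W.
Hypothesis ellL : forall X, compact X -> X `<=` L -> exists C, osub C /\ X `<=` C.
Hypothesis paraL : forall N, N `<=` L -> compact_parafinite act N -> N `<=` [set 0].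

Let sgL : is_subgroup L. Proof. by case: mL. Qed.

(** What remains of the homoclinic closures at every scale: the obstruction to tidy subgroups inside
    arbitrarily small neighbourhoods. *)
Definition nub a := [set x | forall C, osub C -> hcl C a x].

Lemma osub_ex : exists C, osub C.
Proof. by have [|C [oC _]] := @basisL setT; [exact: filterT|exists C]. Qed.

Lemma hcl_near a V : nbhs (0 : M) V -> exists C, osub C /\
  forall x, hcl C a x -> exists y, nub a y /\ V (x - y).
Proof.
move=> nV; have [C0 oC0] := osub_ex.
have [[C oC] /= hC] : exists i : {C | osub C}, forall x, hcl (sval i) a x ->
    exists y, (forall j : {C | osub C}, hcl (sval j) a y) /\ V (x - y).
  apply: (compact_dir_nbhs (exist _ C0 oC0) hM) => //.
    by case=> D oD /=; exact: hcl_compact.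
  case=> D oD [D' oD']; exists (exist _ _ (osubI oD oD')) => /=.
  by split; apply: hclS => x [].
exists C; split => // x /hC[y [hy Vy]]; exists y; split => // D oD.
exact: (hy (exist _ D oD)).
Qed.

(* The nub is compact; a proper submodule of finite index in it would be relatively
   open, and following a homoclinic orbit backwards shows that it contains the nub. *)
Lemma nub_eq0 a : nub a `<=` [set 0].
Proof.
have [C0 oC0] := osub_ex.
have nubL : nub a `<=` L by move=> x /(_ C0 oC0); exact: hcl_L.
have snub : is_subgroup (nub a).
  split=> [C oC|x y hx hy C oC]; first exact: (sg0 (hcl_sg a (osub_sg oC))).
  by apply: (sgB (hcl_sg a (osub_sg oC))); [exact: hx|exact: hy].
have cnub : closed (nub a).
  move=> x cx C oC; apply: hcl_closed; apply: closureS cx => y; exact.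
have knub : compact (nub a).
  by apply: (subclosed_compact cnub (hcl_compact (a := a) oC0)) => x /(_ C0 oC0).
have anub b x : nub a x -> nub a (act b x).
  move=> hx C oC; have := hx _ (osub_act b oC).
  by apply: closure_act => y [h1 h2]; split; exact/enters_act'.
apply: paraL => //; split => //.
move=> N' [[sN' aN'] cN'] N'nub fN'.
apply/seteqP; split => //.
have [W [nW WN']] := closed_finite_index_open sN' cN' fN'.
have [C1 [oC1 C1W]] := basisL nW.
(* Being close modulo this [C] gives closeness modulo [C1] both before and after one application of
   [a]. *)
pose C := C1 `&` [set x | C1 (act a x)].
have oC : osub C by apply: osubI => //; exact: osub_act.
have sC := osub_sg oC; have sC1 := osub_sg oC1.
have nubC1 x : nub a x -> C1 x -> N' x by move=> nx /C1W Wx; apply: WN'.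
have [V [nV VC]] := osub_nbhs oC.
have [C2 [oC2 hC2]] := hcl_near a nV.
have {}hC2 x : hcl C2 a x -> exists y, nub a y /\ C (x - y).
  move=> hx; have [y [ny Vy]] := hC2 x hx; exists y.
  split => //; apply: VC; split => //; apply: sgB => //; last exact: nubL.
  exact: hcl_L hx.
pose C3 := C2 `&` C.
have oC3 : osub C3 by exact: osubI.
have key x : homoclinic C3 a x -> addS N' C x.
  move=> hx; have [[n hn] _] := hx.
  (* Backwards from the entry time [n]: the orbit point is a nub element [u] up to [C], and
     [act a u] is a nub element close to the [n'] found one time later. Their difference lies in
     [N'], hence so do [act a u] and [u]. *)
  have down k : (k <= n)%N -> addS N' C (act (a *+ (n - k)) x).
    elim: k => [|k IH] kn.
      rewrite subn0; exists 0, (act (a *+ n) x); rewrite add0r; split => //.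
        exact: sg0.
      by have [] := hn n (leqnn _).
    have [n' [c [N'n Cc e]]] := IH (ltnW kn).
    have [|u [nu Cu]] := hC2 (act (a *+ (n - k.+1)) x).
      by apply: (hclS (D := C2) (C := C3)) => [y []//|]; apply: subset_closure;
        exact: homoclinic_act.
    exists u, (act (a *+ (n - k.+1)) x - u); split => //; last by rewrite addrC subrK.
    suff : N' (act a u) by move/(aN' (- a)); rewrite actK.
    have : N' (act a u - n').
      apply: nubC1; first by apply: (sgB snub); [exact: anub|exact: N'nub].
      have -> : act a u - n' = c - act a (act (a *+ (n - k.+1)) x - u).
        rewrite actB actA -mulrS subnSK // e; zmod.
      by apply: sgB => //; [exact: Cc.1|exact: Cu.2].
    by move=> /(sgD sN') /(_ N'n); rewrite subrK.
  by have := down n (leqnn n); rewrite subnn mulr0n act0.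
move=> x nx.
have : addS N' C x.
  have cl : closed (addS N' C).
    apply: compact_closed => //; apply: compact_addS; last exact: osub_compact.
    by apply: (subclosed_compact cN' knub).
  by apply: cl; apply: closureS key _ _; exact: nx.
move=> [n' [c [N'n Cc e]]]; rewrite e; apply: sgD => //.
apply: nubC1; last exact: Cc.1.
have -> : c = x - n' by rewrite e; zmod.
by apply: (sgB snub) => //; exact: N'nub.
Qed.

(** The last two conditions are tidiness below: an orbit starting in [D] that finally stays in [D]
    has never left it. They make [enters D a] closed. *)
Definition tidy D a := [/\ osub D,
  D `<=` addS (stays D (- a)) (stays D a),
  D `&` enters D a `<=` stays D a & D `&` enters D (- a) `<=` stays D (- a)].

Lemma tidyN D a : tidy D a -> tidy D (- a).
Proof.
case=> oD dD h1 h2; split => //; rewrite ?opprK //.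
by move=> _ /dD[x [y [? ? ->]]]; rewrite addrC; exists y, x.
Qed.
Lemma tidy_osub D a : tidy D a -> osub D. Proof. by case. Qed.

(** Here the vanishing of the nub enters: small [C] have a small closed homoclinic group, and
    [tidy_above] only shrinks [C] further. *)
Lemma small_hcl C0 a : osub C0 -> exists C, [/\ osub C, C `<=` C0,
  hcl C a `<=` C0 & C `<=` addS (stays C (- a)) (stays C a)].
Proof.
move=> oC0.
have [V [nV VC]] := osub_nbhs oC0.
have [C2 [oC2 hC2]] := hcl_near a nV.
have [C [oC CC dC]] := tidy_above a (osubI oC0 oC2).
exists C; split => // [x /CC[]//|x hx].
have hx2 : hcl C2 a x by apply: hclS hx => y /CC[].
have [y [/nub_eq0 y0 Vy]] := hC2 x hx2.
by apply: VC; move: Vy; rewrite y0 subr0; split => //; exact: hcl_L hx2.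
Qed.

(** A nearby [y] in [C] that enters [C] splits as [p + m]; then [p = y - m] is bounded backwards and
    enters forwards, so it is homoclinic. The sum of two compact groups is closed, which permits the
    limit. *)
Lemma closure_enters C a x : osub C ->
  C `<=` addS (stays C (- a)) (stays C a) ->
  closure (enters C a) x -> C x -> addS (stays C a) (hcl C a) x.
Proof.
move=> oC dC cx Cx; have sC := osub_sg oC.
have [W [nW WC]] := osub_nbhs oC.
have cl : closed (addS (stays C a) (hcl C a)).
  by apply: compact_closed => //; apply: compact_addS; [exact: stays_compact|exact: hcl_compact].
apply/cl/closureP0 => V nV.
have [y [ey [Vy Wy]]] := (closureP0 _ _).1 cx _ (filterI nV nW).
exists y; split => //.
have Ly : L y by exact: enters_L ey.
have Cy : C y.
  rewrite (_ : y = x - (x - y)); last by zmod.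
  apply: sgB => //; apply: WC; split => //; apply: sgB => //; exact: osub_L Cx.
have [p [m [hp hm e]]] := dC y Cy.
exists m, p; split => //; last by rewrite addrC.
apply: subset_closure; split; last exact: stays_enters.
rewrite (_ : p = y - m); last by rewrite e; zmod.
by apply: (sgB (enters_sg a sC)) => //; exact: stays_enters.
Qed.

(** Willis's tidying step: enlarging [C] by its closed homoclinic group [Q] removes the orbits that
    leave and come back. *)
Lemma tidy_half C a : osub C -> C `<=` addS (stays C (- a)) (stays C a) ->
  addS C (hcl C a) `&` enters (addS C (hcl C a)) a `<=` stays (addS C (hcl C a)) a.
Proof.
move=> oC dC; set Q := hcl C a; set D := addS C Q.
have sC := osub_sg oC; have sQ : is_subgroup Q by exact: hcl_sg.
have sD : is_subgroup D by exact: sg_addS.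
have CD : C `<=` D by exact: addSl.
have QD : Q `<=` D by exact: addSr.
move=> x [[c [q [Cc Qq e]]] [n0 hn0]].
have [p [m [hp hm e']]] := dC c Cc.
have rest n : D (act (a *+ n) (m + q)).
  rewrite actD; apply: (sgD sD); first by apply: CD; exact: hm.
  by apply: QD; exact: hcl_act.
have ex : x = p + (m + q) by rewrite e e'; zmod.
suff hD n : D (act (a *+ n) p) by move=> n; rewrite ex actD; exact: (sgD sD).
(* At late times the orbit of [p] lies in [stays C (- a) + Q], whose backward orbits remain in [D];
   every time [n] is then reached backwards from a late one. *)
have big k : (n0 <= k)%N -> addS (stays C (- a)) Q (act (a *+ k) p).
  move=> nk.
  have [c' [q' [Cc' Qq' e1]]] : D (act (a *+ k) p).
    rewrite (_ : p = x - (m + q)); last by rewrite ex; zmod.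
    by rewrite actB; apply: (sgB sD) => //; exact: hn0.
  have : addS (stays C (- a)) (hcl C (- a)) c'.
    apply: closure_enters => //.
      by move=> y /dC[u [v [? ? ->]]]; rewrite addrC opprK; exists v, u.
    have sE := sg_closure (enters_sg (- a) sC).
    rewrite (_ : c' = act (a *+ k) p - q'); last by rewrite e1; zmod.
    apply: (sgB sE).
      by have := enters_actN k (stays_enters hp); rewrite opprK; exact: subset_closure.
    by apply: closureS Qq' => y [].
  rewrite hclN => -[s [q2 [hs hq2 e2]]].
  exists s, (q2 + q'); split => //; first exact: (sgD sQ).
  by rewrite e1 e2 addrA.
have [s [q' [hs hq' e1]]] := big (maxn n0 n) (leq_maxl _ _).
have -> : act (a *+ n) p = act ((- a) *+ (maxn n0 n - n)) (act (a *+ maxn n0 n) p).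
  by rewrite actMnl ?leq_subr // subKn // leq_maxr.
rewrite e1 actD; apply: (sgD sD); first by apply: CD; exact: hs.
by apply: QD; exact: hcl_actN.
Qed.

Lemma tidy_basis C0 a : osub C0 -> exists D, tidy D a /\ D `<=` C0.
Proof.
move=> oC0; have [C [oC CC0 QC0 dC]] := small_hcl a oC0.
have sC := osub_sg oC; have sQ : is_subgroup (hcl C a) by exact: hcl_sg.
exists (addS C (hcl C a)); split; last by apply: addS_sub => //; exact: osub_sg.
have CD : C `<=` addS C (hcl C a) by exact: addSl.
have QD : hcl C a `<=` addS C (hcl C a) by exact: addSr.
split.
- by apply: osubU => //; [exact: hcl_compact|exact: hcl_L].
- move=> x [c [q [/dC[p [m [hp hm ->]]] hq ->]]]; exists p, (m + q); split.
  + exact: staysS hp.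
  + apply: (sgD (stays_sg a (sg_addS sC sQ))); first exact: staysS hm.
    by move=> n; apply: QD; exact: hcl_act.
  + by rewrite addrA.
- exact: tidy_half.
- have := @tidy_half C (- a) oC; rewrite hclN; apply.
  by move=> y /dC[u [v [? ? ->]]]; rewrite addrC opprK; exists v, u.
Qed.

Lemma tidy_closed D a : tidy D a -> closed (enters D a).
Proof.
case=> oD _ h _; have [W [nW WD]] := osub_nbhs oD.
apply: (sg_locally_closed (K := stays D a) (enters_sg a (osub_sg oD)) nW).
- by apply: stays_closed; exact: osub_closed.
- move=> x [ex Wx]; apply: h; split => //; apply: WD; split => //; exact: enters_L ex.
- exact: stays_enters.
Qed.

Definition core D a := stays D a `&` stays D (- a).

Lemma core_sg D a : is_subgroup D -> is_subgroup (core D a).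
Proof. by move=> sD; apply: sgI; exact: stays_sg. Qed.
Lemma coreN D a : core D (- a) = core D a.
Proof. by rewrite /core opprK setIC. Qed.
Lemma core_act D a k x : core D a x -> core D a (act (a *+ k) x).
Proof.
move=> [h1 h2]; split; first exact: stays_act.
move=> n; have [kn|nk] := leqP k n; first by rewrite actMnr.
by rewrite actMnl // ltnW.
Qed.
Lemma core_actN D a k x : core D a x -> core D a (act ((- a) *+ k) x).
Proof. by rewrite -coreN; exact: core_act. Qed.
Lemma core_compact D a : osub D -> compact (core D a).
Proof.
move=> oD; apply: (subclosed_compact _ (stays_compact (a := a) oD)); last by move=> x [].
by apply: closedI; apply: stays_closed; exact: osub_closed.
Qed.

Lemma telescope_sg (H : set M) a k x : is_subgroup H ->
  (forall y n, H y -> H (act (a *+ n) y)) -> H (act (a *+ k) x - x) ->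
  forall n, H (act (a *+ (k * n)) x - x).
Proof.
move=> sH aH h; elim=> [|n IH]; first by rewrite muln0 mulr0n act0 subrr; exact: sg0.
rewrite mulnS -actMnD (_ : _ - x = act (a *+ k) (act (a *+ (k * n)) x - x)
  + (act (a *+ k) x - x)); first by apply: sgD => //; exact: aH.
by rewrite actB; zmod.
Qed.

(** Recurrence gives a period [k] with [act (a *+ k) x - x] in [core D a + enters D' a]. By
    telescoping, all points [act (a *+ (k * n)) x] equal [x] modulo this sum, and their limit has a
    full orbit in [D]. *)
Lemma tidy_split D D' a x : tidy D a -> tidy D' a -> D' `<=` D ->
  stays D a x -> exists v, core D a v /\ enters D' a (x - v).
Proof.
move=> tD tD' D'D hx.
have oD := tidy_osub tD; have oD' := tidy_osub tD'.
have sD := osub_sg oD; have sD' := osub_sg oD'.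
have [W [nW WD]] := osub_nbhs oD'.
pose H := addS (core D a) (enters D' a).
have sH : is_subgroup H by apply: sg_addS; [exact: core_sg|exact: enters_sg].
have aH y n : H y -> H (act (a *+ n) y).
  move=> [u [v [? ? ->]]]; rewrite actD.
  by apply: addSP; [exact: core_act|exact: enters_act].
have aHN y n : H y -> H (act ((- a) *+ n) y).
  move=> [u [v [? ? ->]]]; rewrite actD.
  by apply: addSP; [exact: core_actN|exact: enters_actN].
have DH y : stays D a y -> D' y -> H y.
  move=> hy D'y; case: (tD') => _ dD' _ _; have [p [m [hp hm e]]] := dD' y D'y.
  rewrite e; apply: addSP; last exact: stays_enters.
  split; last exact: staysS hp.
  rewrite (_ : p = y - m); last by rewrite e; zmod.
  by apply: (sgB (stays_sg a sD)) => //; exact: staysS hm.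
have [k [k0 Hk]] : exists k, (0 < k)%N /\ H (act (a *+ k) x - x).
  have [||i [j [ij Wij]]] :=
    @compact_recurrence M (stays D a) (fun n => act (a *+ n) x) W _ _ nW.
  - exact: stays_compact.
  - by move=> n; exact: stays_act.
  have hij : stays D a (act (a *+ i) x - act (a *+ j) x).
    by apply: (sgB (stays_sg a sD)); exact: stays_act.
  exists (j - i)%N; split; first by rewrite subn_gt0.
  have : H (act (a *+ i) x - act (a *+ j) x).
    apply: DH => //; apply: WD; split => //.
    by apply: (osub_L oD); exact: stays_sub hij.
  move=> /(aHN _ i); rewrite actB actMnK actMnl ?(ltnW ij) // => /(sgN sH).
  by rewrite opprB.
have Hn := telescope_sg sH aH Hk.
have [] := @compact_dir M nat 0%N (stays D a)
  (fun n => [set w | stays D a (act ((- a) *+ n) w) /\ enters D' a (x - w)]).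
- exact: stays_compact.
- move=> n; apply: (@closedI _ [set w | stays D a (act ((- a) *+ n) w)]
    [set w | enters D' a (x - w)]).
    by apply: closed_act; apply: stays_closed; exact: osub_closed.
  by apply: closed_subr; exact: tidy_closed tD'.
- move=> i j; exists (maxn i j).
  have key l m w : (l <= m)%N -> stays D a (act ((- a) *+ m) w) ->
      stays D a (act ((- a) *+ l) w).
    by move=> lm /(stays_act (m - l)); rewrite actMnl' ?leq_subr // subKn.
  by split=> w [hw ?]; split => //; apply: key hw; rewrite ?leq_maxl ?leq_maxr.
- move=> n; have [c [e [hc he ee]]] := Hn n.
  (* Discarding the core part [c] leaves a point that agrees with [x] modulo [enters D' a] and whose
     backward orbit is in [D] for at least [n] steps, because [n <= k * n]. *)
  pose w := act (a *+ (k * n)) x - c; exists w.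
  have hw : stays D a w by apply: (sgB (stays_sg a sD)); [exact: stays_act|case: hc].
  split => //; split; last first.
    rewrite (_ : x - w = - e); first exact: (sgN (enters_sg a sD')).
    have -> : e = act (a *+ (k * n)) x - x - c by rewrite ee; zmod.
    by rewrite /w; zmod.
  rewrite /w actB actMnl; last by rewrite leq_pmull.
  apply: (sgB (stays_sg a sD)); first exact: stays_act.
  by case: (core_actN n hc).
- move=> w [hw hF]; exists w; split; last by have [] := hF 0%N.
  by split => // n; have [+ _] := hF n; exact: stays_sub.
Qed.

(** * Contraction and level submodules *)

Definition con a := [set x | forall C, osub C -> enters C a x].
Definition lev a := [set x | exists C, osub C /\ core C a x].

Lemma con_L a : con a `<=` L.
Proof. by move=> x h; have [C oC] := osub_ex; exact: enters_L (h C oC). Qed.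
Lemma con_submodule a : alg_submodule act (con a).
Proof.
split; first split.
- by move=> C oC; exact: (sg0 (enters_sg a (osub_sg oC))).
- move=> x y hx hy C oC.
  by apply: (sgB (enters_sg a (osub_sg oC))); [exact: hx|exact: hy].
- by move=> b x hx C oC; apply/enters_act'/hx; exact: osub_act.
Qed.
Lemma con_closed a : closed (con a).
Proof.
move=> x cx C oC; have [D [tD DC]] := tidy_basis a oC.
apply: entersS DC _ _; apply: tidy_closed (tD) _ _; apply: closureS cx => y.
by apply; exact: tidy_osub tD.
Qed.
Lemma lev_L a : lev a `<=` L.
Proof. by move=> x [C [oC [/stays_sub h _]]]; exact: osub_L h. Qed.
Lemma lev_core D a : osub D -> core D a `<=` lev a.
Proof. by move=> oD x; exists D. Qed.
Lemma osub_join C D : osub C -> osub D -> exists E, [/\ osub E, C `<=` E & D `<=` E].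
Proof.
move=> oC oD; have [||E [oE CE]] := @ellL (C `|` D).
- by apply: compactU; exact: osub_compact.
- by move=> x [/(osub_L oC)|/(osub_L oD)].
by exists E; split => // x ?; apply: CE; [left|right].
Qed.
Lemma coreS C D a : C `<=` D -> core C a `<=` core D a.
Proof. by move=> CD x [? ?]; split; apply: staysS CD _ _. Qed.
Lemma lev_submodule a : alg_submodule act (lev a).
Proof.
split; first split.
- by have [C oC] := osub_ex; exists C; split => //; exact: (sg0 (core_sg a (osub_sg oC))).
- move=> x y [C [oC hx]] [D [oD hy]]; have [E [oE CE DE]] := osub_join oC oD.
  exists E; split => //; apply: (sgB (core_sg a (osub_sg oE))).
    exact: coreS hx.
  exact: coreS hy.
- move=> b x [C [oC [h1 h2]]]; exists [set y | C (act (- b) y)].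
  by split; [exact: osub_act|split=> n /=; rewrite actC actK].
Qed.
Lemma levN a : lev (- a) = lev a.
Proof. by rewrite /lev; apply/seteqP; split => x [C [oC h]]; exists C; rewrite ?coreN in h *. Qed.

(** The backward orbit recurs, and tidiness turns the small difference into [act (a *+ k) x - x] in
    [stays D a] with [k = j - i]. Telescoping keeps [act (a *+ (k * n)) x - x] in [D]; for large [n]
    the first term is in [D], hence [x] is. *)
Lemma con_lev0 a x : con a x -> lev a x -> x = 0.
Proof.
move=> cx [C [oC hC]]; apply: nbhs0_eq0 => // W /basisL[C' [oC' C'W]].
have [D [tD DC']] := tidy_basis a oC'.
have oD := tidy_osub tD; have sD := osub_sg oD.
apply/C'W/DC'.
have [V [nV VD]] := osub_nbhs oD.
have [||i [j [ij Vij]]] :=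
    @compact_recurrence M (core C a) (fun n => act ((- a) *+ n) x) V _ _ nV.
- exact: core_compact.
- by move=> n; exact: core_actN.
have ex : enters D a x by exact: cx.
pose y := act ((- a) *+ i) x - act ((- a) *+ j) x.
have ey : enters D a y by apply: (sgB (enters_sg a sD)); exact: enters_actN.
have hy : stays D a y.
  case: tD => _ _ h _; apply: h; split => //; apply: VD; split => //.
  exact: enters_L ey.
have hk : stays D a (act (a *+ (j - i)) x - x).
  have := stays_act j hy; rewrite /y actB actMnNK actMnr' // ltnW //.
have := telescope_sg (stays_sg a sD) (fun y n => @stays_act D a n y) hk.
have [n0 hn0] := ex => /(_ n0) /stays_sub h.
have := sgB sD (hn0 ((j - i) * n0)%N _) h; rewrite opprB addrC subrK; apply.
by rewrite leq_pmull // subn_gt0.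
Qed.

Lemma con_forward a x : con a x -> exists C, osub C /\ stays C a x.
Proof.
move=> cx; have [D oD] := osub_ex; have [n0 h] := cx D oD.
have Lx := con_L cx.
have [||C [oC hC]] := @ellL ([set y | y \in [seq act (a *+ i) x | i <- iota 0 n0]] `|` D).
- by apply: compactU; [exact: compact_set_seq|exact: osub_compact].
- move=> y [/= /mapP[i _ ->]|]; first exact/L_act.
  exact: osub_L.
exists C; split => // n; apply: hC; have [nn|nn] := ltnP n n0.
  by left; apply/mapP; exists n; rewrite // mem_iota.
by right; exact: h.
Qed.

(** The forward orbit of [u] is bounded by contraction, and [u = - (w + v)] bounds the backward one;
    so [u] is both contracted and level. *)
Lemma con_lev_direct a u w v : con a u -> con (- a) w -> lev a v ->
  u + w + v = 0 -> [/\ u = 0, w = 0 & v = 0].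
Proof.
have aux b u' w' v' : con b u' -> con (- b) w' -> lev b v' -> u' + w' + v' = 0 -> u' = 0.
  move=> cu cw [C [oC [h1 h2]]] e; apply: (con_lev0 cu).
  have [C1 [oC1 hC1]] := con_forward cu; have [C2 [oC2 hC2]] := con_forward cw.
  have [D [oD C1D CD1]] := osub_join oC1 oC; have [E [oE DE C2E]] := osub_join oD oC2.
  exists E; split => //; split; first by apply: staysS hC1 => x /C1D /DE.
  rewrite (_ : u' = - (w' + v')).
    have sE := stays_sg (- b) (osub_sg oE).
    apply: (sgN sE); apply: (sgD sE); first exact: staysS hC2.
    by apply: staysS h2 => x /CD1 /DE.
  by apply/eqP; rewrite -addr_eq0 addrA; exact/eqP.
move=> cu cw lv e.
have u0 : u = 0 by exact: aux cu cw lv e.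
have w0 : w = 0.
  by apply: (aux (- a) w u v); rewrite ?opprK ?levN // -e; zmod.
by split => //; move: e; rewrite u0 w0 !add0r.
Qed.

(** The core element of [tidy_split] depends on the smaller tidy subgroup; compactness of the core
    makes one choice serve them all. *)
Lemma stays_split D a x : tidy D a -> stays D a x ->
  exists v, core D a v /\ con a (x - v).
Proof.
move=> tD hx; have oD := tidy_osub tD.
have [] := @compact_dir M {D' | tidy D' a /\ D' `<=` D} (exist _ D (conj tD (@subset_refl _ D)))
  (core D a) (fun i => [set v | enters (sval i) a (x - v)]).
- exact: core_compact.
- by move=> [D' [tD' D'D]] /=; apply: closed_subr; exact: tidy_closed tD'.
- move=> [D1 [t1 s1]] [D2 [t2 s2]] /=.
  have [D3 [t3 s3]] := tidy_basis a (osubI (tidy_osub t1) (tidy_osub t2)).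
  have s3D : D3 `<=` D by move=> y /s3[/s1].
  exists (exist _ D3 (conj t3 s3D)) => /=.
  by split => v; apply: entersS => y /s3[].
- by move=> [D' [tD' D'D]] /=; exact: tidy_split.
- move=> v [hv h]; exists v; split => // C oC.
  have [D' [tD' D'C]] := tidy_basis a (osubI oC oD).
  have D'D : D' `<=` D by move=> y /D'C[].
  have := h (exist _ D' (conj tD' D'D)).
  by apply: entersS => y /D'C[].
Qed.

Lemma tidy_dec D a x : tidy D a -> D x -> exists u w v,
  [/\ con a u /\ D u, con (- a) w /\ D w, core D a v & x = u + w + v].
Proof.
move=> tD Dx; have oD := tidy_osub tD; have sD := osub_sg oD.
case: (tD) => _ dD _ _; have [p [m [hp hm e]]] := dD x Dx.
have [v [cv cm]] := stays_split tD hm.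
have [v' [cv' cp]] := stays_split (tidyN tD) hp.
rewrite coreN in cv'.
exists (m - v), (p - v'), (v + v'); split => //.
- by split => //; apply: sgB => //; [exact: stays_sub hm|apply: stays_sub cv.1].
- by split => //; apply: sgB => //; [exact: stays_sub hp|apply: stays_sub cv'.1].
- exact: (sgD (core_sg a sD)).
- by rewrite e; zmod.
Qed.

Lemma lev_tidy D a x : tidy D a -> lev a x -> D x -> core D a x.
Proof.
move=> tD lx Dx; have [u [w [v [[cu _] [cw _] hv e]]]] := tidy_dec tD Dx.
have slev := (lev_submodule a).1.
have [||u0 w0 v0] := con_lev_direct (v := v - x) cu cw.
- by apply: (sgB slev) => //; apply: lev_core hv; exact: tidy_osub tD.
- by rewrite e; zmod.
by move/eqP: v0; rewrite subr_eq0 => /eqP <-.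
Qed.

(** Pointwise contraction is uniform on compact sets: modulo a finite net the points lie in [D] and
    are contracted, and by tidiness their orbits never leave [D]. *)
Lemma con_uniform a K W : compact K -> K `<=` con a -> nbhs (0 : M) W ->
  exists n0, forall n, (n0 <= n)%N -> forall x, K x -> W (act (a *+ n) x).
Proof.
move=> cK Kc /basisL[C [oC CW]]; have [D [tD DC]] := tidy_basis a oC.
have oD := tidy_osub tD; have sD := osub_sg oD.
have [V [nV VD]] := osub_nbhs oD.
have [s [sK Ks]] := compact_net cK (@subset_refl _ K) nV.
have [n0 hn0] : exists n0, forall y, y \in s -> forall n, (n0 <= n)%N -> D (act (a *+ n) y).
  elim: s sK {Ks} => [|y s IH] sK; first by exists 0%N.
  have [|n0 h0] := IH; first by move=> z zs; apply: sK; rewrite inE zs orbT.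
  have [n1 h1] := Kc y (sK y (mem_head _ _)) D oD.
  exists (maxn n0 n1) => z; rewrite inE => zs n; rewrite geq_max => /andP[l0 l1].
  by case/predU1P: zs => [->|zs]; [exact: h1|exact: h0].
exists n0 => n nn x Kx; apply/CW/DC.
have [y ys Vy] := Ks x Kx.
have sc := (con_submodule a).1.
have cxy : con a (x - y) by apply: (sgB sc); apply: Kc => //; exact: sK.
rewrite -(subrK y x) actD; apply: sgD => //; last exact: hn0.
have Dxy : D (x - y) by apply: VD; split => //; exact: con_L cxy.
by case: tD => _ _ h _; apply: (h (x - y)); split => //; exact: cxy.
Qed.

Lemma osub_bound_seq a (s : seq M) : (forall y, y \in s -> lev a y) ->
  exists C, osub C /\ forall y, y \in s -> core C a y.
Proof.
elim: s => [|y s IH] h; first by have [C oC] := osub_ex; exists C.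
have [|C [oC hC]] := IH; first by move=> z zs; apply: h; rewrite inE zs orbT.
have [D [oD hD]] := h y (mem_head _ _); have [E [oE CE DE]] := osub_join oC oD.
exists E; split => // z; rewrite inE => /predU1P[->|zs]; first exact: coreS hD.
by apply: coreS (hC z zs).
Qed.

(** The same net argument, with [lev_tidy] in place of tidiness below. *)
Lemma lev_bounded a K : compact K -> K `<=` lev a ->
  exists C, osub C /\ K `<=` core C a.
Proof.
move=> cK Kl; have [C oC] := osub_ex; have [D [tD _]] := tidy_basis a oC.
have oD := tidy_osub tD.
have [V [nV VD]] := osub_nbhs oD.
have [s [sK Ks]] := compact_net cK (@subset_refl _ K) nV.
have [|E [oE hE]] := @osub_bound_seq a s; first by move=> y /sK /Kl.
have [F [oF EF DF]] := osub_join oE oD.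
exists F; split => // x Kx; have [y ys Vy] := Ks x Kx.
have lxy : lev a (x - y) by apply: (sgB (lev_submodule a).1); apply: Kl => //; exact: sK.
rewrite -(subrK y x); apply: (sgD (core_sg a (osub_sg oF))).
  apply: coreS DF _ _; apply: lev_tidy => //; apply: VD; split => //; exact: lev_L lxy.
exact: coreS (hE y ys).
Qed.

(* The solution is a cluster point of the partial sums of the geometric series
   - sum_i a^(k i) u, which stay in a compact subgroup. *)
Lemma con_solve a k u : (0 < k)%N -> con a u ->
  exists u', con a u' /\ act (a *+ k) u' - u' = u.
Proof.
move=> k0 cu; have [C [oC hC]] := con_forward cu.
have sC := osub_sg oC; have scon := (con_submodule a).1.
pose s n := \sum_(i < n) act (a *+ (k * i)) u.
have Cs n : C (s n) by apply: (sg_sum _ sC) => i _; exact: hC.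
have cs n : con a (s n) by apply: (sg_sum _ scon) => i _; exact: (con_submodule a).2.
have es n : act (a *+ k) (s n) - s n = act (a *+ (k * n)) u - u.
  rewrite /s; elim: n => [|n IH].
    by rewrite !big_ord0 actr0 muln0 mulr0n act0 !subrr.
  rewrite big_ord_recr /= actD actMnD -mulnS.
  have -> : forall p q r t : M, p + q - (r + t) = (p - r) + (q - t) by move=> *; zmod.
  by rewrite IH; zmod.
have [y [Cy hy]] := compact_cluster_seq (osub_compact oC) Cs.
have cy : con a y.
  apply/con_closed/closureP0 => W nW; have [m [_ Wm]] := hy W nW 0%N.
  by exists (s m).
exists (- y); split; first exact: (sgN scon).
have -> : act (a *+ k) (- y) - - y = u - (act (a *+ k) y - y + u) by rewrite actN; zmod.
rewrite (_ : act (a *+ k) y - y + u = 0) ?subr0 //.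
apply: nbhs0_eq0 => // W nW.
have [V [nV sV VV]] := nbhs0_split nW; have [V1 [nV1 sV1 VV1]] := nbhs0_split nV.
have [n hn] : exists n, forall m, (n <= m)%N -> V (act (a *+ (k * m)) u).
  have [D [oD DV]] := basisL nV; have [n hn] := cu D oD.
  by exists n => m nm; apply/DV/hn/(leq_trans nm); rewrite leq_pmull.
have nU : nbhs (0 : M) (V1 `&` [set z | V1 (act (a *+ k) z)]).
  by apply: filterI => //; exact: act_nbhs.
have [m [nm [U1 U2]]] := hy _ nU n.
have -> : act (a *+ k) y - y + u = (act (a *+ k) (y - s m) + - (y - s m)) +
    act (a *+ (k * m)) u.
  rewrite actB; have := es m; set p := act _ (s m); set q := act _ u => e.
  have -> : q = p - s m + u by rewrite e; zmod.
  by zmod.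
by apply: VV; [apply: VV1 => //; exact: sV1|exact: hn].
Qed.

Hypothesis omegaL : forall U, alg_submodule act U -> U `<=` L ->
  (exists C, osub C /\ C `<=` U) ->
  (forall N, alg_submodule act N -> U `<=` N -> N `<=` L -> finite_index U N ->
     N `<=` U) -> L `<=` U.

(** Modulo the compact group [core C a] the orbit of [x] is [k]-periodic, so all of it lies in
    finitely many translates of that group. *)
Lemma lev_periodic a k x : (0 < k)%N -> L x -> lev a (act (a *+ k) x - x) -> lev a x.
Proof.
move=> k0 Lx [C [oC hC]]; have sC := osub_sg oC.
have sF := core_sg a sC.
have [||E [oE hE]] := @ellL (addS [set y | y \in [seq act (a *+ i) x | i <- iota 0 k]] (core C a)).
- by apply: compact_addS; [exact: compact_set_seq|exact: core_compact].
- move=> _ [_ [v [/mapP[i _ ->] [/stays_sub Cv _] ->]]].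
  by apply: sgD => //; [exact/L_act|exact: osub_L Cv].
have hr r y : (r < k)%N -> core C a (y - act (a *+ r) x) -> E y.
  move=> rk hy; apply: hE; exists (act (a *+ r) x), (y - act (a *+ r) x).
  by split => //; [apply/mapP; exists r => //; rewrite mem_iota|zmod].
have tel := telescope_sg sF (fun y n => @core_act C a n y) hC.
exists E; split => //; split => n.
  apply: (hr (n %% k)%N); first by rewrite ltn_mod.
  rewrite {1}(divn_eq n k) addnC mulnC -actMnD -actB; exact: core_act.
(* [k * q] is a multiple of the period that is at least [n], so [m] represents the time [- n] modulo
   [k] by a natural number. *)
pose q := n.+1.
have nq : (n <= k * q)%N.
  by rewrite /q mulnS; apply: leq_trans (leq_addl _ _); rewrite leq_pmull.
pose m := (k * q - n)%N.
apply: (hr (m %% k)%N); first by rewrite ltn_mod.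
have e1 : core C a (act (a *+ m) x - act (a *+ (m %% k)) x).
  rewrite {1}(divn_eq m k) addnC mulnC -actMnD -actB; exact: core_act.
have e2 : core C a (act ((- a) *+ n) x - act (a *+ m) x).
  rewrite (_ : _ - _ = act ((- a) *+ n) (- (act (a *+ (k * q)) x - x))).
    by apply: core_actN; exact: (sgN sF).
  by rewrite actN actB actMnl // opprB.
by have := sgD sF e2 e1; rewrite addrA subrK.
Qed.

(* The sum of the three submodules is open, and its quotient has no finite submodule
   since a periodic class can be solved for by [con_solve] and [lev_periodic]. *)
Lemma con_lev_dec a x : L x -> exists u w v,
  [/\ con a u, con (- a) w, lev a v & x = u + w + v].
Proof.
have [C oC] := osub_ex; have [D [tD _]] := tidy_basis a oC.
have oD := tidy_osub tD.
have mc := con_submodule a; have mc' := con_submodule (- a); have ml := lev_submodule a.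
pose U := addS (addS (con a) (con (- a))) (lev a).
have sU : is_subgroup U by apply: sg_addS ml.1; apply: sg_addS mc.1 mc'.1.
have mU : alg_submodule act U.
  split => // b _ [_ [v [[u [w [hu hw ->]]] hv ->]]].
  rewrite !actD; apply: addSP; last exact: ml.2.
  by apply: addSP; [exact: mc.2|exact: mc'.2].
suff LU : L `<=` U.
  by move=> /LU[_ [v [[u [w [hu hw ->]]] hv ->]]]; exists u, w, v.
apply: omegaL => //.
- move=> _ [_ [v [[u [w [hu hw ->]]] hv ->]]].
  apply: (sgD sgL); last exact: lev_L hv.
  by apply: (sgD sgL); [exact: con_L hu|exact: con_L hw].
- exists D; split => // y Dy; have [u [w [v [[hu _] [hw _] hv ->]]]] := tidy_dec tD Dy.
  by apply: addSP; [exact: addSP|exact: lev_core hv].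
move=> N mN UN NL fN y Ny.
have [i [j [ij]]] := finite_index_recur sU fN (fun n => mN.2 (a *+ n) _ Ny).
move=> /(sgN sU) /(mU.2 ((- a) *+ i)).
rewrite opprB actB actMnK actMnl ?(ltnW ij) //.
have : (0 < j - i)%N by rewrite subn_gt0.
move: (j - i)%N => k k0 [_ [v [[u [w [hu hw ->]]] hv e]]].
have [u' [hu' eu]] := con_solve k0 hu.
(* [con_solve] is used for [- a] here; applying [a *+ k] to its equation yields
   [act (a *+ k) w' - w' = w]. *)
have [w' [hw' ew]] := con_solve k0 (sgN mc'.1 (mc'.2 ((- a) *+ k) _ hw)).
have ew2 : act (a *+ k) w' - w' = w.
  have := congr1 (act (a *+ k)) ew; rewrite actB actN !actMnNK => ew2.
  by rewrite -[w]opprK -ew2; zmod.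
have -> : y = u' + w' + (y - u' - w') by zmod.
apply: addSP; first exact: addSP.
apply: (lev_periodic k0).
  by apply: sgB => //; [apply: sgB => //; [exact: NL|exact: con_L hu']|exact: con_L hw'].
rewrite (_ : _ - _ = v) // !actB.
have -> : v = act (a *+ k) y - y - u - w by rewrite e; zmod.
by rewrite -eu -ew2; zmod.
Qed.

(** Continuity of the three projections: [tidy_dec] splits an element of a small tidy [D] inside
    [D], and by directness this is the only splitting. *)
Lemma con_lev_continuous a W : nbhs (0 : M) W -> exists V, nbhs (0 : M) V /\
  forall u w v, con a u -> con (- a) w -> lev a v -> V (u + w + v) ->
    [/\ W u, W w & W v].
Proof.
move=> /basisL[C [oC CW]]; have [D [tD DC]] := tidy_basis a oC.
have oD := tidy_osub tD.
have [V [nV VD]] := osub_nbhs oD.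
exists V; split => // u w v hu hw hv Vx.
have [|u' [w' [v' [[cu Du] [cw Dw] hv' e]]]] := tidy_dec (x := u + w + v) tD.
  apply: VD; split => //; apply: sgD => //; last exact: lev_L hv.
  by apply: sgD => //; [exact: con_L hu|exact: con_L hw].
have [] := @con_lev_direct a (u - u') (w - w') (v - v').
- exact: (sgB (con_submodule a).1).
- exact: (sgB (con_submodule (- a)).1).
- by apply: (sgB (lev_submodule a).1) => //; exact: lev_core hv'.
- have -> : u - u' + (w - w') + (v - v') = (u + w + v) - (u' + w' + v') by zmod.
  by rewrite e subrr.
move=> /subr0_eq-> /subr0_eq-> /subr0_eq->.
by split; apply/CW/DC => //; exact: stays_sub hv'.1.
Qed.

End Action.

(** * Proper homomorphisms from open subgroups to Euclidean spaces *)

Section LCA.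
Variable M : topologicalZmodType.
Hypothesis hM : hausdorff_space M.
Hypothesis lcM : locally_compact [set: M].
Implicit Types (x y z : M) (K H G W V : set M).

Lemma compact_nbhs0 : exists K, compact K /\ nbhs (0 : M) K.
Proof.
have [K hK [cK _]] := lcM (I : [set: M] (0 : M)); exists K; split => //.
by apply: filterS (hK : nbhs _ _) => y; exact.
Qed.

Lemma compact_opp K : compact K -> compact [set x | K (- x)].
Proof.
move=> cK; rewrite (_ : [set _ | _] = -%R @` K).
  by apply: compact_image => //; exact: opp_continuous.
rewrite predeqE => x; split => [Kx|[y Ky <-]] /=; last by rewrite opprK.
by exists (- x); rewrite ?opprK.
Qed.

(* Weil's lemma on monothetic groups, modulo the subgroup La: if infinitely many
   multiples of x return to a compact set, all multiples stay in one. *)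
Lemma weil (La : set M) x K : is_subgroup La -> compact K ->
  (forall N, exists k l, [/\ (N <= k)%N, La l & K (x *+ k + l)]) ->
  exists K', compact K' /\ forall m : int, exists l, La l /\ K' (x *~ m + l).
Proof.
move=> sL cK hK; have [U [cU nU]] := compact_nbhs0.
have [V [nV sV VV]] := nbhs0_split nU.
have VU y : V y -> U y by move=> Vy; rewrite -(addr0 y); apply: VV => //; exact: nbhs_singleton.
(* Returns to [K] chosen with gaps of at least [N] have two terms that are close; their difference
   is a return to the small set [V] at a time beyond [N]. *)
have rec (N : nat) : exists k l, [/\ (N <= k)%N, La l & V (x *+ k + l)].
  have /choice[f hf] : forall n, exists p : nat * M,
      [/\ (n <= p.1)%N, La p.2 & K (x *+ p.1 + p.2)].
    by move=> n; have [k [l ?]] := hK n; exists (k, l).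
  pose g n := iter n (fun p => f (p.1 + N)%N) (f 0%N).
  have hg n : La (g n).2 /\ K (x *+ (g n).1 + (g n).2).
    by case: n => [|n]; [have [] := hf 0%N|have [] := hf ((g n).1 + N)%N].
  have gS n : ((g n).1 + N <= (g n.+1).1)%N by have [] := hf ((g n).1 + N)%N.
  have gij i j : (i < j)%N -> ((g i).1 + N <= (g j).1)%N.
    elim: j => // j IH; rewrite ltnS leq_eqVlt => /predU1P[->//|/IH h].
    by apply: leq_trans h _; apply: leq_trans (gS j); exact: leq_addr.
  have [|i [j [ij Vij]]] := @compact_recurrence M K
    (fun n => x *+ (g n).1 + (g n).2) V cK _ nV; first by move=> n; have [] := hg n.
  have le := gij i j ij.
  have {}Vij : V (x *+ (g i).1 + (g i).2 - (x *+ (g j).1 + (g j).2)) by [].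
  exists ((g j).1 - (g i).1)%N, ((g j).2 - (g i).2); split.
  - by rewrite leq_subRL ?(leq_trans (leq_addr _ _) le).
  - by apply: sgB => //; [have [] := hg j|have [] := hg i].
  - rewrite mulrnBr ?(leq_trans (leq_addr _ _) le) //.
    by have := sV _ Vij; congr V; zmod.
pose S := [set z | exists (m : int) l, La l /\ z = x *~ m + l].
have near z : S z -> exists n l, [/\ (0 < n)%N, La l & V (x *+ n + l - z)].
  move=> [m [l [Ll ->]]]; have [k [l' [km Ll' Vk]]] := rec `|m|.+1%N.
  exists (absz (m + k)), (l + l'); split; [lia|exact: sgD|].
  have -> : x *+ absz (m + k) = x *~ m + x *+ k.
    by rewrite !pmulrn -mulrzDr; congr (_ *~ _); lia.
  by move: Vk; congr V; zmod.
have [|s [sS Ss]] := @compact_net M U V (S `&` U) cU _ nV; first by move=> z [].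
have [N hN] : exists N, forall y, y \in s -> exists n l,
    [/\ (0 < n <= N)%N, La l & V (x *+ n + l - y)].
  elim: s sS {Ss} => [|y s IH] sS; first by exists 0%N.
  have [|N hN] := IH; first by move=> z zs; apply: sS; rewrite inE zs orbT.
  have [n [l [n0 Ll Vn]]] := near y (sS y (mem_head _ _)).1.
  exists (maxn N n) => z; rewrite inE => /predU1P[->|/hN[n' [l' [/andP[n0' nN'] ? ?]]]].
    by exists n, l; split => //; rewrite n0 leq_maxr.
  by exists n', l'; split => //; rewrite n0' leq_max nN'.
have {}hN y : S y -> U y -> exists n l, [/\ (0 < n <= N)%N, La l & U (y - (x *+ n + l))].
  move=> Sy Uy; have [z zs Vz] := Ss y (conj Sy Uy).
  have [n [l [nN Ll Vn]]] := hN z zs; exists n, l; split => //.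
  by have := VV _ _ Vz (sV _ Vn); congr U; zmod.
(* Take the least positive [n] that reaches [z] up to [U]. The remaining difference is itself
   reached by some [k <= N] through [hN], and [k < n] would make [n - k] a smaller choice; so
   [n <= k <= N]. *)
have key z : S z -> exists n l, [/\ (n <= N)%N, La l & U (x *+ n + l - z)].
  move=> Sz.
  have ex : exists n, `[< (0 < n)%N /\ exists l, La l /\ U (x *+ n + l - z) >].
    have [n [l [n0 Ll Vn]]] := near z Sz.
    by exists n; apply/asboolP; split => //; exists l; split => //; exact: VU.
  case: (ex_minnP ex) => n /asboolP[n0 [l [Ll Un]]] hmin.
  exists n, l; split => //.
  have [||k [l' [/andP[k0 kN] Ll' Uk]]] := hN (x *+ n + l - z) => //.
    case: Sz => m [l1 [Ll1 ->]]; exists (n%:Z - m), (l - l1); split; first exact: sgB.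
    by rewrite mulrzBr pmulrn; zmod.
  apply: leq_trans kN; rewrite leqNgt; apply/negP => kn.
  suff : (n <= n - k)%N by lia.
  apply: hmin; apply/asboolP; split; first by rewrite subn_gt0.
  exists (l - l'); split; first exact: sgB.
  by move: Uk; rewrite mulrnBr ?(ltnW kn) //; congr U; zmod.
exists (addS [set y | y \in [seq x *+ i | i <- iota 0 N.+1]] [set y | U (- y)]).
split; first by apply: compact_addS; [exact: compact_set_seq|exact: compact_opp].
move=> m; have [|n [l [nN Ll Un]]] := key (x *~ m).
  by exists m, 0; rewrite addr0; split => //; exact: sg0.
exists (- l); split; first exact: sgN.
exists (x *+ n), (x *~ m - l - x *+ n); split.
- by apply/mapP; exists n => //; rewrite mem_iota add0n ltnS.
- by move: Un; rewrite /=; congr U; zmod.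
- by zmod.
Qed.

Definition lcomb n (g : 'I_n -> M) (l : 'I_n -> int) : M := \sum_i g i *~ l i.
Definition span n (g : 'I_n -> M) : set M := [set z | exists l, z = lcomb g l].

Lemma lcombB n (g : 'I_n -> M) l l' :
  lcomb g l - lcomb g l' = lcomb g (fun i => l i - l' i).
Proof. by rewrite /lcomb -sumrB; apply: eq_bigr => i _; rewrite mulrzBr. Qed.
Lemma lcombD n (g : 'I_n -> M) l l' :
  lcomb g l + lcomb g l' = lcomb g (fun i => l i + l' i).
Proof. by rewrite /lcomb -big_split; apply: eq_bigr => i _; rewrite mulrzDr. Qed.

Lemma span_sg n (g : 'I_n -> M) : is_subgroup (span g).
Proof.
split; first by exists (fun=> 0); rewrite /lcomb big1.
by move=> _ _ [l ->] [l' ->]; exists (fun i => l i - l' i); rewrite lcombB.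
Qed.

Lemma span_gen n (g : 'I_n -> M) i : span g (g i).
Proof.
exists (fun j => (j == i)%:Z); rewrite /lcomb (bigD1 i) //= eqxx big1 ?addr0 //.
by move=> j /negPf->.
Qed.

Definition cogen G n := exists (g : 'I_n -> M) K, compact K /\ G `<=` addS K (span g).

(** With a symmetric compact neighbourhood [K], finitely many translates of [K] cover [K + K], so
    [K] plus the span of their centres is closed under subtraction. *)
Lemma cogen_open : exists G n, [/\ is_subgroup G, nbhs (0 : M) G & cogen G n].
Proof.
have [U [cU nU]] := compact_nbhs0.
pose K := U `|` [set x | U (- x)].
have nK : nbhs (0 : M) K by apply: filterS nU => x; left.
have sK x : K x -> K (- x) by case=> h; [right|left] => //=; rewrite ?opprK.
have cK : compact K by apply: compactU => //; exact: compact_opp.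
have [s [_ hs]] := compact_net (compact_addS cK cK) (@subset_refl _ _) nK.
pose g (i : 'I_(size s)) := s`_i.
have sg := span_sg g.
exists (addS K (span g)), (size s); split.
- split; first by exists 0, 0; rewrite addr0; split => //; [exact: nbhs_singleton|exact: sg0].
  move=> _ _ [k [z [Kk hz ->]]] [k' [z' [Kk' hz' ->]]].
  have [y ys Ky] := hs (k - k') (addSP Kk (sK _ Kk')).
  exists (k - k' - y), (y + (z - z')); split => //; last by zmod.
  apply: (sgD sg); last exact: sgB.
  have is_ : (index y s < size s)%N by rewrite index_mem.
  by have := span_gen g (Ordinal is_); rewrite /g /= nth_index.
- by apply: filterS nK => x; exact: addSl.
- by exists g, K; split => // x.
Qed.

Lemma lcomb_lift n (g : 'I_n.+1 -> M) i l :
  lcomb g l = g i *~ l i + lcomb (fun j => g (lift i j)) (fun j => l (lift i j)).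
Proof. by rewrite /lcomb (bigD1_ord i). Qed.

(* With the least number of generators, Z^n -> M is proper: otherwise [weil] absorbs
   one generator into the compact set. *)
Lemma cogen_proper G n (g : 'I_n -> M) K : compact K -> G `<=` addS K (span g) ->
  (forall m, cogen G m -> (n <= m)%N) ->
  forall K1, compact K1 -> exists N : nat, forall l, K1 (lcomb g l) ->
    forall i, (`|l i| <= N)%N.
Proof.
move=> cK GK hmin K1 cK1.
have bnd i : exists N : nat, forall l, K1 (lcomb g l) -> (`|l i| <= N)%N.
  case: n g GK hmin i => [|n] g GK hmin i; first by case: i.
  apply: contrapT => nb; suff /hmin : cogen G n by rewrite ltnn.
  pose g' j := g (lift i j).
  (* Symmetrizing [K1] allows a negative coefficient of [g i] to be replaced by its absolute
     value. *)
  have [||K' [cK' hK']] := @weil (span g') (g i) (K1 `|` [set x | K1 (- x)]) (span_sg g').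
  - by apply: compactU => //; exact: compact_opp.
  - move=> N; apply: contrapT => nN; apply: nb; exists N => l Kl.
    rewrite leqNgt; apply/negP => lN; apply: nN.
    rewrite (lcomb_lift g i) in Kl.
    have sg' := span_sg g'.
    have [li|li] := leP 0 (l i).
      exists (absz (l i)), (lcomb g' (fun j => l (lift i j))); split; first exact: ltnW.
        by exists (fun j => l (lift i j)).
      by left; rewrite pmulrn gez0_abs.
    exists (absz (l i)), (- lcomb g' (fun j => l (lift i j))); split; first exact: ltnW.
      by apply: (sgN sg'); exists (fun j => l (lift i j)).
    right => /=; rewrite opprD opprK; move: Kl; congr (K1 (_ + _)).
    by rewrite pmulrn ltz0_abs // mulrNz opprK.
  exists g', (addS K K'); split; first exact: compact_addS.
  move=> x /GK[k [_ [Kk [l ->] ->]]].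
  have [l' [[m ->] Kl']] := hK' (l i).
  exists (k + (g i *~ l i + lcomb g' m)),
    (lcomb g' (fun j => l (lift i j)) - lcomb g' m); split.
  - exact: addSP.
  - by rewrite lcombB; eexists.
  - by rewrite (lcomb_lift g i) -/g'; zmod.
have [f hf] := choice bnd.
exists (\max_i f i) => l Kl i; apply: leq_trans (hf i l Kl) _; exact: leq_bigmax.
Qed.

Lemma lcomb_box n (g : 'I_n -> M) (N : nat) :
  exists K, compact K /\ forall l, (forall i, (`|l i| <= N)%N) -> K (lcomb g l).
Proof.
elim: n g => [|n IH] g.
  exists [set 0]; split; first exact: compact_set1.
  by move=> l _; rewrite /lcomb big_ord0.
have [K [cK hK]] := IH (fun j => g (lift ord0 j)).
exists (addS [set y | y \in [seq g ord0 *~ (i%:Z - N%:Z) | i <- iota 0 (N + N).+1]] K).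
split; first by apply: compact_addS => //; exact: compact_set_seq.
move=> l hl; rewrite (lcomb_lift g ord0); apply: addSP; last by apply: hK => j; exact: hl.
apply/mapP; exists (absz (l ord0 + N%:Z)).
  by rewrite mem_iota; have := hl ord0; lia.
by congr (_ *~ _); have := hl ord0; lia.
Qed.
End LCA.

(** * Homogenization of real quasi-morphisms *)

Section QuasiMorphism.
Variables (R : realType) (M : topologicalZmodType) (G : set M) (q : M -> R) (D : R).
Hypothesis sG : is_subgroup G.
Hypothesis qD : forall x y, G x -> G y -> `|q (x + y) - q x - q y| <= D.

Let u x k := q (x *+ 2 ^ k) / 2 ^+ k.
Let e k : R := D / 2 ^+ k.
Let G2 x k : G x -> G (x *+ 2 ^ k).
Proof. exact: sgMn. Qed.
Let e2 k : e k = e k.+1 *+ 2.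
Proof. by rewrite /e exprS -mulr_natr; field. Qed.

Let uS x k : G x -> `|u x k.+1 - u x k| <= e k.+1.
Proof.
move=> Gx; have := qD (G2 k Gx) (G2 k Gx).
rewrite -mulr2n -mulrnA -expnSr => h.
have -> : u x k.+1 - u x k =
    (q (x *+ 2 ^ k.+1) - q (x *+ 2 ^ k) - q (x *+ 2 ^ k)) / 2 ^+ k.+1.
  by rewrite /u exprS; field.
rewrite normrM (ger0_norm (x := _^-1)) ?invr_ge0 ?exprn_ge0 //.
by rewrite ler_pM2r ?invr_gt0 ?exprn_gt0.
Qed.

Let D0 : 0 <= D.
Proof. by case: sG => G0 _; apply: le_trans (qD G0 G0); exact: normr_ge0. Qed.
Let e0 k : 0 <= e k.
Proof. by rewrite divr_ge0 // exprn_ge0. Qed.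

Let lowS x k : G x -> u x k - e k <= u x k.+1 - e k.+1.
Proof.
by move=> Gx; have := uS k Gx; rewrite (e2 k) ler_norml => /andP[]; lra.
Qed.
Let upS x k : G x -> u x k.+1 + e k.+1 <= u x k + e k.
Proof.
by move=> Gx; have := uS k Gx; rewrite (e2 k) ler_norml => /andP[]; lra.
Qed.
Let low_le x k m : G x -> (k <= m)%N -> u x k - e k <= u x m - e m.
Proof.
by move=> Gx /subnK <-; elim: (m - k)%N => // i IH; apply: le_trans IH (lowS _ Gx).
Qed.
Let up_le x k m : G x -> (k <= m)%N -> u x m + e m <= u x k + e k.
Proof.
by move=> Gx /subnK <-; elim: (m - k)%N => // i IH; apply: le_trans (upS _ Gx) IH.
Qed.
Let low_up x k m : G x -> u x k - e k <= u x m + e m.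
Proof.
move=> Gx; have [km|mk] := leqP k m.
  by apply: le_trans (low_le Gx km) _; have := e0 m; lra.
by apply: le_trans (up_le Gx (ltnW mk)); have := e0 k; lra.
Qed.

(** This is the limit of [q (x *+ 2 ^ k) / 2 ^+ k]. The intervals of radius [e k] around [u x k] are
    nested, so the supremum of their lower ends lies in all of them. *)
Definition homogenize x : R := sup [set u x k - e k | k in [set: nat]].

Let hom_near x k : G x -> `|homogenize x - u x k| <= e k.
Proof.
move=> Gx; rewrite ler_norml; apply/andP; split.
  rewrite lerBrDr addrC; apply: ub_le_sup; last by exists k.
  by exists (u x 0%N + e 0%N) => _ [m _ <-]; exact: low_up.
rewrite lerBlDr addrC; apply: ge_sup; first by exists (u x 0%N - e 0%N); exists 0%N.
by move=> _ [m _ <-]; exact: low_up.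
Qed.

Lemma homogenize_near x : G x -> `|homogenize x - q x| <= D.
Proof.
by move=> Gx; have := hom_near 0 Gx; rewrite /u /e expn0 expr0 mulr1n !divr1.
Qed.

Lemma homogenizeD x y : G x -> G y ->
  homogenize (x + y) = homogenize x + homogenize y.
Proof.
move=> Gx Gy.
have Gxy : G (x + y) by exact: sgD.
have near k : `|homogenize (x + y) - (homogenize x + homogenize y)| <= (4 * D) / 2 ^+ k.
  have h1 := hom_near k Gxy; have h2 := hom_near k Gx; have h3 := hom_near k Gy.
  have h4 : `|u (x + y) k - u x k - u y k| <= e k.
    rewrite /u mulrnDl -!mulrBl normrM (ger0_norm (x := _^-1)) ?invr_ge0 ?exprn_ge0 //.
    by rewrite ler_pM2r ?invr_gt0 ?exprn_gt0 //; apply: qD; exact: G2.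
  have -> : 4 * D / 2 ^+ k = e k *+ 4 by rewrite /e -mulrnAl mulr_natl.
  by move: h1 h2 h3 h4; rewrite !ler_norml => /andP[? ?] /andP[? ?] /andP[? ?] /andP[? ?];
    apply/andP; split; lra.
apply/eqP; rewrite -subr_eq0 -normr_le0; apply/ler_addgt0Pr => eps eps0; rewrite add0r.
have [k hk] : exists k : nat, 4 * D / eps < 2 ^+ k.
  exists (Num.truncn (4 * D / eps)).+1.
  apply: lt_le_trans (truncnS_gt _) _; rewrite -natrX ler_nat.
  by apply: ltnW; exact: ltn_expl.
apply: le_trans (near k) _; rewrite ler_pdivrMr ?exprn_gt0 //.
by move: hk; rewrite ltr_pdivrMr // => /ltW; rewrite (mulrC eps).
Qed.
End QuasiMorphism.

Lemma additive_continuous (M N : topologicalZmodType) (f : M -> N) :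
  (forall x y, f (x + y) = f x + f y) ->
  (forall W, nbhs (0 : N) W -> nbhs (0 : M) [set x | W (f x)]) -> continuous f.
Proof.
move=> fD f0 x W /nbhs_shift/f0 h; apply/nbhs_shift; apply: filterS h => y /=.
by rewrite fD.
Qed.

Lemma nbhs0_mulrn (M : topologicalZmodType) n (W : set M) :
  nbhs (0 : M) W -> nbhs (0 : M) [set x | W (x *+ n)].
Proof.
elim: n W => [|n IH] W nW.
  by apply: filterS (@filterT _ (nbhs (0 : M)) _) => x _ /=; rewrite mulr0n; exact: nbhs_singleton.
have [V [nV _ VV]] := nbhs0_split nW.
by apply: filterS (filterI nV (IH V nV)) => x [? ?] /=; rewrite mulrS; exact: VV.
Qed.

Lemma mulrn_continuous (M : topologicalZmodType) n : continuous (fun x : M => x *+ n).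
Proof.
apply: additive_continuous => [x y|W]; first by rewrite mulrnDl.
exact: nbhs0_mulrn.
Qed.

(** * Real row vectors and closed subgroups of R^n *)

Section Euclid.
Variable R : realType.

Lemma rV_coord_le n (v : 'rV[R]_n) i : `|v 0 i| <= `|v|.
Proof.
rewrite [leRHS]mx_normrE.
exact: (@le_bigmax _ _ _ _ (fun ij : 'I_1 * 'I_n => `|v ij.1 ij.2|) (0, i)).
Qed.

Lemma rV_norm_le n (v : 'rV[R]_n) r : 0 <= r -> (forall i, `|v 0 i| <= r) -> `|v| <= r.
Proof.
move=> r0 h; rewrite [leLHS]mx_normrE; apply: bigmax_le => // -[i j] _ /=.
by rewrite ord1.
Qed.

Lemma rV_mulmx_le n m (B : 'M[R]_(n, m)) :
  exists c, 0 < c /\ forall v : 'rV[R]_n, `|v *m B| <= c * `|v|.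
Proof.
pose c := 1 + \sum_i \sum_j `|B i j|.
have s0 : 0 <= \sum_i \sum_j `|B i j| by apply: sumr_ge0 => i _; apply: sumr_ge0.
have c0 : 0 < c by rewrite /c; lra.
exists c; split => // v; apply: rV_norm_le => [|k]; first by rewrite mulr_ge0 // ltW.
rewrite mxE; apply: le_trans (ler_norm_sum _ _ _) _.
apply: (@le_trans _ _ (\sum_j `|v| * `|B j k|)).
  by apply: ler_sum => j _; rewrite normrM ler_wpM2r // rV_coord_le.
rewrite -mulr_sumr mulrC ler_wpM2r // /c.
apply: (@le_trans _ _ (\sum_i \sum_j `|B i j|)); last by lra.
by apply: ler_sum => i _; rewrite (bigD1 k) //= lerDl; apply: sumr_ge0.
Qed.

Lemma invS_lt (e : R) : 0 < e -> exists k : nat, k.+1%:R^-1 < e.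
Proof.
move=> e0; exists (Num.truncn e^-1).
by rewrite -[ltRHS]invrK ltf_pV2 ?posrE ?invr_gt0 ?ltr0n // truncnS_gt.
Qed.

(** Among the matrices whose rows lie in [S], one of maximal rank has all of [S] in its row
    space. *)
Lemma subspace_proj n (S : set 'rV[R]_n) : S 0 ->
  (forall u v, S u -> S v -> S (u + v)) -> (forall (c : R) v, S v -> S (c *: v)) ->
  exists p : 'M[R]_n, (forall v, S (v *m p)) /\ (forall v, S v -> v *m p = v).
Proof.
move=> S0 SD SZ.
have Scomb m (e : 'M[R]_(m, n)) : (forall i, S (row i e)) -> forall u, S (u *m e).
  move=> Se u; rewrite mulmx_sum_row.
  by apply: (big_ind S) => // i _; exact: SZ.
pose Q k := `[< exists e : 'M[R]_n, (forall i, S (row i e)) /\ \rank e = k >].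
have exQ : exists k, Q k.
  by exists 0%N; apply/asboolP; exists 0; split; [move=> i; rewrite row0|exact: mxrank0].
have ubQ k : Q k -> (k <= n)%N by move=> /asboolP[e [_ <-]]; exact: rank_leq_row.
case: (ex_maxnP exQ ubQ) => k /asboolP[e [Se <-]] emax.
have Sle v : S v -> (v <= e)%MS.
  move=> Sv; apply: contrapT => /negP nle.
  have : (\rank (e + v)%MS <= \rank e)%N.
    apply: emax; apply/asboolP; exists (e + v)%MS; split => // i.
    have /sub_addsmxP[[u1 u2] /= ->] : (row i (e + v)%MS <= e + v)%MS by exact: row_sub.
    apply: SD; first exact: Scomb.
    by apply: Scomb => j; rewrite row_id.
  rewrite leqNgt => /negP; apply; apply: rank_ltmx.
  by rewrite /ltmx addsmxSl /= addsmx_sub submx_refl.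
exists (pinvmx e *m e); split => [v|v /Sle h]; rewrite mulmxA; first exact: Scomb.
exact: mulmxKpV.
Qed.

Lemma nbhs0_norm n (e : R) : 0 < e -> nbhs (0 : 'rV[R]_n) [set v | `|v| < e].
Proof.
move=> e0; apply/nbhs_ballP; exists e => // v.
by rewrite -ball_normE /= sub0r normrN.
Qed.

Lemma nbhs0_normP n (W : set 'rV[R]_n) : nbhs (0 : 'rV[R]_n) W ->
  exists e : R, 0 < e /\ forall v, `|v| < e -> W v.
Proof.
move=> /nbhs_ballP[e e0 h]; exists e; split => // v ve; apply: h.
by rewrite -ball_normE /= sub0r normrN.
Qed.

(** [p] projects onto the space [S] of all lines in [H]. If [H] had arbitrarily small elements
    outside [S], their components killed by [p] would still be in [H], and a cluster point [u] of
    the normalized components would be a unit vector of [S] killed by [p]. *)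
Lemma closed_subgroup_lines n (H : set 'rV[R]_n) : is_subgroup H -> closed H ->
  exists p : 'M[R]_n, [/\ forall v, H (v *m p),
    p *m p = p & exists e : R, 0 < e /\ forall v, H v -> `|v| < e -> v *m p = v].
Proof.
move=> sH cH; pose S := [set v | forall t : R, H (t *: v)].
have [|||p [Sp pS]] := @subspace_proj n S.
- by move=> t; rewrite scaler0; exact: (sg0 sH).
- by move=> u v hu hv t; rewrite scalerDr; exact: (sgD sH).
- by move=> c v hv t; rewrite scalerA.
have SH v : S v -> H v by move=> /(_ 1); rewrite scale1r.
exists p; split => [v|| ]; first exact/SH/Sp.
  by apply/row_matrixP => i; rewrite row_mul; apply: pS; rewrite rowE; exact: Sp.
apply: contrapT => /forallNP hno.
have /choice[v hv] : forall k : nat, exists v,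
    [/\ H v, `|v| < k.+1%:R^-1 & v *m p <> v].
  move=> k; apply: contrapT => /forallNP nv; apply: (hno k.+1%:R^-1).
  split; first by rewrite invr_gt0 ltr0n.
  by move=> v Hv vk; apply: contrapT => vp; apply: (nv v).
have [c [c0 hc]] := rV_mulmx_le (1%:M - p).
pose h k := v k *m (1%:M - p).
have hE k : h k = v k - v k *m p by rewrite /h mulmxBr mulmx1.
have Hh k : H (h k) by rewrite hE; apply: sgB => //; [have [] := hv k|exact/SH/Sp].
have h0 k : h k != 0.
  by apply/eqP; rewrite hE => /subr0_eq e; have [_ _] := hv k; apply.
have hp k : h k *m p = 0 by rewrite hE mulmxBl (pS (v k *m p)) ?subrr.
have hs k : `|h k| < c * k.+1%:R^-1.
  by apply: le_lt_trans (hc _) _; rewrite ltr_pM2l //; have [] := hv k.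
pose w k := `|h k|^-1 *: h k.
have nw k : `|w k| = 1.
  by rewrite /w mx_normZ normfV normr_id mulVf // normr_eq0.
have [||u [u1 hu]] := @compact_cluster_seq _ [set x : 'rV[R]_n | `|x| = 1] w.
- apply: bounded_closed_compact.
    by exists 1; split => // x x1 y /= ->; exact: ltW.
  move=> y /closureP0 cy /=; apply/eqP; rewrite -subr_eq0 -normr_le0.
  apply/ler_addgt0Pr => e e0; rewrite add0r.
  have [x [x1 yx]] := cy _ (nbhs0_norm n e0).
  by rewrite -x1; apply: le_trans (ler_dist_dist _ _) (ltW yx).
- by move=> k; exact: nw.
have [c' [c'0 hc']] := rV_mulmx_le p.
have up : u *m p = 0.
  apply/eqP; rewrite -normr_le0; apply/ler_addgt0Pr => e e0; rewrite add0r.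
  have [k [_ hk]] := hu _ (nbhs0_norm n (divr_gt0 e0 c'0)) 0%N.
  have -> : u *m p = (u - w k) *m p by rewrite mulmxBl -scalemxAl hp scaler0 subr0.
  apply: le_trans (hc' _) _; rewrite mulrC -ler_pdivlMr //; exact: ltW.
suff /pS : S u.
  by rewrite up => u0; move: u1; rewrite /= -u0 normr0 => /eqP; rewrite eq_sym oner_eq0.
move=> t; apply/cH/closureP0 => W /nbhs0_normP[e [e0 hW]].
have e2 : 0 < e / 2 by rewrite divr_gt0.
have t1 : 0 < `|t| + 1 by have := normr_ge0 t; lra.
have [k1 hk1] := invS_lt (divr_gt0 e2 c0).
have [k [k1k hk]] := hu _ (nbhs0_norm n (divr_gt0 e2 t1)) k1.
(* The multiple [h k *~ m] differs from [t *: w k] by less than the norm of [h k]; as these norms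
   tend to 0, [t *: u] is a limit of elements of [H]. *)
pose m := Num.floor (t / `|h k|).
exists (h k *~ m); split; first exact: sgMz.
apply: hW.
have -> : t *: u - h k *~ m = t *: (u - w k) + (t / `|h k| - m%:~R) *: h k.
  rewrite scalerBr /w scalerA scalerBl scaler_int; zmod.
apply: le_lt_trans (ler_normD _ _) _.
rewrite [e]splitr; apply: ler_ltD; rewrite mx_normZ.
  apply: (@le_trans _ _ ((`|t| + 1) * `|u - w k|)); first by rewrite ler_wpM2r //; lra.
  by rewrite mulrC -ler_pdivlMr //; exact: ltW.
apply: (@le_lt_trans _ _ `|h k|).
  rewrite ler_piMl // ger0_norm; first have := floor_itv (t / `|h k|).
    by rewrite -/m rmorphD /= => /andP[_]; lra.
  by rewrite subr_ge0; exact: floor_le.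
apply: lt_trans (hs k) _; rewrite -ltr_pdivlMl // mulrC.
apply: le_lt_trans hk1; rewrite lef_pV2 ?posrE ?ltr0n // ler_nat ltnS //.
Qed.

Lemma intr_absz_le (m : int) (N : nat) : (`|m%:~R : R| <= N%:R) = (`|m| <= N)%N.
Proof. by rewrite -intr_norm -abszE -pmulrn ler_nat. Qed.

(** A neighbourhood of 0 generates R^n: [t] is a natural multiple of a vector so short that its
    image falls into [W]. *)
Lemma rV_hom_sub n (M : topologicalZmodType) (h : 'rV[R]_n -> M) (H W : set M) :
  (forall t t', h (t + t') = h t + h t') -> continuous h -> is_subgroup H ->
  nbhs (0 : M) W -> (forall t, W (h t) -> H (h t)) -> forall t, H (h t).
Proof.
move=> hD ch sH nW WH t.
have h0 : h 0 = 0 by apply: (addrI (h 0)); rewrite -hD !addr0.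
have hMn t' k : h (t' *+ k) = h t' *+ k.
  by elim: k => [|k IH]; rewrite ?mulr0n // !mulrS hD IH.
have hc := ch 0 W; rewrite h0 in hc; have /nbhs0_normP[e [e0 he]] := hc nW.
pose k := (Num.truncn (`|t| / e)).+1.
have k0 : 0 < k%:R :> R by rewrite ltr0n.
have -> : t = (k%:R^-1 *: t) *+ k.
  by rewrite -scaler_nat scalerA divff ?scale1r // lt0r_neq0.
rewrite hMn; apply: (sgMn _ sH); apply/WH/he.
rewrite mx_normZ normfV (ger0_norm (ltW k0)) ltr_pdivrMl //.
by rewrite -ltr_pdivrMr // truncnS_gt.
Qed.

End Euclid.

(** * Existence of a proper homomorphism *)

Section LCAMap.
Variables (R : realType) (M : topologicalZmodType).
Hypothesis hM : hausdorff_space M.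
Hypothesis lcM : locally_compact [set: M].
Implicit Types (x y z : M) (K G W : set M).

(** Homogenization yields boundedness on compact sets rather than continuity; for a homomorphism the
    latter follows, see [pm_small]. Outside [G] the values of [f] carry no meaning. *)
Record proper_map G n (f : M -> 'rV[R]_n) : Prop := ProperMap {
  pm_sg : is_subgroup G;
  pm_nbhs : nbhs (0 : M) G;
  pm_add : forall x y, G x -> G y -> f (x + y) = f x + f y;
  pm_bounded : forall K, compact K -> exists B : R, forall x, G x -> K x -> `|f x| <= B;
  pm_proper : forall r : R, exists K, compact K /\ forall x, G x -> `|f x| <= r -> K x
}.

(* The coordinates on Z^n extend to G up to a bounded error; homogenizing these
   quasi-morphisms gives honest homomorphisms. *)
Lemma proper_map_ex : exists G n (f : M -> 'rV[R]_n), proper_map G f.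
Proof.
have [G [n0 [sG nG cG]]] := cogen_open lcM.
have ex : exists n, `[< cogen G n >] by exists n0; exact/asboolP.
case: (ex_minnP ex) => n /asboolP[g [K0 [cK0 GK0]]] hmin {n0 cG ex}.
have prop := cogen_proper lcM cK0 GK0 (fun m hm => hmin m (asboolT hm)).
have /choice[h hh] : forall x, exists l, G x -> K0 (x - lcomb g l).
  move=> x; have [Gx|nG'] := pselect (G x); last by exists (fun=> 0).
  have [k [_ [Kk [l ->] e]]] := GK0 x Gx; exists l => _.
  by rewrite e addrK.
have cKN := compact_opp cK0.
have [N hN] := prop _ (compact_addS cK0 (compact_addS cKN cKN)).
pose q i x : R := (h x i)%:~R.
(* The defect of [h] is a coefficient vector whose combination lies in a sum of [K0] and two copies
   of [- K0]; properness bounds such vectors by [N]. *)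
have qD i x y : G x -> G y -> `|q i (x + y) - q i x - q i y| <= N%:R.
  move=> Gx Gy; rewrite /q -!rmorphB /= intr_absz_le.
  pose l j : int := h x j + h y j - h (x + y) j.
  have -> : absz (h (x + y) i - h x i - h y i)%R = absz (l i) by rewrite /l; lia.
  apply: hN; have -> : lcomb g l = (x + y - lcomb g (h (x + y))) +
      (- (x - lcomb g (h x)) + - (y - lcomb g (h y))).
    by rewrite -lcombB -lcombD; zmod.
  apply: addSP; first by apply: hh; exact: sgD.
  by apply: addSP => /=; rewrite opprK; exact: hh.
pose f x : 'rV[R]_n := \row_i homogenize (q i) N%:R x.
have near x i : G x -> `|f x 0 i - q i x| <= N%:R.
  by move=> Gx; rewrite mxE; exact: (homogenize_near sG (qD i)).
exists G, n, f; split => //.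
- by move=> x y Gx Gy; apply/rowP => i; rewrite !mxE (homogenizeD sG (qD i)).
- move=> K cK; have [N1 hN1] := prop _ (compact_addS cK cKN).
  exists (N1%:R + N%:R) => x Gx Kx; apply: rV_norm_le => [|i]; first by rewrite addr_ge0.
  have h1 : `|q i x| <= N1%:R.
    rewrite intr_absz_le; apply: hN1.
    have -> : lcomb g (h x) = x + - (x - lcomb g (h x)) by zmod.
    by apply: addSP => //=; rewrite opprK; exact: hh.
  rewrite -(subrK (q i x) (f x 0 i)); apply: le_trans (ler_normD _ _) _.
  by rewrite addrC; apply: lerD => //; exact: near.
- move=> r; pose N2 := (Num.truncn (`|r| + N%:R)).+1.
  have [K [cK hK]] := lcomb_box g N2.
  exists (addS K0 K); split; first exact: compact_addS.
  move=> x Gx fr; have -> : x = (x - lcomb g (h x)) + lcomb g (h x) by zmod.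
  apply: addSP; first exact: hh.
  apply: hK => i; rewrite -(intr_absz_le R).
  apply: le_trans (ltW (truncnS_gt _)).
  rewrite -/(q i x) (_ : q i x = f x 0 i - (f x 0 i - q i x)); last by ring.
  apply: le_trans (ler_normB _ _) _; apply: lerD; last exact: near.
  by apply: le_trans (rV_coord_le _ _) _; apply: le_trans fr (ler_norm _).
Qed.

End LCAMap.

(** * Splitting off the Euclidean part *)

Section Structure.
Variables (R : realType) (A M : topologicalZmodType) (act : A -> M -> M).
Hypothesis hM : hausdorff_space M.
Hypothesis lcM : locally_compact [set: M].
Hypothesis hact : is_action act.
Hypothesis hW : Wflat act setT = [set 0].
Hypothesis hO : Omega_sharp act setT = setT.
Implicit Types (x y z : M) (K C D O W N : set M) (a b : A).

Lemma parafinite_eq0 N : compact_parafinite act N -> N `<=` [set 0].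
Proof. by move=> pN x Nx; rewrite -hW => H sH hN; exact: (hN N). Qed.

Lemma omega_full U : alg_submodule act U -> open U ->
  (forall N, alg_submodule act N -> U `<=` N -> finite_index U N -> N `<=` U) ->
  forall x, U x.
Proof.
move=> mU oU hU x; have : Omega_sharp act setT x by rewrite hO.
by apply; split => //; [exists U; rewrite setIT|move=> N mN UN _; exact: hU].
Qed.

Definition ell : set M := [set x | exists K, [/\ is_subgroup K, compact K & K x]].

Lemma compact_sg_ell K : is_subgroup K -> compact K -> K `<=` ell.
Proof. by move=> sK cK x Kx; exists K. Qed.

Lemma ell_submodule : alg_submodule act ell.
Proof.
split; first split.
- by exists [set 0]; split => //; [split => // x y -> ->; rewrite subrr|exact: compact_set1].
- move=> x y [K [sK cK Kx]] [D [sD cD Dy]]; exists (addS K D).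
  split; [exact: sg_addS|exact: compact_addS|].
  by apply: addSP => //; exact: sgN.
- move=> a x [K [sK cK Kx]]; exists [set y | K (act (- a) y)].
  by split; [exact: (sg_act hact)|exact: (compact_act hact)|rewrite /= (actK hact)].
Qed.
Let sell : is_subgroup ell := ell_submodule.1.

(** [K] together with its translates by the first [m] multiples of [x] is a compact subgroup, since
    [x *+ m] is already in [K]. *)
Lemma ell_divide x m : (0 < m)%N -> ell (x *+ m) -> ell x.
Proof.
move=> m0 [K [sK cK Kx]].
exists (addS [set y | y \in [seq x *+ i | i <- iota 0 m]] K); split; last first.
- have [m1|m1] := leqP m 1.
    have m1' : m = 1%N by lia.
    by exists 0, x; rewrite add0r; split => //;
      [apply/mapP; exists 0%N; rewrite ?mem_iota|move: Kx; rewrite m1'].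
  exists x, 0; rewrite addr0; split => //; last exact: sg0.
  by apply/mapP; exists 1%N; rewrite ?mem_iota ?add0n ?mulr1n.
- by apply: compact_addS => //; exact: compact_set_seq.
have red k y : K (y - x *+ k) ->
    addS [set y | y \in [seq x *+ i | i <- iota 0 m]] K y.
  move=> Ky; exists (x *+ (k %% m)), (y - x *+ (k %% m)); split; last by zmod.
    by apply/mapP; exists (k %% m)%N => //; rewrite mem_iota add0n ltn_mod.
  have -> : y - x *+ (k %% m) = (y - x *+ k) + (x *+ m) *+ (k %/ m).
    by rewrite {2}(divn_eq k m) mulrnDr mulnC mulrnA; zmod.
  by apply: sgD => //; exact: sgMn.
split; first by apply: (red 0%N); rewrite mulr0n subr0; exact: sg0.
move=> _ _ [_ [k [/mapP[i im ->] Kk ->]]] [_ [k' [/mapP[j jm ->] Kk' ->]]].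
have jlt : (j <= m)%N by move: jm; rewrite mem_iota => /andP[_] /ltnW.
apply: (red (i + (m - j))%N).
have -> : x *+ i + k - (x *+ j + k') - x *+ (i + (m - j)) = k - k' - x *+ m.
  by rewrite mulrnDr mulrnBr //; zmod.
by apply: sgB => //; exact: sgB.
Qed.

Variables (G : set M) (n : nat) (f : M -> 'rV[R]_n).
Hypothesis pm : proper_map G f.
Let sG := pm_sg pm.
Let nG := pm_nbhs pm.
Let fD := pm_add pm.

Lemma pmN x : G x -> f (- x) = - f x.
Proof.
move=> Gx; have f0 : f 0 = 0.
  by apply: (addrI (f 0)); rewrite -fD ?addr0 //; exact: sg0.
by apply/eqP; rewrite -addr_eq0 -fD ?addNr ?f0 //; exact: sgN.
Qed.
Lemma pmB x y : G x -> G y -> f (x - y) = f x - f y.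
Proof. by move=> Gx Gy; rewrite fD ?pmN //; exact: sgN. Qed.
Lemma pm0 : f 0 = 0.
Proof. by rewrite -(subrr 0) pmB ?subrr //; exact: sg0. Qed.
Lemma pmMn x k : G x -> f (x *+ k) = f x *+ k.
Proof.
move=> Gx; elim: k => [|k IH]; first by rewrite !mulr0n pm0.
by rewrite !mulrS fD ?IH //; exact: sgMn.
Qed.

(** If [x *+ k.+1] still lies in a fixed compact neighbourhood, the bound of [f] there gets divided
    by [k.+1]. *)
Lemma pm_small (e : R) : 0 < e -> exists W, nbhs (0 : M) W /\
  forall x, W x -> G x /\ `|f x| < e.
Proof.
move=> e0; have [K [cK nK]] := compact_nbhs0 lcM.
have [B hB] := pm_bounded pm cK.
have B1 : 0 < `|B| + 1 by have := normr_ge0 B; lra.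
have [k hk] := invS_lt (divr_gt0 e0 B1).
exists (G `&` [set x | (K `&` G) (x *+ k.+1)]); split.
  by apply: filterI => //; apply: nbhs0_mulrn; exact: filterI.
move=> x [Gx [Kx Gkx]]; split => //.
have := hB _ Gkx Kx; rewrite pmMn // -scaler_nat mx_normZ => h.
have k0 : 0 < k.+1%:R :> R by rewrite ltr0n.
move: hk; rewrite ltr_pdivlMr // mulrC -(ltr_pM2l k0).
rewrite mulrA mulrC mulrA mulVf ?mul1r ?lt0r_neq0 //.
rewrite ger0_norm ?ler0n // in h => hk.
rewrite -(ltr_pM2l k0); apply: le_lt_trans h _; apply: le_lt_trans (ler_norm B) _.
by move: hk; lra.
Qed.

Lemma pm_closed : closed G.
Proof. exact: sg_open_closed. Qed.

Lemma pm_fiber_closed v (r : R) : closed [set x | G x /\ `|f x - v| <= r].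
Proof.
move=> x cx; have Gx : G x by apply: pm_closed; apply: closureS cx => y [].
split => //; apply/ler_addgt0Pr => e e0.
have [W [nW hW']] := pm_small e0.
have [y [[Gy fy] Wy]] := (closureP0 _ _).1 cx W nW.
have [_] := hW' _ Wy; rewrite pmB // => fxy.
have -> : f x - v = (f x - f y) + (f y - v) by zmod.
by apply: le_trans (ler_normD _ _) _; rewrite addrC; apply: lerD => //; exact: ltW.
Qed.

Lemma pm_fiber_compact v (r : R) : compact [set x | G x /\ `|f x - v| <= r].
Proof.
have [K [cK hK]] := pm_proper pm (`|v| + r).
apply: (subclosed_compact _ cK); first exact: pm_fiber_closed.
move=> x [Gx fx]; apply: hK => //; rewrite -(subrK v (f x)) addrC.
by apply: le_trans (ler_normD _ _) _; exact: lerD.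
Qed.

Definition pmker := [set x | G x /\ f x = 0].

Lemma pmker_sg : is_subgroup pmker.
Proof.
split; first by split; [exact: sg0|exact: pm0].
by move=> x y [Gx fx] [Gy fy]; split; [exact: sgB|rewrite pmB // fx fy subrr].
Qed.
Lemma pmker_compact : compact pmker.
Proof.
rewrite (_ : pmker = [set x | G x /\ `|f x - 0| <= 0]); first exact: pm_fiber_compact.
rewrite predeqE => x; split => -[Gx h]; split => //; first by rewrite h subrr normr0.
by apply/eqP; move: h; rewrite subr0 normr_le0.
Qed.
Lemma pmker_ell : pmker `<=` ell.
Proof. exact: compact_sg_ell pmker_sg pmker_compact. Qed.

Lemma bounded_multiples (v : 'rV[R]_n) (B : R) : (forall k : nat, `|v *+ k| <= B) -> v = 0.
Proof.
move=> h; apply/eqP; apply: contrapT => /negP v0.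
have nv : 0 < `|v| by rewrite normr_gt0.
have := h (Num.truncn (B / `|v|)).+1; rewrite -scaler_nat mx_normZ ger0_norm ?ler0n //.
by apply/negP; rewrite -ltNge -ltr_pdivrMr // truncnS_gt.
Qed.

Lemma ell_pmker x : ell x -> G x -> f x = 0.
Proof.
move=> [K [sK cK Kx]] Gx; have [B hB] := pm_bounded pm cK.
apply: (@bounded_multiples _ B) => k; rewrite -pmMn //.
by apply: hB; exact: sgMn.
Qed.

(** A compact subgroup has no nonzero bounded image in R^n, so inside [G] the subgroup [ell]
    coincides with the compact kernel of [f]. *)
Lemma ell_closed : closed ell.
Proof.
apply: (sg_locally_closed (K := pmker) sell nG).
- by apply: compact_closed => //; exact: pmker_compact.
- by move=> x [ex Gx]; split => //; exact: ell_pmker.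
- exact: pmker_ell.
Qed.

Lemma pm_image_sg : is_subgroup (f @` G).
Proof.
split; first by exists 0; [exact: sg0|exact: pm0].
by move=> _ _ [x Gx <-] [y Gy <-]; exists (x - y); rewrite ?pmB //; exact: sgB.
Qed.

Lemma pm_image_closed : closed (f @` G).
Proof.
move=> v /closureP0 cv.
have [] := @compact_dir M nat 0%N [set x | G x /\ `|f x - v| <= 1]
  (fun k => [set x | G x /\ `|f x - v| <= k.+1%:R^-1]).
- exact: pm_fiber_compact.
- by move=> k; exact: pm_fiber_closed.
- move=> i j; exists (maxn i j); split=> x [Gx fx]; split => //; apply: le_trans fx _;
    by rewrite lef_pV2 ?posrE ?ltr0n // ler_nat ltnS ?leq_maxl ?leq_maxr.
- move=> k; have k0 : 0 < k.+1%:R^-1 :> R by rewrite invr_gt0 ltr0n.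
  have [_ [[x Gx <-] vx]] := cv _ (nbhs0_norm n k0).
  have h : `|f x - v| <= k.+1%:R^-1 by rewrite distrC; exact: ltW.
  exists x; split => //; split => //; apply: le_trans h _.
  by rewrite invf_le1 ?ltr0n // ler1n.
move=> x [_ hx]; exists x; first by have [] := hx 0%N.
apply/eqP; rewrite -subr_eq0 -normr_le0; apply/ler_addgt0Pr => e e0; rewrite add0r.
have [k hk] := invS_lt e0; have [_ h] := hx k.
by apply: le_trans h (ltW hk).
Qed.

Variable p : 'M[R]_n.
Hypothesis Hp : forall v, (f @` G) (v *m p).
Hypothesis pp : p *m p = p.
Hypothesis pe : exists e : R, 0 < e /\ forall v, (f @` G) v -> `|v| < e -> v *m p = v.

(** The part of [G] above the image of [p], a subspace that fills f(G) near 0; thus it is open, and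
    divisible modulo the kernel of [f]. *)
Definition Gdiv := [set x | G x /\ f x *m p = f x].

Lemma Gdiv_sg : is_subgroup Gdiv.
Proof.
split; first by split; [exact: sg0|rewrite pm0 mul0mx].
by move=> x y [Gx fx] [Gy fy]; split; [exact: sgB|rewrite pmB // mulmxBl fx fy].
Qed.

Lemma pm_lift v : v *m p = v -> exists x, Gdiv x /\ f x = v.
Proof.
by move=> vp; have [x Gx fx] := Hp v; exists x; rewrite /Gdiv /= fx vp.
Qed.

Lemma Gdiv_nbhs : nbhs (0 : M) Gdiv.
Proof.
have [e [e0 he]] := pe; have [W [nW hW']] := pm_small e0.
by apply: filterS nW => x /hW'[Gx fx]; split => //; apply: he => //; exists x.
Qed.

(* A description of Gdiv + ell that does not mention f, hence is invariant under A. *)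
Lemma Gdiv_ellP x : addS Gdiv ell x <-> forall W, nbhs (0 : M) W ->
  exists w k, [/\ W w, (0 < k)%N & ell (x - w *+ k)].
Proof.
split => [[g [l [[Gg fg] el ->]]] W nW|h].
- have [k hk] : exists k : nat, forall x, [set x | G x /\ `|f x - 0| <= k.+1%:R^-1] x ->
      exists y, (forall j : nat, [set x | G x /\ `|f x - 0| <= j.+1%:R^-1] y) /\ W (x - y).
    apply: (compact_dir_nbhs 0%N hM _ _ nW) => [k|i j]; first exact: pm_fiber_compact.
    exists (maxn i j); split=> y [Gy fy]; split => //; apply: le_trans fy _;
      by rewrite lef_pV2 ?posrE ?ltr0n // ler_nat ltnS ?leq_maxl ?leq_maxr.
  (* For this [m] the vector [f g / m] is short enough for [hk] to place its lift [w0] within [W] of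
     a kernel element [c]; [w0 - c] is then the required small element. *)
  pose m := (Num.truncn (`|f g| * k.+1%:R)).+1.
  have m0 : 0 < m%:R :> R by rewrite ltr0n.
  have [|w0 [[Gw0 _] fw0]] := @pm_lift (m%:R^-1 *: f g).
    by rewrite -scalemxAl fg.
  have [|c [hc Wc]] := hk w0.
    split => //; rewrite subr0 fw0 mx_normZ normfV (ger0_norm (ltW m0)).
    rewrite ler_pdivrMl // ler_pdivlMr ?ltr0n //.
    exact/ltW/truncnS_gt.
  have Gc : G c by have [] := hc 0%N.
  have fc : f c = 0.
    apply/eqP; rewrite -normr_le0; apply/ler_addgt0Pr => e e0; rewrite add0r.
    have [j hj] := invS_lt e0; have [_ h] := hc j; rewrite subr0 in h.
    exact: le_trans h (ltW hj).
  exists (w0 - c), m; split => //.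
  have Gw : G (w0 - c) by exact: sgB.
  have Gwm : G ((w0 - c) *+ m) by exact: sgMn.
  rewrite addrAC; apply: (sgD sell) => //; apply: pmker_ell; split; first exact: sgB.
  rewrite pmB // pmMn // pmB // fc subr0 fw0 -scaler_nat scalerA divff ?scale1r ?subrr //.
  by rewrite lt0r_neq0.
- have [w [k [Gw k0 ew]]] := h _ Gdiv_nbhs.
  exists (w *+ k), (x - w *+ k); split => //; last by zmod.
  by apply: (sgMn _ Gdiv_sg).
Qed.

(** [Gdiv + ell] is an open submodule. If a positive multiple [y *+ m] lies in it, its [Gdiv]
    component is divided by [m] up to the kernel of [f], and the rest of [y] is in [ell] by
    [ell_divide]. *)
Lemma Gdiv_ell x : addS Gdiv ell x.
Proof.
have sU := sg_addS Gdiv_sg sell.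
apply: omega_full.
- split => // a y /Gdiv_ellP h; apply/Gdiv_ellP => W nW.
  have [w [k [Ww k0 ew]]] := h _ (act_nbhs hact a nW).
  exists (act a w), k; split => //.
  have -> : act a w *+ k = act a (w *+ k).
    by elim: (k) => [|i IH]; rewrite ?mulr0n ?(actr0 hact) // !mulrS (actD hact) IH.
  by rewrite -(actB hact); exact: ell_submodule.2.
- apply: (sg_open (W := Gdiv)) => //; first exact: Gdiv_nbhs.
  exact: addSl.
move=> N [sN aN] UN fN y Ny.
have [i [j [ij /(sgN sU)]]] := finite_index_recur sU fN (fun k => sgMn k sN Ny).
rewrite opprB -mulrnBr 1?ltnW //.
have : (0 < j - i)%N by rewrite subn_gt0.
move: (j - i)%N => m m0 [z [l [[Gz fz] el e]]].
have m0' : m%:R != 0 :> R by rewrite pnatr_eq0 -lt0n.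
have [|w [hw fw]] := @pm_lift (m%:R^-1 *: f z); first by rewrite -scalemxAl fz.
have -> : y = w + (y - w) by zmod.
apply: addSP => //; apply: (ell_divide m0).
have -> : (y - w) *+ m = (z - w *+ m) + l.
  by rewrite mulrnBl e; zmod.
apply: (sgD sell) => //; apply: pmker_ell.
have Gw := hw.1.
split; first by apply: sgB => //; exact: sgMn.
rewrite pmB ?pmMn //; last exact: sgMn.
by rewrite fw -scaler_nat scalerA divff // scale1r subrr.
Qed.

Let mell := ell_submodule.
Local Notation osubE := (osub ell).

Lemma pmker_osub : osubE pmker.
Proof.
split; [exact: pmker_sg|exact: pmker_ell|exact: pmker_compact|].
by exists G; split => // x [Gx ex]; split => //; exact: ell_pmker.
Qed.

Lemma ell_osub X : compact X -> X `<=` ell -> exists C, osubE C /\ X `<=` C.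
Proof.
move=> cX Xe; have [s [sX Xs]] := compact_net cX (@subset_refl _ X) nG.
have [C [oC KC sC]] : exists C, [/\ osubE C, pmker `<=` C & forall y, y \in s -> C y].
  elim: s sX {Xs} => [|y s IH] sX; first by exists pmker; split => //; exact: pmker_osub.
  have [|C [oC KC sC]] := IH; first by move=> z zs; apply: sX; rewrite inE zs orbT.
  have [K [sK cK Ky]] := Xe y (sX y (mem_head _ _)).
  have CCK : C `<=` addS C K by exact: addSl.
  exists (addS C K); split.
  - by apply: (osubU mell) => //; exact: compact_sg_ell.
  - by move=> z /KC /CCK.
  - move=> z; rewrite inE => /predU1P[->|/sC/CCK//].
    by apply: addSr => //; exact: osub_sg oC.
exists C; split => // x Xx; have [y ys Gy] := Xs x Xx.
rewrite -(subrK y x); apply: (sgD (osub_sg oC)); last exact: sC.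
have exy : ell (x - y) by apply: (sgB sell); apply: Xe => //; exact: sX.
by apply: KC; split => //; exact: ell_pmker.
Qed.

Lemma osub_near V : nbhs (0 : M) V -> exists O, osubE O /\
  forall x, O x -> exists y, (forall C, osubE C -> C y) /\ V (x - y).
Proof.
move=> nV.
have [[ O oO] /= hO'] : exists i : {C | osubE C}, forall x, sval i x ->
    exists y, (forall j : {C | osubE C}, sval j y) /\ V (x - y).
  apply: (compact_dir_nbhs (exist _ _ pmker_osub) hM) => //.
    by case=> D oD /=; exact: osub_compact oD.
  case=> D oD [D' oD']; exists (exist _ _ (osubI hM oD oD')) => /=.
  by split => y [].
exists O; split => // x /hO'[y [hy Vy]]; exists y; split => // D oD.
exact: (hy (exist _ D oD)).
Qed.

(** The intersection [Q] of all compact open subgroups of [ell] is a compact parafinite submodule: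
    given [N'] of finite index in [Q], the elements of a small compact open subgroup that are near
    [N'] form one more such subgroup, hence it contains [Q]. *)
Lemma osub_cap0 x : (forall C, osubE C -> C x) -> x = 0.
Proof.
pose Q := [set x | forall C, osubE C -> C x].
suff Q0 : Q `<=` [set 0] by exact: Q0.
have QK : Q `<=` pmker by move=> y /(_ _ pmker_osub).
have sQ : is_subgroup Q.
  split=> [C oC|y z hy hz C oC]; first exact: (sg0 (osub_sg oC)).
  by apply: (sgB (osub_sg oC)); [exact: hy|exact: hz].
have cQ : closed Q.
  move=> y cy C oC; apply: (osub_closed hM oC); apply: closureS cy => z; exact.
have kQ : compact Q by apply: (subclosed_compact cQ pmker_compact).
have aQ b y : Q y -> Q (act b y).
  by move=> hy C oC; exact: (hy _ (osub_act hact mell b oC)).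
apply: parafinite_eq0; split => // N' [[sN' aN'] cN'] N'Q fN'.
apply/seteqP; split => //.
have [W [nW WN']] := closed_finite_index_open sN' cN' fN'.
have [V [nV sV VW]] := nbhs0_split nW; have [V1 [nV1 sV1 VV1]] := nbhs0_split nV.
have V1V y : V1 y -> V y.
  by move=> h; rewrite -(addr0 y); apply: VV1 => //; exact: nbhs_singleton.
have [ O [oO hO']] := osub_near nV1.
(* [H] is a subgroup because [N'] is relatively open in [Q]: a difference of two elements is near
   some [q] in [Q], and [q] is so near an element of [N'] that it lies in [N']. *)
pose H := [set y | O y /\ exists z, N' z /\ V1 (y - z)].
have sO := osub_sg oO.
have sH : is_subgroup H.
  split; first by split; [exact: sg0|exists 0; rewrite subr0; split;
    [exact: sg0|exact: nbhs_singleton]].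
  move=> y y' [Oy [z [Nz Vz]]] [Oy' [z' [Nz' Vz']]].
  have Oyy : O (y - y') by exact: sgB.
  split => //; have [q [Qq Vq]] := hO' _ Oyy; exists q; split => //.
  have hq : N' (q - (z - z')).
    apply: WN'; split; last by apply: (sgB sQ) => //; apply: (sgB sQ); exact: N'Q.
    have -> : q - (z - z') = (y - z + - (y' - z')) + - (y - y' - q) by zmod.
    by apply: VW; [apply: VV1 => //; exact: sV1|apply: V1V; exact: sV1].
  by rewrite -(subrK (z - z') q); apply: sgD => //; exact: sgB.
have oH : osubE H.
  have [V2 [nV2 V2O]] := osub_nbhs oO.
  have nb : (V1 `&` V2) `&` ell `<=` H.
    move=> y [[V1y V2y] ey]; split; first exact: V2O.
    by exists 0; rewrite subr0; split => //; exact: sg0.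
  split => //.
  - by move=> y [/(osub_L oO)].
  - apply: (subclosed_compact _ (osub_compact oO)); last by move=> y [].
    apply: (sg_locally_closed (K := O `&` H) sH (filterT : nbhs (0 : M) setT)); last by move=> y [].
      move=> y cy.
      have Oy : O y by apply: (osub_closed hM oO); apply: closureS cy => z [].
      split => //; have [z [[Oz Hz] Vz]] := (closureP0 _ _).1 cy _ (filterI nV1 nV2).
      rewrite -(subrK z y); apply: (sgD sH) => //; apply: nb; split => //.
      by apply: (osub_L oO); exact: sgB.
    by move=> y [[Oy hy] _]; split.
  - by exists (V1 `&` V2); split => //; exact: filterI.
move=> y Qy; have [_ [z [Nz Vz]]] := Qy _ oH.
rewrite -(subrK z y); apply: sgD => //; apply: WN'; split.
  rewrite -(addr0 (y - z)); apply: VW; first exact: V1V.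
  exact: nbhs_singleton.
by apply: (sgB sQ) => //; exact: N'Q.
Qed.

Lemma ell_basis W : nbhs (0 : M) W -> exists C, osubE C /\ C `<=` W.
Proof.
move=> /osub_near[ O [oO h]]; exists O; split => // x /h[y [/osub_cap0 ->]].
by rewrite subr0.
Qed.

(** Modulo an open subgroup [O] the compact kernel is finite, so one factorial kills it; an element
    divisible by every factorial therefore lies in every [O]. *)
Lemma pmker_divisible0 x : (forall k, exists z, pmker z /\ x = z *+ k`!) -> x = 0.
Proof.
move=> h; apply: osub_cap0 => O oO; have sO := osub_sg oO.
have [W [nW WO]] := osub_nbhs oO.
have [s [sK Ks]] := compact_net pmker_compact (@subset_refl _ _) nW.
have [k hk] : exists k, forall y, y \in s -> forall l, (k <= l)%N -> O (y *+ l`!).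
  elim: s sK {Ks} => [|y s IH] sK; first by exists 0%N.
  have [|k hk] := IH; first by move=> z zs; apply: sK; rewrite inE zs orbT.
  have Ky := sK y (mem_head _ _).
  have [|i [j [ij Wij]]] := @compact_recurrence M pmker (fun m => y *+ m) W pmker_compact _ nW.
    by move=> m; exact: (sgMn _ pmker_sg).
  have Oij : O (y *+ (j - i)).
    rewrite mulrnBr 1?ltnW // -opprB; apply: sgN => //; apply: WO; split => //.
    by apply: pmker_ell; apply: (sgB pmker_sg); exact: (sgMn _ pmker_sg).
  exists (maxn k (j - i)) => z; rewrite inE => zs l; rewrite geq_max => /andP[kl jl].
  case/predU1P: zs => [->|zs]; last exact: hk.
  have /dvdnP[q ->] : (j - i %| l`!)%N by rewrite dvdn_fact // subn_gt0 ij.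
  by rewrite mulnC mulrnA; exact: sgMn.
have [z [Kz ->]] := h k; have [y ys Wy] := Ks z Kz.
rewrite -(subrK y z) mulrnDl; apply: sgD => //; last exact: hk.
apply: sgMn => //; apply: WO; split => //.
by apply: pmker_ell; apply: (sgB pmker_sg) => //; exact: sK.
Qed.

(* The kernel of f on Gdiv is profinite, hence without divisible elements; so the
   divisible elements of Gdiv form a complement to it. *)
Definition Vdiv := [set x | Gdiv x /\ forall k, exists z, Gdiv z /\ x = z *+ k`!].

Lemma Vdiv_sg : is_subgroup Vdiv.
Proof.
have sg := Gdiv_sg; split.
  by split; [exact: (sg0 sg)|move=> k; exists 0; rewrite mul0rn; split => //; exact: (sg0 sg)].
move=> x y [Gx hx] [Gy hy]; split; first exact: (sgB sg).
move=> k; have [z [Gz ->]] := hx k; have [z' [Gz' ->]] := hy k.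
by exists (z - z'); rewrite mulrnBl; split => //; exact: (sgB sg).
Qed.

Let factNZ k : k`!%:R != 0 :> R. Proof. by rewrite pnatr_eq0 -lt0n fact_gt0. Qed.

Lemma Vdiv_inj x : Vdiv x -> f x = 0 -> x = 0.
Proof.
move=> [Gx hx] fx; apply: pmker_divisible0 => k; have [z [[Gz _] e]] := hx k.
exists z; split => //; split => //; apply/eqP.
have : f x = k`!%:R *: f z by rewrite e pmMn // scaler_nat.
by rewrite fx => /esym/eqP; rewrite scaler_eq0 (negbTE (factNZ k)).
Qed.

(** [X k], the fibre over [v / k!] multiplied by [k!], is compact and decreasing in [k]; a common
    point lies over [v] and is divisible by every factorial. The bound [<= 0] expresses the fibre in
    the form whose compactness is known. *)
Lemma Vdiv_lift v : v *m p = v -> exists x, Vdiv x /\ f x = v.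
Proof.
move=> vp; pose X k := (fun z => z *+ k`!) @` [set z | G z /\ `|f z - k`!%:R^-1 *: v| <= 0].
have XE k z : G z -> `|f z - k`!%:R^-1 *: v| <= 0 -> f z = k`!%:R^-1 *: v.
  by move=> _; rewrite normr_le0 subr_eq0 => /eqP.
have cX k : compact (X k).
  by apply: compact_image; [exact: mulrn_continuous|exact: pm_fiber_compact].
have XS k l : (k <= l)%N -> X l `<=` X k.
  move=> /subnK <-; elim: (l - k)%N => // i IH x [z [Gz fz] <-]; apply: IH.
  exists (z *+ (i + k).+1); last by rewrite -mulrnA -factS.
  split; first exact: sgMn.
  rewrite pmMn // (XE _ _ Gz fz) factS -scaler_nat scalerA natrM invfM mulrA.
  by rewrite divff ?pnatr_eq0 // mul1r subrr normr0.
have [] := @compact_dir M nat 0%N (X 0%N) X.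
- exact: cX.
- by move=> k; apply: compact_closed.
- by move=> i j; exists (maxn i j); split; apply: XS; rewrite ?leq_maxl ?leq_maxr.
- move=> k; have [|z [[Gz _] fz]] := @pm_lift (k`!%:R^-1 *: v); first by rewrite -scalemxAl vp.
  have Xk : X k (z *+ k`!) by exists z => //; split => //; rewrite fz subrr normr0.
  by exists (z *+ k`!); split => //; exact: XS Xk.
move=> x [_ hx].
have hx' k : exists z, [/\ Gdiv z, f z = k`!%:R^-1 *: v & x = z *+ k`!].
  have [z [Gz fz] <-] := hx k; have fz' := XE _ _ Gz fz.
  by exists z; split => //; split => //; rewrite fz' -scalemxAl vp.
have [z [hz fz e]] := hx' 0%N.
have fx : f x = v.
  by rewrite e pmMn ?fz; [rewrite fact0 invr1 scale1r mulr1n|have [] := hz].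
exists x; split => //; split; last by move=> k; have [z' [? _ ?]] := hx' k; exists z'.
by rewrite e; apply: (sgMn _ Gdiv_sg).
Qed.

(** Continuity of the inverse of [f] on [Vdiv]. The sets [E k] are compact, because divisibility by
    a fixed factorial is a closed condition on a compact fibre, and by [Vdiv_inj] they shrink to
    0. *)
Lemma Vdiv_small W : nbhs (0 : M) W -> exists e : R, 0 < e /\
  forall x, Vdiv x -> `|f x| < e -> W x.
Proof.
move=> nW; pose E (k : nat) := [set x | Vdiv x /\ `|f x| <= k.+1%:R^-1].
have cE k : compact (E k).
  pose r : R := k.+1%:R^-1.
  apply: (subclosed_compact _ (@pm_fiber_compact 0 r)); last first.
    by move=> x [[[Gx _] _] fx]; split => //; rewrite subr0.
  have cP (l : nat) : closed ((fun z => z *+ l) @` [set z | G z /\ `|f z - 0| <= r]).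
    apply: compact_closed => //; apply: compact_image; last exact: pm_fiber_compact.
    exact: mulrn_continuous.
  move=> x cx.
  have hx l : exists z, [/\ G z, `|f z| <= r & x = z *+ l`!].
    suff : ((fun z => z *+ l`!) @` [set z | G z /\ `|f z - 0| <= r]) x.
      by move=> [z [Gz fz] <-]; exists z; split => //; move: fz; rewrite subr0.
    apply: cP; apply: closureS cx => y [[_ hy] fy].
    have [z [[Gz _] e]] := hy l; exists z => //; split => //; rewrite subr0.
    move: fy; rewrite e pmMn // -scaler_nat mx_normZ ger0_norm ?ler0n //.
    by apply: le_trans; rewrite ler_peMl // ler1n fact_gt0.
  have [Gx fx] : G x /\ `|f x - 0| <= r.
    by apply: pm_fiber_closed; apply: closureS cx => y [[[Gy _] _] fy]; rewrite /= subr0.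
  have fxp : f x *m p = f x.
    apply/eqP; rewrite -subr_eq0 -normr_le0; apply/ler_addgt0Pr => e e0; rewrite add0r.
    have [c [c0 hc]] := rV_mulmx_le (p - 1%:M).
    have [W' [nW' hW']] := pm_small (divr_gt0 e0 c0).
    have [y [[[[Gy fy] _] _] Wy]] := (closureP0 _ _).1 cx _ nW'.
    have -> : f x *m p - f x = f (x - y) *m (p - 1%:M).
      by rewrite pmB // mulmxBr mulmx1 mulmxBl fy; zmod.
    apply: le_trans (hc _) _; rewrite mulrC -ler_pdivlMr //; apply: ltW.
    by have [] := hW' _ Wy.
  split; last by rewrite subr0 in fx.
  split => // l; have [z [Gz _ e]] := hx l; exists z; split => //; split => //.
  have : f x = l`!%:R *: f z by rewrite e pmMn // scaler_nat.
  move=> /(congr1 (fun v => l`!%:R^-1 *: v)); rewrite scalerA mulVf // scale1r => <-.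
  by rewrite -scalemxAl fxp.
have [k hk] : exists k : nat, forall x, E k x ->
    exists y, (forall j : nat, E j y) /\ W (x - y).
  apply: (compact_dir_nbhs 0%N hM _ _ nW) => // i j.
  exists (maxn i j); split=> y [Vy fy]; split => //; apply: le_trans fy _;
    by rewrite lef_pV2 ?posrE ?ltr0n // ler_nat ltnS ?leq_maxl ?leq_maxr.
exists k.+1%:R^-1; split; first by rewrite invr_gt0 ltr0n.
move=> x Vx fx; have [|y [hy Wy]] := hk x; first by split => //; exact: ltW.
suff y0 : y = 0 by rewrite y0 subr0 in Wy.
apply: Vdiv_inj; first by have [] := hy 0%N.
apply/eqP; rewrite -normr_le0; apply/ler_addgt0Pr => e e0; rewrite add0r.
have [j hj] := invS_lt e0; have [_ h] := hy j.
by apply: le_trans h (ltW hj).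
Qed.

(** [F] applies [f] to a [Gdiv] component, which is well defined as [f] vanishes on [Gdiv] and [ell]
    together; [s] lifts to [Vdiv], where injectivity of [f] makes the lift additive. [row_base p]
    gives coordinates on the image of [p]. *)
Lemma Euclidean_split_aux : exists (F : M -> 'rV[R]_(\rank p)) (s : 'rV[R]_(\rank p) -> M),
  [/\ forall x y, F (x + y) = F x + F y, continuous F,
      forall u v, s (u + v) = s u + s v, continuous s & cancel s F] /\
  (forall x, F x = 0 <-> ell x).
Proof.
pose B := row_base p.
have Bp (c : 'rV[R]_(\rank p)) : c *m B *m p = c *m B.
  have /submxP[u ->] : (c *m B <= p)%MS.
    by apply: submx_trans (submxMl _ _) _; rewrite eq_row_base.
  by rewrite -mulmxA pp.
have pB (v : 'rV[R]_n) : v *m p = v -> v *m pinvmx B *m B = v.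
  by move=> vp; apply: mulmxKpV; rewrite eq_row_base -vp submxMl.
have BK (c : 'rV[R]_(\rank p)) : c *m B *m pinvmx B = c by rewrite -mulmxA mulmxVp ?mulmx1 // row_base_free.
have Gell x : Gdiv x -> ell x -> f x = 0 by move=> [Gx _] /ell_pmker; apply.
have /choice[g hg] : forall x, exists g, Gdiv g /\ ell (x - g).
  by move=> x; have [g [l [Gg el ->]]] := Gdiv_ell x; exists g; rewrite addrC addKr.
have gE x y : Gdiv y -> ell (x - y) -> f (g x) = f y.
  move=> Gy exy; have [Gx ex] := hg x.
  apply/eqP; rewrite -subr_eq0 -pmB; [|by have [] := Gx|by have [] := Gy].
  apply/eqP/Gell; first exact: (sgB Gdiv_sg).
  have -> : g x - y = (x - y) - (x - g x) by zmod.
  exact: (sgB sell).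
have /choice[s hs] : forall c : 'rV[R]_(\rank p), exists x, Vdiv x /\ f x = c *m B.
  by move=> c; exact: (Vdiv_lift (Bp c)).
have sD u v : s (u + v) = s u + s v.
  have [Vu fu] := hs u; have [Vv fv] := hs v; have [Vw fw] := hs (u + v).
  have GV x : Vdiv x -> G x by move=> [[]].
  have Vuv : Vdiv (s u + s v) by exact: (sgD Vdiv_sg).
  apply/subr0_eq/Vdiv_inj; first exact: (sgB Vdiv_sg).
  rewrite pmB ?fD ?fu ?fv ?fw; try exact: GV.
  by rewrite mulmxDl subrr.
exists (fun x => f (g x) *m pinvmx B), s.
have FD x y : f (g (x + y)) *m pinvmx B = f (g x) *m pinvmx B + f (g y) *m pinvmx B.
  have [Gx ex] := hg x; have [Gy ey] := hg y.
  rewrite -mulmxDl (gE _ (g x + g y)) ?fD //; try (by case: Gx); try (by case: Gy).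
    exact: (sgD Gdiv_sg).
  have -> : x + y - (g x + g y) = (x - g x) + (y - g y) by zmod.
  exact: (sgD sell).
split; first split => //.
- apply: additive_continuous => // W /nbhs0_normP[e [e0 he]].
  have [c [c0 hc]] := rV_mulmx_le (pinvmx B).
  have [W' [nW' hW']] := pm_small (divr_gt0 e0 c0).
  apply: filterS (filterI nW' Gdiv_nbhs) => x [Wx Gx] /=; apply: he.
  rewrite (gE x x) ?subrr; [|by []|exact: (sg0 sell)].
  apply: le_lt_trans (hc _) _; rewrite mulrC -ltr_pdivlMr //.
  by have [] := hW' _ Wx.
- apply: additive_continuous => // W nW.
  have [e [e0 he]] := Vdiv_small nW.
  have [c [c0 hc]] := rV_mulmx_le B.
  apply: filterS (nbhs0_norm _ (divr_gt0 e0 c0)) => v /= hv.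
  have [Vv fv] := hs v; apply: he => //; rewrite fv.
  by apply: le_lt_trans (hc _) _; rewrite mulrC -ltr_pdivlMr.
- move=> v; have [[Gv _] fv] := hs v.
  by rewrite (gE _ (s v)) ?subrr ?fv ?BK //; exact: (sg0 sell).
move=> x; have [Gx ex] := hg x; split=> [F0|exl].
  rewrite -(subrK (g x) x); apply: (sgD sell) => //; apply: pmker_ell.
  by split; [have [] := Gx|rewrite -(pB (f (g x))) ?F0 ?mul0mx //; have [] := Gx].
rewrite Gell ?mul0mx //.
have -> : g x = x - (x - g x) by zmod.
exact: (sgB sell).
Qed.

End Structure.

Record euclid_split (R : realType) (M : topologicalZmodType) d
    (F : M -> 'rV[R]_d) (s : 'rV[R]_d -> M) : Prop := EuclidSplit {
  esFD : forall x y, F (x + y) = F x + F y;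
  esF_cont : continuous F;
  essD : forall u v, s (u + v) = s u + s v;
  ess_cont : continuous s;
  essK : cancel s F;
  es_ell : forall x, F x = 0 <-> @ell M x
}.

Theorem sheer_euclid_split (R : realType) (A M : topologicalZmodType)
    (act : A -> M -> M) : LCA_group M -> is_action act -> sheer act setT ->
  [/\ exists d (F : M -> 'rV[R]_d) (s : 'rV[R]_d -> M), euclid_split F s,
      closed (@ell M),
      forall W, nbhs (0 : M) W -> exists C, osub (@ell M) C /\ C `<=` W &
      forall X, compact X -> X `<=` @ell M ->
        exists C, osub (@ell M) C /\ X `<=` C].
Proof.
move=> [hM lcM] hact [hW hO].
have [G [n [f pm]]] := proper_map_ex R lcM.
have [p [Hp pp pe]] := closed_subgroup_lines (pm_image_sg pm) (pm_image_closed lcM pm).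
split.
- have [F [s [[FD Fc sD sc sK] Fe]]] := Euclidean_split_aux hM lcM hact hW hO pm Hp pp pe.
  by exists (\rank p), F, s.
- exact: (ell_closed hM lcM hact pm).
- exact: (ell_basis hM lcM hact hW pm).
- exact: (ell_osub lcM hact pm).
Qed.

(** * Spectral decomposition of real matrices by modulus *)

Section RealLimits.
Variable R : realType.

Definition to0 (u : nat -> R) := forall e, 0 < e -> exists N, forall n, (N <= n)%N -> u n < e.

Lemma expr_to0 (r : R) : 0 <= r -> r < 1 -> to0 (fun n => r ^+ n).
Proof.
move=> r0 r1 e e0.
have /cvgrPdist_lt/(_ e e0)[N _ hN] : r ^+ n @[n --> \oo] --> (0 : R).
  by apply: cvg_expr; rewrite ger0_norm.
exists N => n /hN /=; rewrite sub0r normrN ger0_norm // exprn_ge0 //.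
Qed.

Lemma contraction_to0 (r : R) (x y : nat -> R) : 0 <= r -> r < 1 ->
  (forall n, 0 <= x n) -> (forall n, x n.+1 <= r * x n + y n) -> to0 y -> to0 x.
Proof.
move=> r0 r1 x0 xS hy e e0.
(* With a perturbation of this size, [e / 2] is the fixed point of the recursion; the initial value
   decays above it. *)
have d0 : 0 < e * (1 - r) / 2 by rewrite divr_gt0 // mulr_gt0 // subr_gt0.
have [N hN] := hy _ d0.
have bnd k : x (N + k)%N <= r ^+ k * x N + e / 2.
  elim: k => [|k IH]; first by rewrite addn0 expr0 mul1r lerDl divr_ge0 // ltW.
  rewrite addnS; apply: le_trans (xS _) _.
  have h1 := ltW (hN _ (leq_addr k N)).
  have h2 : r * x (N + k)%N <= r * (r ^+ k * x N + e / 2) by rewrite ler_wpM2l.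
  by rewrite exprS; move: h1 h2; rewrite !mulrDr !mulrA; nra.
have xN : 0 < x N + 1 by have := x0 N; lra.
have [K hK] := expr_to0 r0 r1 (divr_gt0 (divr_gt0 e0 (ltr0Sn _ 1)) xN).
exists (N + K)%N => n le.
have nN : (N <= n)%N := leq_trans (leq_addr _ _) le.
rewrite -(subnKC nN); apply: le_lt_trans (bnd _) _.
have := hK (n - N)%N; rewrite leq_subRL // => /(_ le); rewrite ltr_pdivlMr // => h.
have rk : 0 <= r ^+ (n - N) by rewrite exprn_ge0.
by move: h; rewrite mulrDr mulr1; lra.
Qed.
End RealLimits.

Section Spectral.
Variable R : realType.
Local Notation C := (R[i]).
Local Notation toC := (map_mx (real_complex R)).
Local Notation normc := (@ComplexField.Normc.normc R).

(** A norm with values in [R], as the norm of [R[i]] takes its values in [R[i]]. *)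
Definition cnorm d (v : 'rV[C]_d) : R := \sum_i normc (v 0 i).
Definition mxiter (K : pzRingType) d (B : 'M[K]_d) n (v : 'rV[K]_d) := iter n (mulmx^~ B) v.
(* [mxroots B s v] is v times the product of the B - z for z in s; unlike
   [horner_mx] it makes sense in dimension 0. *)
Definition mxroots d (B : 'M[C]_d) (s : seq C) (v : 'rV[C]_d) :=
  foldl (fun w z => w *m B - z *: w) v s.

Lemma normc_ge0 (z : C) : 0 <= normc z.
Proof. by case: z => a b; rewrite /= sqrtr_ge0. Qed.
Lemma normc_real (x : R) : normc (real_complex R x) = `|x|.
Proof. by rewrite /= expr0n addr0 sqrtr_sqr. Qed.
Lemma normc_eq1 (z : C) : (`|z| = 1) <-> (normc z = 1).
Proof.
split=> [|e]; last by rewrite /Num.norm /= e.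
by move/(congr1 (@complex.Re R)).
Qed.

Lemma cnorm_ge0 d (v : 'rV[C]_d) : 0 <= cnorm v.
Proof. by apply: sumr_ge0 => i _; exact: normc_ge0. Qed.
Lemma cnormD d (v w : 'rV[C]_d) : cnorm (v + w) <= cnorm v + cnorm w.
Proof.
rewrite -big_split /=; apply: ler_sum => i _; rewrite mxE.
exact: le_normcD.
Qed.
Lemma cnormZ d z (v : 'rV[C]_d) : cnorm (z *: v) = normc z * cnorm v.
Proof.
by rewrite /cnorm mulr_sumr; apply: eq_bigr => i _; rewrite mxE ComplexField.Normc.normcM.
Qed.
Lemma cnormN d (v : 'rV[C]_d) : cnorm (- v) = cnorm v.
Proof.
by rewrite /cnorm; apply: eq_bigr => i _; rewrite mxE normcN.
Qed.
Lemma cnorm_eq0 d (v : 'rV[C]_d) : cnorm v = 0 -> v = 0.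
Proof.
move=> /eqP; rewrite psumr_eq0 => [|i _]; last exact: normc_ge0.
move=> /allP h; apply/rowP => i; rewrite mxE; apply: ComplexField.Normc.eq0_normc.
by apply/eqP/(h i); rewrite mem_index_enum.
Qed.
Lemma cnorm_real d (v : 'rV[R]_d) : `|v| <= cnorm (toC v).
Proof.
apply: rV_norm_le => [|i]; first exact: cnorm_ge0.
rewrite /cnorm (bigD1 i) //= !mxE normc_real lerDl.
by apply: sumr_ge0 => j _; exact: normc_ge0.
Qed.
Lemma cnorm_real_le d (v : 'rV[R]_d) : cnorm (toC v) <= d%:R * `|v|.
Proof.
apply: (@le_trans _ _ (\sum_(i < d) `|v|)); last by rewrite sumr_const card_ord mulr_natl.
by apply: ler_sum => i _; rewrite mxE normc_real; exact: rV_coord_le.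
Qed.

Lemma mxiterD (K : comPzRingType) d (B : 'M[K]_d) n v w :
  mxiter B n (v + w) = mxiter B n v + mxiter B n w.
Proof. by elim: n => //= n; rewrite /mxiter /= => ->; rewrite mulmxDl. Qed.
Lemma mxiterZ (K : comPzRingType) d (B : 'M[K]_d) n z v :
  mxiter B n (z *: v) = z *: mxiter B n v.
Proof. by elim: n => //= n; rewrite /mxiter /= => ->; rewrite scalemxAl. Qed.
Lemma mxiterB (K : comPzRingType) d (B : 'M[K]_d) n v w :
  mxiter B n (v - w) = mxiter B n v - mxiter B n w.
Proof. by rewrite mxiterD -scaleN1r mxiterZ scaleN1r. Qed.
Lemma mxiterS (K : comPzRingType) d (B : 'M[K]_d) n v :
  mxiter B n.+1 v = mxiter B n (v *m B).
Proof. by rewrite /mxiter iterSr. Qed.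
Lemma toC_mxiter d (B : 'M[R]_d) n v : toC (mxiter B n v) = mxiter (toC B) n (toC v).
Proof. by elim: n => //= n; rewrite /mxiter /= => <-; rewrite map_mxM. Qed.

(** Induction on the roots instead of a Jordan form: with [w = v *m B - z *: v] the iterates satisfy
    v_(n+1) = z v_n + w_n, a contraction perturbed by a sequence that tends to 0. *)
Lemma mxiter_to0_lt1 d (B : 'M[C]_d) s v : (forall z, z \in s -> normc z < 1) ->
  mxroots B s v = 0 -> to0 (fun n => cnorm (mxiter B n v)).
Proof.
elim: s v => [|z s IH] v hs /=.
  move=> -> e e0; exists 0%N => n _; rewrite -(scale0r 0) mxiterZ cnormZ.
  by rewrite ComplexField.Normc.normc0 mul0r.
move=> hv; have hw := IH _ (fun y ys => hs y (mem_behead (s := z :: s) ys)) hv.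
apply: (contraction_to0 (normc_ge0 z) (hs z (mem_head _ _)) _ _ hw).
  by move=> n; exact: cnorm_ge0.
move=> n; rewrite -cnormZ -mxiterZ; apply: le_trans (cnormD _ _).
by rewrite -mxiterD addrC subrK -mxiterS.
Qed.

(** The same recursion solved for the inverse: v_(n+1) = z^-1 (v_n - w_(n+1)). *)
Lemma mxiter_to0_gt1 d (B B' : 'M[C]_d) s v : B *m B' = 1%:M ->
  (forall z, z \in s -> 1 < normc z) ->
  mxroots B s v = 0 -> to0 (fun n => cnorm (mxiter B' n v)).
Proof.
move=> BB'; elim: s v => [|z s IH] v hs /=.
  move=> -> e e0; exists 0%N => n _; rewrite -(scale0r 0) mxiterZ cnormZ.
  by rewrite ComplexField.Normc.normc0 mul0r.
move=> hv; have hw := IH _ (fun y ys => hs y (mem_behead (s := z :: s) ys)) hv.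
have z1 := hs z (mem_head _ _).
have z0 : 0 < normc z by apply: lt_trans z1.
have nz : z != 0 by apply/eqP => e; move: z0; rewrite e ComplexField.Normc.normc0 ltxx.
set w := v *m B - z *: v in hw.
apply: (@contraction_to0 _ (normc z)^-1 _
  (fun n => (normc z)^-1 * cnorm (mxiter B' n.+1 w))).
- by rewrite invr_ge0 ltW.
- by rewrite invf_lt1.
- by move=> n; exact: cnorm_ge0.
- move=> n; rewrite -mulrDr -ComplexField.Normc.normcV.
  have -> : mxiter B' n.+1 v = z^-1 *: (mxiter B' n v - mxiter B' n.+1 w).
    rewrite [mxiter B' n.+1 w]mxiterS /w mulmxBl -mulmxA BB' mulmx1 mxiterB.
    rewrite -scalemxAl mxiterZ -mxiterS opprB addrCA subrr addr0.
    by rewrite scalerA mulVf // scale1r.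
  rewrite cnormZ ler_wpM2l ?normc_ge0 //; apply: le_trans (cnormD _ _) _.
  by rewrite cnormN.
- move=> e e0; have [N hN] := hw (normc z * e) (mulr_gt0 z0 e0).
  exists N => n Nn; rewrite ltr_pdivrMl //; apply: hN; exact: leqW.
Qed.

(** The iterates of [w = v *m B - z *: v] tend to 0 with those of [v], so [w = 0] by induction; then
    [v] is multiplied by a number of modulus 1 at each step and its norm is constant. *)
Lemma mxiter_unit_eq0 d (B : 'M[C]_d) s v : (forall z, z \in s -> normc z = 1) ->
  mxroots B s v = 0 -> to0 (fun n => cnorm (mxiter B n v)) -> v = 0.
Proof.
elim: s v => [|z s IH] v hs //= hv v0.
have z1 := hs z (mem_head _ _).
have w0 : v *m B - z *: v = 0.
  apply: IH hv _; first by move=> y ys; apply: hs; rewrite inE ys orbT.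
  move=> e e0; have [N hN] := v0 (e / 2) (divr_gt0 e0 (ltr0Sn _ 1)).
  exists N => n Nn; rewrite mxiterB mxiterZ -mxiterS.
  apply: le_lt_trans (cnormD _ _) _; rewrite cnormN cnormZ z1 mul1r [e]splitr.
  by apply: ltrD; apply: hN => //; exact: leqW.
have vn n : cnorm (mxiter B n v) = cnorm v.
  elim: n => // n IHn; rewrite mxiterS (subr0_eq w0) mxiterZ cnormZ z1 mul1r.
  exact: IHn.
apply: cnorm_eq0; apply/eqP; rewrite eq_le cnorm_ge0 andbT.
apply/ler_addgt0Pr => e e0; rewrite add0r.
by have [N hN] := v0 e e0; rewrite -(vn N); apply: ltW; exact: hN.
Qed.

Lemma mxroots_eigen d (B : 'M[C]_d) s v z : v *m B = z *: v -> v != 0 ->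
  mxroots B s v = 0 -> z \in s.
Proof.
elim: s v => [|y s IH] v vB v0 /=; first by move=> e; rewrite e eqxx in v0.
rewrite vB -scalerBl inE; have [->|zy] := eqVneq z y; first by [].
move=> h; apply: (IH ((z - y) *: v)) => //.
  by rewrite -scalemxAl vB !scalerA mulrC.
by rewrite scaler_eq0 subr_eq0 (negbTE zy).
Qed.

Lemma mxroots_mul d e (B : 'M[C]_d) (B' : 'M[C]_e) (Y : 'M[C]_(d, e)) s v :
  B *m Y = Y *m B' -> mxroots B' s (v *m Y) = mxroots B s v *m Y.
Proof.
move=> BY; elim: s v => //= z s IH v; rewrite -IH; congr foldl.
by rewrite mulmxBl -!mulmxA BY -scalemxAl.
Qed.

Lemma mxroots_horner d (B : 'M[C]_d.+1) s v :
  v *m horner_mx B (\prod_(z <- s) ('X - z%:P)) = mxroots B s v.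
Proof.
elim: s v => [|z s IH] v; first by rewrite big_nil rmorph1 mulmx1.
rewrite big_cons rmorphM rmorphB /= horner_mx_X horner_mx_C mulmxA -IH.
by rewrite mulmxBr mul_mx_scalar.
Qed.

(** * Factors of a real polynomial sorted by the modulus of their roots *)

Lemma real_roots (p : {poly R}) : p \is monic ->
  exists s : seq C, map_poly (real_complex R) p = \prod_(z <- s) ('X - z%:P).
Proof.
move=> mp; have [s hs] := closed_field_poly_normal (map_poly (real_complex R) p).
exists s; rewrite hs (monicP _) ?scale1r // map_monic //.
Qed.

Definition modulus_factor (p : {poly R}) := exists p0 p1 p2 : {poly R},
  [/\ p0 \is monic /\ (forall z, root (map_poly (real_complex R) p0) z -> normc z < 1),
      p1 \is monic /\ (forall z, root (map_poly (real_complex R) p1) z -> normc z = 1),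
      p2 \is monic /\ (forall z, root (map_poly (real_complex R) p2) z -> 1 < normc z) &
      p = p0 * p1 * p2].

(** The sorting descends to the reals because conjugate roots have equal modulus: a complex root
    yields a real factor of degree 1 or 2 with all its roots of one modulus, and the quotient is
    treated by induction. *)
Lemma real_factor (p : {poly R}) : p \is monic -> modulus_factor p.
Proof.
have [n] := ubnP (size p); elim: n p => // n IH p /ltnSE sp mp.
have [p1|sp1] := eqVneq (size p) 1%N.
  have -> : p = 1.
    have /size_poly1P[c c0 ec] : size p == 1%N by rewrite p1.
    by move: mp; rewrite ec monicE lead_coefC => /eqP ->.
  exists 1, 1, 1; rewrite !mulr1 !monic1 rmorph1.
  by split => //; split => // z; rewrite (negbTE (root1 z)).
have main (r : R) (q : {poly R}) : q \is monic -> (1 < size q)%N ->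
    (forall z, root (map_poly (real_complex R) q) z -> normc z = r) -> q %| p -> modulus_factor p.
  move=> mq sq hq /dvdpP[t et].
  have mt : t \is monic by move: mp; rewrite et monicMr.
  have st : (size t < n)%N.
    apply: leq_trans sp; rewrite et size_Mmonic // ?monic_neq0 //.
    by move: sq; case: (size q) => [|[|k]] // _; rewrite addnS /= addnS ltnS leq_addr.
  have [p0 [p1 [p2 [[m0 h0] [m1 h1] [m2 h2] e]]]] := IH t st mt.
  have [r1|r1|r1] := ltgtP r 1.
  - exists (p0 * q), p1, p2; split => //; last by rewrite et e; ring.
    split; first by rewrite monicMr.
    by move=> z; rewrite rmorphM /= rootM => /orP[/h0//|/hq ->].
  - exists p0, p1, (p2 * q); split => //; last by rewrite et e; ring.
    split; first by rewrite monicMr.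
    by move=> z; rewrite rmorphM /= rootM => /orP[/h2//|/hq ->].
  - exists p0, (p1 * q), p2; split => //; last by rewrite et e; ring.
    split; first by rewrite monicMr.
    by move=> z; rewrite rmorphM /= rootM => /orP[/h1//|/hq ->].
have [z rz] : exists z, root (map_poly (real_complex R) p) z.
  by apply/closed_rootP; rewrite size_map_poly.
case: z rz => a b rz.
have [b0|b0] := eqVneq b 0.
  apply: (main `|a| ('X - a%:P)); rewrite ?monicXsubC ?size_XsubC //.
    move=> z; rewrite rmorphB /= map_polyX map_polyC root_XsubC => /eqP ->.
    exact: normc_real.
  rewrite dvdp_XsubCl -(fmorph_root (real_complex R)) /=.
  by move: rz; rewrite b0.
pose q : {poly R} := 'X^2 - (a *+ 2) *: 'X + (a ^+ 2 + b ^+ 2)%:P.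
have sq : size q = 3%N.
  rewrite /q -addrA size_polyDl ?size_polyXn //.
  apply: leq_ltn_trans (size_polyD _ _) _; rewrite gtn_max size_polyN.
  rewrite (leq_ltn_trans (size_scale_leq _ _)) ?size_polyX //=.
  by rewrite (leq_ltn_trans (size_polyC_leq1 _)).
have mq : q \is monic.
  rewrite monicE lead_coefE sq /q !coefE /=.
  by rewrite mulr0 subr0 addr0.
pose z : C := Complex a b.
have qz : map_poly (real_complex R) q = ('X - z%:P) * ('X - (conjc z)%:P).
  rewrite /q rmorphD rmorphB /= map_polyXn map_polyZ map_polyX map_polyC /=.
  have -> : real_complex R (a *+ 2) = z + conjc z.
    by rewrite /z; apply/eqP; rewrite eq_complex /= mulr2n subrr !eqxx.
  have -> : real_complex R (a ^+ 2 + b ^+ 2) = z * conjc z.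
    apply/eqP; rewrite eq_complex /=; apply/andP; split; apply/eqP; ring.
  by rewrite polyCM -mul_polyC polyCD; ring.
have qroot y : root (map_poly (real_complex R) q) y -> normc y = Num.sqrt (a ^+ 2 + b ^+ 2).
  rewrite qz rootM !root_XsubC => /orP[/eqP ->|/eqP ->] //=.
  by rewrite sqrrN.
apply: (main (Num.sqrt (a ^+ 2 + b ^+ 2)) q) => //; first by rewrite sq.
have q0 : q != 0 by exact: monic_neq0.
(* The remainder has degree at most 1 with real coefficients and vanishes at the non-real [z], so it
   is 0. *)
have := divp_eq p q; set r := p %% q => ep.
suff r0 : r = 0 by rewrite /dvdp -/r r0.
have sr : (size r <= 2)%N by have := ltn_modp p q; rewrite q0 sq.
have er : r = r`_1 *: 'X + (r`_0)%:P.
  apply/polyP => i; rewrite !coefE; case: i => [|[|i]] /=; rewrite ?mulr0 ?mulr1 ?add0r ?addr0 //.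
  by rewrite nth_default // (leq_trans sr).
have : (map_poly (real_complex R) r).[z] = 0.
  have := rz; rewrite /root ep rmorphD rmorphM /= hornerD hornerM.
  rewrite [(map_poly _ q).[_]](_ : _ = 0); first by rewrite mulr0 add0r => /eqP.
  by rewrite qz hornerM !hornerXsubC subrr mul0r.
rewrite er rmorphD /= map_polyZ map_polyX map_polyC hornerD hornerZ hornerX hornerC.
move=> /eqP; rewrite eq_complex /= !mul0r subr0 addr0 => /andP[/eqP h1 /eqP h2].
have r1 : r`_1 = 0.
  by apply/eqP; move/eqP: h2; rewrite addr0 mulf_eq0 (negbTE b0) orbF.
by rewrite r1 scale0r add0r; move: h1; rewrite r1 mul0r add0r => ->.
Qed.

Lemma real_coprime (p q : {poly R}) :
  (forall z, root (map_poly (real_complex R) p) z ->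
     ~~ root (map_poly (real_complex R) q) z) -> coprimep p q.
Proof.
move=> h; rewrite -(coprimep_map (real_complex R)).
by apply/Pdiv.ClosedField.coprimepP => z /h.
Qed.

Lemma Bezout1 (p q : {poly R}) : coprimep p q -> exists u v, u * p + v * q = 1.
Proof.
move=> /Bezout_coprimepP[[u v] /= /eqpf_eq[c c0 e]].
exists (c^-1 *: u), (c^-1 *: v).
by rewrite -!scalerAl -scalerDr e scalerA mulVf // scale1r.
Qed.

Lemma mxroots_real d (B : 'M[R]_d.+1) (p : {poly R}) : p \is monic ->
  exists s : seq C, (forall z, z \in s -> root (map_poly (real_complex R) p) z) /\
    forall v, v *m horner_mx B p = 0 -> mxroots (toC B) s (toC v) = 0.
Proof.
move=> mp; have [s hs] := real_roots mp; exists s; split.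
  by move=> z zs; rewrite hs root_prod_XsubC.
move=> v hv; rewrite -mxroots_horner -hs -map_horner_mx -map_mxM hv.
by rewrite map_mx0.
Qed.

Lemma spectral_split d (B : 'M[R]_d) : exists (P0 P1 P2 : 'M[R]_d) (s0 s1 s2 : seq C),
  [/\ P0 + P1 + P2 = 1%:M,
      [/\ P0 *m P1 = 0, P0 *m P2 = 0, P1 *m P2 = 0, P1 *m P0 = 0 & P2 *m P0 = 0 /\ P2 *m P1 = 0],
      forall X, X *m B = B *m X ->
        [/\ X *m P0 = P0 *m X, X *m P1 = P1 *m X & X *m P2 = P2 *m X],
      [/\ forall z, z \in s0 -> normc z < 1, forall z, z \in s1 -> normc z = 1 &
          forall z, z \in s2 -> 1 < normc z] &
      forall v, [/\ mxroots (toC B) s0 (toC (v *m P0)) = 0,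
        mxroots (toC B) s1 (toC (v *m P1)) = 0 &
        mxroots (toC B) s2 (toC (v *m P2)) = 0]].
Proof.
case: d B => [|d] B.
  by exists 0, 0, 0, [::], [::], [::]; split; do ?[move=> *]; try split;
    rewrite ?mulmx0 ?mul0mx ?map_mx0 // ?[_ + _]thinmx0 ?[1%:M]thinmx0.
have [p0 [p1 [p2 [[m0 h0] [m1 h1] [m2 h2] e]]]] := real_factor (char_poly_monic B).
have CH : horner_mx B (p0 * p1 * p2) = 0 by rewrite -e Cayley_Hamilton.
have [|u [v uv]] := @Bezout1 p0 (p1 * p2).
  apply: real_coprime => z /h0 z0; rewrite rmorphM /= rootM; apply/negP => /orP[/h1|/h2] h.
    by rewrite h ltxx in z0.
  by have := lt_trans z0 h; rewrite ltxx.
have [|u1 [v1 uv1]] := @Bezout1 p1 p2.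
  by apply: real_coprime => z /h1 z0; apply/negP => /h2; rewrite z0 ltxx.
(* Substituting the second Bezout identity into the first: 1 = u p0 (u1 p1 + v1 p2) + v p1 p2. *)
pose e0 := v * (p1 * p2); pose e1 := u * v1 * (p0 * p2); pose e2 := u * u1 * (p0 * p1).
have esum : e0 + e1 + e2 = 1.
  rewrite /e0 /e1 /e2 -[RHS]uv -[u * p0]mulr1 -uv1; ring.
have kill q : horner_mx B (q * (p0 * p1 * p2)) = 0 by rewrite rmorphM /= CH mulr0.
have [s0 [r0 k0]] := mxroots_real B m0.
have [s1 [r1 k1]] := mxroots_real B m1.
have [s2 [r2 k2]] := mxroots_real B m2.
exists (horner_mx B e0), (horner_mx B e1), (horner_mx B e2), s0, s1, s2; split.
- by rewrite -!rmorphD /= esum rmorph1.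
- have z (f g q : {poly R}) : f * g = q * (p0 * p1 * p2) ->
      horner_mx B f *m horner_mx B g = 0.
    by move=> h; rewrite -[_ *m _]/(_ * _) -rmorphM /= h kill.
  split; last split.
  + by apply: (z _ _ (v * u * v1 * p2)); rewrite /e0 /e1; ring.
  + by apply: (z _ _ (v * u * u1 * p1)); rewrite /e0 /e2; ring.
  + by apply: (z _ _ (u * v1 * u * u1 * p0)); rewrite /e1 /e2; ring.
  + by apply: (z _ _ (v * u * v1 * p2)); rewrite /e0 /e1; ring.
  + by apply: (z _ _ (v * u * u1 * p1)); rewrite /e0 /e2; ring.
  + by apply: (z _ _ (u * v1 * u * u1 * p0)); rewrite /e1 /e2; ring.
- by move=> X XB; split; exact: comm_mx_horner.
- by split => z; [move/r0/h0|move/r1/h1|move/r2/h2].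
- have z (w : 'rV[R]_d.+1) (f g q : {poly R}) : f * g = q * (p0 * p1 * p2) ->
      w *m horner_mx B f *m horner_mx B g = 0.
    move=> h; rewrite -mulmxA -[horner_mx B f *m _]/(_ * _) -rmorphM /= h kill.
    by rewrite mulmx0.
  move=> w; split; [apply: k0|apply: k1|apply: k2].
  + by apply: (z _ _ _ v); rewrite /e0; ring.
  + by apply: (z _ _ _ (u * v1)); rewrite /e1; ring.
  + by apply: (z _ _ _ (u * u1)); rewrite /e2; ring.
Qed.

Lemma mxroots_char d (B : 'M[R]_d) : exists s : seq C,
  (forall z, z \in s -> root (map_poly (real_complex R) (char_poly B)) z) /\
  forall v, mxroots (toC B) s (toC v) = 0.
Proof.
case: d B => [|d] B.
  by exists [::]; split => // v; rewrite /= [toC v]thinmx0.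
have [s [hs h]] := mxroots_real B (char_poly_monic B); exists s; split => // v.
by apply: h; rewrite Cayley_Hamilton mulmx0.
Qed.

Lemma mxiter_uniform d (B P : 'M[R]_d) :
  (forall v, to0 (fun n => cnorm (mxiter (toC B) n (toC (v *m P))))) ->
  forall e, 0 < e -> exists N, forall n, (N <= n)%N -> forall v,
    `|mxiter B n (v *m P)| <= e * `|v|.
Proof.
move=> h e e0.
(* One share of [e] for each basis vector; the successor avoids a division by 0 in dimension 0. *)
have d0 : 0 < e / d.+1%:R by rewrite divr_gt0 // ltr0n.
have /choice[f hf] : forall i : 'I_d, exists N, forall n, (N <= n)%N ->
    cnorm (mxiter (toC B) n (toC (delta_mx 0 i *m P))) < e / d.+1%:R.
  by move=> i; exact: h.
exists (\max_i f i) => n hn v; apply: le_trans (cnorm_real _) _; rewrite toC_mxiter.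
have -> : toC (v *m P) = \sum_i (real_complex R (v 0 i)) *: toC (delta_mx 0 i *m P).
  rewrite {1}[v]row_sum_delta mulmx_suml raddf_sum; apply: eq_bigr => i _.
  by rewrite /= -scalemxAl; apply/rowP => j; rewrite !mxE rmorphM.
have lin (I : Type) (r : seq I) (c : I -> C) (w : I -> 'rV[C]_d) :
    cnorm (mxiter (toC B) n (\sum_(i <- r) c i *: w i)) <=
    \sum_(i <- r) normc (c i) * cnorm (mxiter (toC B) n (w i)).
  elim: r => [|i r IH].
    rewrite !big_nil -(scale0r 0) mxiterZ cnormZ.
    by rewrite ComplexField.Normc.normc0 mul0r.
  rewrite !big_cons mxiterD; apply: le_trans (cnormD _ _) _.
  by rewrite mxiterZ cnormZ lerD2l.
apply: le_trans (lin _ _ _ _) _.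
apply: (@le_trans _ _ (\sum_(i < d) `|v| * (e / d.+1%:R))).
  apply: ler_sum => i _; rewrite normc_real; apply: ler_pM => //.
  - exact: cnorm_ge0.
  - exact: rV_coord_le.
  - by apply: ltW; apply: hf; apply: leq_trans hn; exact: leq_bigmax.
rewrite sumr_const card_ord -mulrnAr mulrC ler_wpM2r //.
rewrite -mulr_natr -mulrA ger_pMr // mulrC ler_pdivrMr ?ltr0n // mul1r ler_nat //.
Qed.

Lemma additive_rV_matrix d m (f : 'rV[R]_d -> 'rV[R]_m) :
  (forall u v, f (u + v) = f u + f v) -> continuous f ->
  exists B, forall v, f v = v *m B.
Proof.
move=> fD fc.
have f0 : f 0 = 0 by apply: (addrI (f 0)); rewrite -fD !addr0.
have fN v : f (- v) = - f v by apply/eqP; rewrite -addr_eq0 -fD addNr f0.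
have fMn v k : f (v *+ k) = f v *+ k.
  by elim: k => [|k IH]; rewrite ?mulr0n // !mulrS fD IH.
have fMz v (k : int) : f (v *~ k) = f v *~ k.
  by case: k => k; rewrite ?NegzE -?pmulrn ?mulrNz ?fN -?pmulrn fMn.
have [dl [dl0 hdl]] : exists e : R, 0 < e /\ forall v, `|v| < e -> `|f v| < 1.
  have : nbhs (0 : 'rV[R]_d) [set v | `|f v| < 1].
    have h := fc (0 : 'rV[R]_d) [set w | `|w| < 1]; rewrite f0 in h.
    exact: (h (nbhs0_norm m ltr01)).
  by move/nbhs0_normP.
have bnd v : exists K : R, forall t : R, 0 <= t <= 1 -> `|f (t *: v)| <= K.
  pose k := (Num.truncn (`|v| / dl)).+1; exists k%:R => t /andP[t0 t1].
  have k0 : 0 < k%:R :> R by rewrite ltr0n.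
  have -> : t *: v = (k%:R^-1 *: (t *: v)) *+ k.
    by rewrite -scaler_nat scalerA divff ?scale1r // lt0r_neq0.
  rewrite fMn -scaler_nat mx_normZ ger0_norm ?ler0n //.
  rewrite ler_piMr //.
  apply: ltW; apply: hdl; rewrite !mx_normZ normfV (ger0_norm (ltW k0)) (ger0_norm t0).
  rewrite ltr_pdivrMl //; apply: (@le_lt_trans _ _ `|v|); first by rewrite ler_piMl.
  by rewrite -ltr_pdivrMr // truncnS_gt.
(* The [k]-th multiple of [f (t *: v) - t *: f v] depends only on the fractional part of [t *+ k],
   so all multiples are bounded and the vector is 0. *)
have fZ (t : R) v : f (t *: v) = t *: f v.
  have [K hK] := bnd v.
  apply/subr0_eq; apply: (@bounded_multiples R m _ (K + `|f v|)) => k.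
  pose c : R := t *+ k; pose q := Num.floor c.
  have /andP[q1 q2] := floor_itv c; rewrite -/q in q1 q2.
  have -> : (f (t *: v) - t *: f v) *+ k = f ((c - q%:~R) *: v) - (c - q%:~R) *: f v.
    rewrite mulrnBl -fMn !scalerMnl -/c !scalerBl !scaler_int fD fN fMz; zmod.
  have hc : 0 <= c - q%:~R <= 1.
    by move: q2; rewrite rmorphD /= => q2; apply/andP; split; lra.
  apply: le_trans (ler_normB _ _) _; apply: lerD; first exact: hK.
  by move: hc => /andP[hc0 hc1]; rewrite mx_normZ ger0_norm // ler_piMl.
exists (\matrix_i f (delta_mx 0 i)) => v.
rewrite mulmx_sum_row {1}[v]row_sum_delta.
rewrite (big_morph f fD f0); apply: eq_bigr => i _.
by rewrite fZ rowK.
Qed.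

End Spectral.

(** * Equivariant projections *)

Section EquivariantProjection.
Variables (A M : topologicalZmodType) (act : A -> M -> M).
Hypothesis hM : hausdorff_space M.
Hypothesis hact : is_action act.
Implicit Types (x y z : M) (p q : M -> M).

Record equivariant p : Prop := Equivariant {
  eqvD : forall x y, p (x + y) = p x + p y;
  eqv_cont : continuous p;
  eqv_act : forall a x, p (act a x) = act a (p x)
}.
Definition eproj p := equivariant p /\ forall x, p (p x) = p x.
(** Fixed points, which for an idempotent form its image and are visibly closed. *)
Definition im p : set M := [set x | p x = x].

Lemma eqv0 p : equivariant p -> p 0 = 0.
Proof. by move=> ep; apply: (addrI (p 0)); rewrite -(eqvD ep) !addr0. Qed.
Lemma eqvN p x : equivariant p -> p (- x) = - p x.
Proof. by move=> ep; apply/eqP; rewrite -addr_eq0 -(eqvD ep) addNr eqv0. Qed.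
Lemma eqvB p x y : equivariant p -> p (x - y) = p x - p y.
Proof. by move=> ep; rewrite (eqvD ep) eqvN. Qed.
Lemma eqv_sum p (I : Type) (r : seq I) (P : pred I) (F : I -> M) : equivariant p ->
  p (\sum_(i <- r | P i) F i) = \sum_(i <- r | P i) p (F i).
Proof. by move=> ep; apply: (big_morph p (eqvD ep) (eqv0 ep)). Qed.
Lemma eqv_nbhs p W : equivariant p -> nbhs (0 : M) W -> nbhs (0 : M) [set x | W (p x)].
Proof. by move=> ep nW; apply: (eqv_cont ep); rewrite /= eqv0. Qed.

Lemma equivariantP p : (forall x y, p (x + y) = p x + p y) ->
  (forall W, nbhs (0 : M) W -> nbhs (0 : M) [set x | W (p x)]) ->
  (forall a x, p (act a x) = act a (p x)) -> equivariant p.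
Proof. by move=> pD pc pa; split => //; exact: additive_continuous. Qed.

Lemma equivariant_add p q : equivariant p -> equivariant q ->
  equivariant (fun x => p x + q x).
Proof.
move=> ep eq; apply: equivariantP => [x y|W nW|a x].
- by rewrite (eqvD ep) (eqvD eq) addrACA.
- have [V [nV _ VV]] := nbhs0_split nW.
  by apply: filterS (filterI (eqv_nbhs ep nV) (eqv_nbhs eq nV)) => x [? ?]; exact: VV.
- by rewrite (eqv_act ep) (eqv_act eq) (actD hact).
Qed.
Lemma equivariant_opp p : equivariant p -> equivariant (fun x => - p x).
Proof.
move=> ep; apply: equivariantP => [x y|W nW|a x].
- by rewrite (eqvD ep) opprD.
- have [V [nV sV VV]] := nbhs0_split nW.
  apply: filterS (eqv_nbhs ep nV) => x /= Vx; rewrite -(addr0 (- _)).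
  by apply: VV; [exact: sV|exact: nbhs_singleton].
- by rewrite (eqv_act ep) (actN hact).
Qed.
Lemma equivariant_comp p q : equivariant p -> equivariant q ->
  equivariant (fun x => p (q x)).
Proof.
move=> ep eq; apply: equivariantP => [x y|W nW|a x].
- by rewrite (eqvD eq) (eqvD ep).
- exact: (eqv_nbhs eq (eqv_nbhs ep nW)).
- by rewrite (eqv_act eq) (eqv_act ep).
Qed.
Lemma equivariant_id : equivariant id.
Proof. by apply: equivariantP. Qed.
Lemma equivariant0 : equivariant (fun=> 0).
Proof.
apply: equivariantP => [x y|W nW|a x]; rewrite ?addr0 ?(actr0 hact) //.
by apply: filterS (@filterT _ (nbhs (0 : M)) _) => x _ /=; exact: nbhs_singleton.
Qed.

Lemma im_submodule p : equivariant p -> submodule act (im p).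
Proof.
move=> ep; split; first split; first split.
- exact: eqv0.
- by move=> x y px py; rewrite /im /= eqvB // px py.
- by move=> a x px; rewrite /im /= (eqv_act ep) px.
have eq := equivariant_add ep (equivariant_opp equivariant_id).
move=> x /closureP0 cx; apply/subr0_eq/(nbhs0_eq0 hM) => W nW.
have [y [py Wy]] := cx _ (eqv_nbhs eq nW); move: Wy => /=.
rewrite eqvB // py; have -> : p x - y - (x - y) = p x - x by zmod.
by [].
Qed.

Lemma within_comp (T : topologicalType) (p : M -> M) (S : set M) (f : M -> T) :
  continuous p -> (forall x, S (p x)) -> {within S, continuous f} ->
  continuous (fun x => f (p x)).
Proof.
move=> cp Sp /subspace_continuousP cf x W nW.
have := cf (p x) (Sp x) W nW => h.
have /= := cp x [set y | S y -> W (f y)] h; move=> h2.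
have : nbhs x [set y | S (p y) -> W (f (p y))] by exact: h2.
by apply: filterS => y /=; apply.
Qed.

Lemma im_add_l p q x : equivariant q -> (forall y, q (p y) = 0) -> im p x ->
  p x + q x = x.
Proof. by move=> eq qp px; rewrite /im /= in px; rewrite px -{2}px qp addr0. Qed.

Lemma polycontractable_add p q : eproj p -> eproj q ->
  (forall x, p (q x) = 0) -> (forall x, q (p x) = 0) ->
  polycontractable act (im p) -> polycontractable act (im q) ->
  polycontractable act (im (fun x => p x + q x)).
Proof.
move=> [ep pp] [eq qq] pq qp [n [F [hF [FS Funiq [pi [piF pisum pic]]]]]].
move=> [m [G [hG [GS Guniq [rho [rhoG rhosum rhoc]]]]]].
exists (n + m)%N, (fun i => match fintype.split i with inl j => F j | inr k => G k end).
split; first by move=> i; case: (fintype.split i).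
split.
- move=> i x; case: (fintype.split i) => j.
    by move=> /FS px; rewrite /im /= (im_add_l eq qp).
  by move=> /GS qx; rewrite /im /= addrC (im_add_l ep pq).
- move=> y z hy hz; rewrite !big_split_ord /= => e.
  have hyF j : F j (y (lshift m j)).
    by have := hy (lshift m j); rewrite (fintype.unsplitK (inl j)).
  have hzF j : F j (z (lshift m j)).
    by have := hz (lshift m j); rewrite (fintype.unsplitK (inl j)).
  have hyG j : G j (y (rshift n j)).
    by have := hy (rshift n j); rewrite (fintype.unsplitK (inr j)).
  have hzG j : G j (z (rshift n j)).
    by have := hz (rshift n j); rewrite (fintype.unsplitK (inr j)).
  have sp (w : 'I_(n + m) -> M) : (forall j, F j (w (lshift m j))) ->
      (forall j, G j (w (rshift n j))) ->
      p (\sum_(i < n) w (lshift m i) + \sum_(i < m) w (rshift n i)) =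
      \sum_(i < n) w (lshift m i).
    move=> h1 h2; rewrite (eqvD ep) !(eqv_sum _ _ _ ep).
    have -> : \sum_(i < n) p (w (lshift m i)) = \sum_(i < n) w (lshift m i).
      by apply: eq_bigr => i _; exact: (FS i).
    have -> : \sum_(i < m) p (w (rshift n i)) = 0; last by rewrite addr0.
    by apply: big1 => i _; have /GS := h2 i; rewrite /im /= => <-.
  have e1 : \sum_(i < n) y (lshift m i) = \sum_(i < n) z (lshift m i).
    by rewrite -(sp y) // -(sp z) // e.
  have e2 : \sum_(i < m) y (rshift n i) = \sum_(i < m) z (rshift n i).
    by move: e; rewrite e1 => /addrI.
  have f1 := Funiq _ _ hyF hzF e1; have f2 := Guniq _ _ hyG hzG e2.
  apply: funext => i; rewrite -(fintype.splitK i); case: (fintype.split i) => j /=.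
    by have := congr1 (fun h => h j) f1.
  by have := congr1 (fun h => h j) f2.
- exists (fun i x => match fintype.split i with inl j => pi j (p x) | inr k => rho k (q x) end).
  split.
  + move=> i x _; case: (fintype.split i) => j; first by apply: piF; exact: pp.
    by apply: rhoG; exact: qq.
  + move=> x hx; rewrite big_split_ord /=.
    rewrite (eq_bigr (fun i => pi i (p x))); last by move=> i _; rewrite (fintype.unsplitK (inl i)).
    rewrite -pisum; last exact: pp.
    rewrite (eq_bigr (fun i => rho i (q x))); last by move=> i _; rewrite (fintype.unsplitK (inr i)).
    by rewrite -rhosum; [rewrite hx|exact: qq].
  + move=> i; apply: continuous_subspaceT; case: (fintype.split i) => j.
      exact: (within_comp (eqv_cont ep) pp (pic j)).
    exact: (within_comp (eqv_cont eq) qq (rhoc j)).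
Qed.

Lemma polycontractable1 p : eproj p -> contractable act (im p) ->
  polycontractable act (im p).
Proof.
move=> [ep pp] cp; exists 1%N, (fun=> im p); split.
  by move=> _; split => //; exact: im_submodule.
split; first by move=> i x.
- move=> y z _ _; rewrite !big_ord1 => e; apply: funext => i; by rewrite ord1.
- exists (fun _ x => x); split => //; first by move=> x _; rewrite big_ord1.
  by move=> i; apply: continuous_subspaceT => x; exact: cvg_id.
Qed.

Lemma polycontractable0 : polycontractable act (im (fun=> 0)).
Proof.
exists 0%N, (fun=> set0); split; first by case.
split; first by case.
- by move=> y z _ _ _; apply: funext; case.
- exists (fun _ x => x); split; first by case.
    by move=> x <-; rewrite big_ord0.
  by case.
Qed.

Lemma iter_act a n x : iter n (act a) x = act (a *+ n) x.
Proof. by elim: n => [|n IH]; rewrite ?mulr0n ?(act0 hact) // iterS IH (actA hact) mulrS. Qed.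

Lemma contractable_im p a : equivariant p ->
  (forall K W, compact K -> K `<=` im p -> nbhs (0 : M) W -> exists n0,
    forall n, (n0 <= n)%N -> forall x, K x -> W (act (a *+ n) x)) ->
  contractable act (im p).
Proof.
move=> ep h; exists a; split; first by move=> x; exact: (im_submodule ep).1.2.
move=> K Kp cK W nW; have [n0 hn] := h K W cK Kp nW.
by exists n0 => n nn x Kx; rewrite iter_act; exact: hn.
Qed.

(** A compact parafinite submodule of [im p] is one of [M]; and an open submodule of [im p] with
    purely discrete quotient pulls back along [p] to one of [M], hence to all of [M]. *)
Lemma sheer_summand p : eproj p -> sheer act setT -> sheer act (im p).
Proof.
move=> [ep pp] [hW hO]; have [[sim aim] cim] := im_submodule ep.
split; apply/seteqP; split.
- move=> x wx; rewrite -hW => H sH hH; apply: wx => // N _; exact: hH.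
- by move=> _ -> H sH _; exact: sg0.
- move=> x; apply; split => //; first by exists setT; split; [exact: openT|rewrite setTI].
- move=> x px U [mU US [ O [oO eU]] hU].
  have pO y : U (p y) <-> O (p y) by rewrite eU; split => [[]//|Oy]; split => //; exact: pp.
  suff : Omega_sharp act setT x -> U (p x) by rewrite hO px; apply.
  move=> /(_ [set y | U (p y)]); apply; split => //.
  + split; first split.
    * by rewrite /= eqv0 //; exact: (sg0 mU.1).
    * by move=> y z /= hy hz; rewrite eqvB //; exact: (sgB mU.1).
    * by move=> a y /= hy; rewrite (eqv_act ep); exact: mU.2.
  + exists [set y | O (p y)]; split; last by rewrite setIT predeqE => y; exact: pO.
    by apply: open_comp => // y _; exact: (eqv_cont ep).
  + move=> N mN UN _ [F [fF [FN NF]]].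
    have pN y : N y -> N (p y).
      move=> Ny; have -> : p y = y - (y - p y) by zmod.
      apply: (sgB mN.1) => //; apply: UN => /=.
      by rewrite eqvB // pp subrr; exact: (sg0 mU.1).
    have key : N `&` im p `<=` U.
      apply: hU.
      * split; first exact: (sgI mN.1 sim).
        by move=> a y [Ny py]; split; [exact: mN.2|exact: aim].
      * by move=> u Uu; split; [apply: UN; rewrite /= (US u Uu)|exact: US].
      * by move=> y [].
      * exists (p @` F); split; first exact: finite_image.
        split; first by move=> _ [f Ff <-]; split; [apply: pN; exact: FN|exact: pp].
        move=> y [Ny py]; have [f Ff Uf] := NF y Ny.
        by exists (p f); [exists f|rewrite -{1}py -eqvB].
    by move=> y Ny; apply: key; split; [exact: pN|exact: pp].
Qed.

(** The maps [pi] of a [topdirsum] are only assumed continuous on [S]; uniqueness of components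
    makes them additive and equivariant. Composing with [p] gives maps continuous on all of [M]. *)
Lemma topdirsum_equivariant S n (G : 'I_n -> set M) p :
  (forall i, submodule act (G i)) -> topdirsum S G -> equivariant p ->
  (forall x, S (p x)) -> exists q : 'I_n -> M -> M,
  [/\ forall i, equivariant (q i), forall i x, G i (q i x) &
      forall x, p x = \sum_i q i x].
Proof.
move=> mG [GS uniq [pi [piG pisum pic]]] ep Sp; exists (fun i x => pi i (p x)).
have sG i := (mG i).1.1; split=> [i|i x|x]; [|exact: piG|exact: pisum].
split; last 1 first.
- move=> a x; apply: (congr1 (fun h => h i) (uniq (fun i => pi i (p (act a x)))
    (fun i => act a (pi i (p x))) _ _ _)) => [j|j|].
  + exact: piG.
  + by apply: (mG j).1.2; exact: piG.
  + by rewrite -pisum // -(act_sum hact) -pisum // (eqv_act ep).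
- move=> x y; apply: (congr1 (fun h => h i) (uniq (fun i => pi i (p (x + y)))
    (fun i => pi i (p x) + pi i (p y)) _ _ _)) => [j|j|].
  + exact: piG.
  + by apply: (sgD (sG j)); exact: piG.
  + by rewrite big_split /= -!pisum // (eqvD ep).
- exact: (within_comp (eqv_cont ep) Sp (pic i)).
Qed.

Lemma eqv_compact_submodule p C : equivariant p -> alg_submodule act C -> compact C ->
  alg_submodule act (p @` C) /\ compact (p @` C).
Proof.
move=> ep mC cC; split; last by apply: compact_image => //; exact: (eqv_cont ep).
split; first split.
- by exists 0; [exact: (sg0 mC.1)|exact: (eqv0 ep)].
- move=> _ _ [y Cy <-] [z Cz <-]; exists (y - z); last exact: (eqvB _ _ ep).
  exact: (sgB mC.1).
- by move=> a _ [y Cy <-]; exists (act a y); [exact: mC.2|exact: (eqv_act ep)].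
Qed.

End EquivariantProjection.

(** * The decomposition and its uniqueness *)

Local Notation R := Rdefinitions.R.
Local Notation toC := (map_mx (real_complex R)).
Local Notation normc := (@ComplexField.Normc.normc R).

Section SheerModule.
Variables (A M : topologicalZmodType) (act : A -> M -> M).
Hypothesis hM : hausdorff_space M.
Hypothesis hact : is_action act.
Hypothesis hs : sheer act setT.
Variables (d : nat) (F : M -> 'rV[R]_d) (s : 'rV[R]_d -> M).
Hypothesis es : euclid_split F s.
Local Notation L := (@ell M).
Hypothesis cL : closed L.
Hypothesis basisL : forall W, nbhs (0 : M) W -> exists C, osub L C /\ C `<=` W.
Hypothesis ellL : forall X, compact X -> X `<=` L -> exists C, osub L C /\ X `<=` C.
Implicit Types (x y : M) (a b : A).

Let mL : alg_submodule act L := ell_submodule hact.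
Let sL : is_subgroup L := mL.1.
Let FD := esFD es.
Let sD := essD es.
Let sK := essK es.

Lemma F0 : F 0 = 0. Proof. by apply: (addrI (F 0)); rewrite -FD !addr0. Qed.
Lemma FN x : F (- x) = - F x.
Proof. by apply/eqP; rewrite -addr_eq0 -FD addNr F0. Qed.
Lemma FB x y : F (x - y) = F x - F y. Proof. by rewrite FD FN. Qed.
Lemma s0 : s 0 = 0. Proof. by apply: (addrI (s 0)); rewrite -sD !addr0. Qed.
Lemma sN t : s (- t) = - s t.
Proof. by apply/eqP; rewrite -addr_eq0 -sD addNr s0. Qed.
Lemma F_nbhs (e : R) : 0 < e -> nbhs (0 : M) [set x | `|F x| < e].
Proof.
move=> e0; have h := @esF_cont R M d F s es 0 [set t | `|t| < e]; rewrite F0 in h.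
exact: (h (nbhs0_norm d e0)).
Qed.
Lemma s_small W : nbhs (0 : M) W -> exists e : R, 0 < e /\ forall t, `|t| < e -> W (s t).
Proof.
move=> nW; have h := @ess_cont R M d F s es 0 W; rewrite s0 in h.
by have /nbhs0_normP := h nW.
Qed.

(** [L] has arbitrarily small compact relatively open subgroups, and each contains the image of a
    ball, hence of the space the ball generates. *)
Lemma hom_ell0 n (h : 'rV[R]_n -> M) : (forall t t', h (t + t') = h t + h t') ->
  continuous h -> (forall t, L (h t)) -> forall t, h t = 0.
Proof.
move=> hD ch hL t; apply: (nbhs0_eq0 hM) => W /basisL[C [oC CW]]; apply: CW.
have [V [nV VC]] := osub_nbhs oC.
by apply: (rV_hom_sub hD ch (osub_sg oC) nV) => t' Vt; exact: VC.
Qed.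

Lemma compact_F_bounded K : compact K -> exists B : R, forall x, K x -> `|F x| <= B.
Proof.
move=> cK; have cFK : compact (F @` K).
  by apply: continuous_compact => //; apply: continuous_subspaceT; exact: esF_cont es.
have [B [_ hB]] := compact_bounded cFK; exists (B + 1) => x Kx.
by apply: (hB (B + 1)); [rewrite ltrDl|exists x].
Qed.

Definition pV x := s (F x).
Definition pL x := x - pV x.

Lemma pL_ell x : L (pL x).
Proof. by apply/(es_ell es); rewrite /pL /pV FB sK subrr. Qed.
Lemma pV_ell x : L x -> pV x = 0.
Proof. by move=> /(es_ell es) h; rewrite /pV h s0. Qed.
Lemma pL_id x : L x -> pL x = x.
Proof. by move=> /pV_ell h; rewrite /pL h subr0. Qed.
Lemma pL_s t : pL (s t) = 0.
Proof. by rewrite /pL /pV sK subrr. Qed.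
Lemma F_ell x : L x -> F x = 0. Proof. by move/(es_ell es). Qed.

(** The Euclidean complement is invariant: the [L] component of [act a (s t)] is a continuous
    homomorphism in [t] and vanishes by [hom_ell0]. *)
Lemma act_mx : exists Bm : A -> 'M[R]_d, forall a t, act a (s t) = s (t *m Bm a).
Proof.
have key a : exists B : 'M[R]_d, forall t, act a (s t) = s (t *m B).
  have [||B hB] := @additive_rV_matrix R d d (fun t => F (act a (s t))).
  - by move=> t t'; rewrite sD (actD hact) FD.
  - move=> t; apply: (continuous_comp (f := fun t => act a (s t)) (g := F)).
      apply: (continuous_comp (f := s) (g := act a)); first exact: (ess_cont es).
      exact: (act_continuous hact).
    exact: (esF_cont es).
  exists B => t; apply/subr0_eq.
  apply: (@hom_ell0 d (fun t => act a (s t) - s (t *m B))).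
  - by move=> t1 t2; rewrite mulmxDl !sD (actD hact); zmod.
  - apply: additive_continuous => [t1 t2|W nW].
      by rewrite mulmxDl !sD (actD hact); zmod.
    have [V [nV sV VV]] := nbhs0_split nW.
    have [e1 [e10 h1]] := s_small (act_nbhs hact a nV).
    have [e2 [e20 h2]] := s_small nV.
    have [c [c0 hc]] := rV_mulmx_le B.
    apply: filterS (filterI (nbhs0_norm d e10) (nbhs0_norm d (divr_gt0 e20 c0))) => t1 [/= k1 k2].
    apply: VV; first exact: h1.
    apply/sV/h2; apply: le_lt_trans (hc _) _.
    by rewrite mulrC -ltr_pdivlMr.
  - by move=> t1; rewrite -hB; exact: pL_ell.
by have /choice[Bm h] := key; exists Bm.
Qed.

Variable Bm : A -> 'M[R]_d.
Hypothesis hBm : forall a t, act a (s t) = s (t *m Bm a).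

Lemma F_act a x : F (act a x) = F x *m Bm a.
Proof.
have e : x = pV x + pL x by rewrite /pL; zmod.
rewrite {1}e (actD hact) FD /pV hBm sK [F (act a _)]F_ell ?addr0 //.
by apply: mL.2; exact: pL_ell.
Qed.

Lemma mx_eq (X Y : 'M[R]_d) : (forall t : 'rV[R]_d, t *m X = t *m Y) -> X = Y.
Proof. by move=> h; apply/row_matrixP => i; rewrite !rowE. Qed.

Lemma BmD a b : Bm (a + b) = Bm a *m Bm b.
Proof.
apply: mx_eq => t; apply: (can_inj sK).
by rewrite -hBm -(actA hact) (actC hact) !hBm mulmxA.
Qed.
Lemma BmC a b : Bm a *m Bm b = Bm b *m Bm a.
Proof. by rewrite -!BmD addrC. Qed.
Lemma Bm0 : Bm 0 = 1%:M.
Proof. by apply: mx_eq => t; apply: (can_inj sK); rewrite -hBm (act0 hact) mulmx1. Qed.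
Lemma BmV a : Bm a *m Bm (- a) = 1%:M.
Proof. by rewrite -BmD subrr Bm0. Qed.
Lemma act_mxiter a n t : act (a *+ n) (s t) = s (mxiter (Bm a) n t).
Proof.
elim: n => [|n IH]; first by rewrite mulr0n (act0 hact).
by rewrite mulrS -(actA hact) IH hBm.
Qed.

(** * Polycontractable and distal parts of the Euclidean summand *)

Definition vp (E : 'M[R]_d) x := s (F x *m E).
Definition commB (E : 'M[R]_d) := forall a, E *m Bm a = Bm a *m E.

Lemma commB_mul E E' : commB E -> commB E' -> commB (E *m E').
Proof. by move=> h h' a; rewrite -mulmxA h' !mulmxA h. Qed.
Lemma commB_add E E' : commB E -> commB E' -> commB (E + E').
Proof. by move=> h h' a; rewrite mulmxDl mulmxDr h h'. Qed.
Lemma vp_comp E E' x : vp E (vp E' x) = vp (E' *m E) x.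
Proof. by rewrite /vp sK mulmxA. Qed.
Lemma vpD E E' x : vp (E + E') x = vp E x + vp E' x.
Proof. by rewrite /vp mulmxDr sD. Qed.
Lemma vp0 x : vp 0 x = 0. Proof. by rewrite /vp mulmx0 s0. Qed.
Lemma vp1 x : vp 1%:M x = pV x. Proof. by rewrite /vp mulmx1. Qed.
Lemma vp_equivariant E : commB E -> equivariant act (vp E).
Proof.
move=> cE; apply: equivariantP => [x y|W nW|a x].
- by rewrite /vp FD mulmxDl sD.
- have [e [e0 he]] := s_small nW; have [c [c0 hc]] := rV_mulmx_le E.
  apply: filterS (F_nbhs (divr_gt0 e0 c0)) => x /= hx; apply: he.
  by apply: le_lt_trans (hc _) _; rewrite mulrC -ltr_pdivlMr.
- by rewrite /vp F_act hBm -!mulmxA cE.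
Qed.
Lemma vp_eproj E : commB E -> E *m E = E -> eproj act (vp E).
Proof. by move=> cE EE; split; [exact: vp_equivariant|move=> x; rewrite vp_comp EE]. Qed.

Lemma vp_contractable Q a : commB Q ->
  (forall t, to0 (fun n => cnorm (mxiter (toC (Bm a)) n (toC (t *m Q))))) ->
  contractable act (im (vp Q)).
Proof.
move=> cQ h0; apply: (contractable_im hM hact (a := a) (vp_equivariant cQ)) => K W cK Kim nW.
have [B hB] := compact_F_bounded cK.
have [e [e0 he]] := s_small nW.
have B1 : 0 < `|B| + 1 by have := normr_ge0 B; lra.
have [N hN] := mxiter_uniform h0 (divr_gt0 e0 B1).
exists N => n Nn x Kx.
have -> : x = s (F x *m Q) by have := Kim x Kx.
rewrite act_mxiter; apply: he; apply: le_lt_trans (hN n Nn _) _.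
rewrite mulrAC ltr_pdivrMr // ltr_pM2l //.
by apply: le_lt_trans (hB x Kx) _; have := ler_norm B; lra.
Qed.

(** Unit modulus expressed by an annihilating list of roots: this passes to smaller images without a
    choice of basis, unlike a characteristic polynomial. *)
Definition distalB (D : 'M[R]_d) := forall a, exists q : seq R[i],
  (forall z, z \in q -> normc z = 1) /\
  forall t, mxroots (toC (Bm a)) q (toC (t *m D)) = 0.

Lemma euclid_dec E : E *m E = E -> commB E -> exists P D : 'M[R]_d,
  [/\ P + D = E, P *m P = P /\ D *m D = D, P *m D = 0 /\ D *m P = 0,
      commB P /\ commB D & polycontractable act (im (vp P)) /\ distalB D].
Proof.
have [r] := ubnP (\rank E); elim: r E => // r IH E /ltnSE rE EE cE.
(* Either some [a] moves the image of [E] off its unit-modulus part, and the induction goes on with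
   [E *m P1], or [E] is already distal. *)
have [[a ha]|na] := pselect (exists a, exists (P0 P1 P2 : 'M[R]_d) (q0 q1 q2 : seq R[i]),
  [/\ P0 + P1 + P2 = 1%:M,
      [/\ P0 *m P1 = 0, P0 *m P2 = 0, P1 *m P2 = 0, P1 *m P0 = 0 & P2 *m P0 = 0 /\ P2 *m P1 = 0],
      forall X, X *m Bm a = Bm a *m X ->
        [/\ X *m P0 = P0 *m X, X *m P1 = P1 *m X & X *m P2 = P2 *m X],
      [/\ forall z, z \in q0 -> normc z < 1, forall z, z \in q1 -> normc z = 1 &
          forall z, z \in q2 -> 1 < normc z] &
      (forall v, [/\ mxroots (toC (Bm a)) q0 (toC (v *m P0)) = 0,
        mxroots (toC (Bm a)) q1 (toC (v *m P1)) = 0 &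
        mxroots (toC (Bm a)) q2 (toC (v *m P2)) = 0]) /\ E *m P1 <> E]); last first.
  exists 0, E; rewrite add0r !mul0mx mulmx0; split => //.
    by split => // b; rewrite mul0mx mulmx0.
  split; first by rewrite (_ : vp 0 = fun=> 0); [exact: polycontractable0|apply: funext => x; exact: vp0].
  move=> a; have [P0 [P1 [P2 [q0 [q1 [q2 [h1 h2 h3 h4 h5]]]]]]] := spectral_split (Bm a).
  have EP : E *m P1 = E.
    by apply: contrapT => nE; apply: na; exists a, P0, P1, P2, q0, q1, q2.
  exists q1; split; first by case: h4.
  by move=> t; rewrite -EP mulmxA; have [] := h5 (t *m E).
have [P0 [P1 [P2 [q0 [q1 [q2 [P012 [z01 z02 z12 z10 [z20 z21]] hX [hq0 hq1 hq2] [hv nE]]]]]]]] := ha.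
have [eP0 eP1 eP2] := hX _ (cE a).
have cP : [/\ commB P0, commB P1 & commB P2].
  by split => b; have [h0 h1 h2] := hX (Bm b) (BmC b a); rewrite ?h0 ?h1 ?h2.
case: cP => cP0 cP1 cP2.
have idem (P Q S : 'M[R]_d) : P + Q + S = 1%:M -> P *m Q = 0 -> P *m S = 0 -> P *m P = P :> 'M[R]_d.
  by move=> e e1 e2; rewrite -{3}[P]mulmx1 -e !mulmxDr e1 e2 !addr0.
have P00 := idem _ _ _ P012 z01 z02.
have P11 : P1 *m P1 = P1 by apply: (idem _ P0 P2) => //; rewrite [P1 + P0]addrC.
have P22 : P2 *m P2 = P2 by apply: (idem _ P0 P1) => //; rewrite -addrA addrC.
pose Ei (P : 'M[R]_d) : 'M[R]_d := E *m P.
have EiM P Q : E *m P = P *m E -> Ei P *m Ei Q = E *m (P *m Q).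
  by move=> h; rewrite /Ei h mulmxA -(mulmxA P) EE -h !mulmxA.
have Ei1 : Ei P1 *m Ei P1 = Ei P1 by rewrite EiM // P11.
(* With equal ranks the row space of [E] would be that of [E *m P1], on which [P1] is the identity,
   so that [E *m P1 = E]. *)
have rk : (\rank (Ei P1) < r)%N.
  apply: leq_trans rE; rewrite ltn_neqAle.
  have sub : (Ei P1 <= E)%MS by rewrite /Ei eP1 submxMl.
  rewrite mxrankS // andbT; apply/negP => /eqP rk; apply: nE.
  have /andP[_ sub'] : (Ei P1 == E)%MS by rewrite -(mxrank_leqif_eq sub) rk.
  by have /submxP[X e] := sub'; rewrite {1}e -mulmxA -[Ei P1 *m P1]mulmxA P11 -e.
have [P [D [PD [PP DD] [PDz DPz] [cPP cDD] [polyP dD]]]] := IH _ rk Ei1 (commB_mul cE cP1).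
have PE : P *m Ei P1 = P by rewrite -PD mulmxDr PP PDz addr0.
have EP : Ei P1 *m P = P by rewrite -PD mulmxDl PP DPz addr0.
have DE : D *m Ei P1 = D by rewrite -PD mulmxDr DD DPz add0r.
have ED : Ei P1 *m D = D by rewrite -PD mulmxDl DD PDz add0r.
have zr (X Q : 'M[R]_d) : X *m Ei P1 = X -> P1 *m Q = 0 -> X *m Ei Q = 0 :> 'M[R]_d.
  by move=> h h0; rewrite -h -mulmxA EiM // h0 !mulmx0.
have zl (X Q : 'M[R]_d) : Ei P1 *m X = X -> E *m Q = Q *m E -> Q *m P1 = 0 -> Ei Q *m X = 0 :> 'M[R]_d.
  by move=> h h1 h0; rewrite -h mulmxA EiM // h0 mulmx0 mul0mx.
have i0 : Ei P0 *m Ei P0 = Ei P0 by rewrite EiM // P00.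
have i2 : Ei P2 *m Ei P2 = Ei P2 by rewrite EiM // P22.
have e02 : Ei P0 *m Ei P2 = 0 by rewrite EiM // z02 mulmx0.
have e20 : Ei P2 *m Ei P0 = 0 by rewrite EiM // z20 mulmx0.
have c0 := commB_mul cE cP0; have c2 := commB_mul cE cP2.
have p0 : P *m Ei P0 = 0 by exact: zr.
have p2 : P *m Ei P2 = 0 by exact: zr.
have p0' : Ei P0 *m P = 0 by exact: zl.
have p2' : Ei P2 *m P = 0 by exact: zl.
have d0' : D *m Ei P0 = 0 by exact: zr.
have d2 : D *m Ei P2 = 0 by exact: zr.
have d0'' : Ei P0 *m D = 0 by exact: zl.
have d2' : Ei P2 *m D = 0 by exact: zl.
exists (P + Ei P0 + Ei P2), D; split.
- rewrite (_ : E = Ei P0 + Ei P1 + Ei P2); last by rewrite /Ei -!mulmxDr P012 mulmx1.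
  by rewrite -PD; zmod.
- split => //; rewrite !mulmxDl !mulmxDr PP i0 i2 p0 p2 p0' p2' e02 e20.
  by rewrite !addr0 !add0r.
- by split; rewrite ?mulmxDl ?mulmxDr ?PDz ?DPz ?d0' ?d2 ?d0'' ?d2' !addr0.
- by split => //; apply: commB_add => //; exact: commB_add.
split => //.
have con0 : contractable act (im (vp (Ei P0))).
  apply: (vp_contractable (a := a)) => // t; apply: (mxiter_to0_lt1 hq0).
  by rewrite /Ei mulmxA; have [] := hv (t *m E).
have con2 : contractable act (im (vp (Ei P2))).
  apply: (vp_contractable (a := - a)) => // t.
  apply: (mxiter_to0_gt1 (B := toC (Bm a)) (s := q2)) => //.
    by rewrite -map_mxM BmV map_mx1.
  by rewrite /Ei mulmxA; have [] := hv (t *m E).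
have ep0 := vp_eproj c0 i0; have ep2 := vp_eproj c2 i2; have epP := vp_eproj cPP PP.
have poly0 := polycontractable1 hM hact ep0 con0.
have poly2 := polycontractable1 hM hact ep2 con2.
have z1 x : vp P (vp (Ei P0) x) = 0 by rewrite vp_comp p0' vp0.
have z2 x : vp (Ei P0) (vp P x) = 0 by rewrite vp_comp p0 vp0.
have := polycontractable_add epP ep0 z1 z2 polyP poly0.
rewrite (_ : (fun x => vp P x + vp (Ei P0) x) = vp (P + Ei P0)); last first.
  by apply: funext => x; rewrite vpD.
move=> poly3.
have ep3 : eproj act (vp (P + Ei P0)).
  apply: vp_eproj; first exact: commB_add.
  by rewrite mulmxDl !mulmxDr PP i0 p0 p0' addr0 add0r.
have z3 x : vp (P + Ei P0) (vp (Ei P2) x) = 0.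
  by rewrite vp_comp mulmxDr p2' e20 addr0 vp0.
have z4 x : vp (Ei P2) (vp (P + Ei P0) x) = 0.
  by rewrite vp_comp mulmxDl p2 e02 addr0 vp0.
have := polycontractable_add ep3 ep2 z3 z4 poly3 poly2.
rewrite (_ : (fun x => vp (P + Ei P0) x + vp (Ei P2) x) = vp (P + Ei P0 + Ei P2)) //.
by apply: funext => x; rewrite [RHS]vpD.
Qed.

Lemma mxroots_linear n (B : 'M[R[i]]_n) q :
  exists Q, forall t, mxroots B q t = t *m Q.
Proof.
elim: q => [|z q [Q hQ]]; first by exists 1%:M => t; rewrite mulmx1.
exists ((B - z%:M) *m Q) => t /=.
by rewrite mulmxA mulmxBr mul_mx_scalar -hQ.
Qed.

Lemma distal_im D : D *m D = D -> commB D -> distalB D ->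
  distal_euclidean act (im (vp D)).
Proof.
move=> DD cD dD; pose S := row_base D; pose T := pinvmx S.
have ST : S *m T = 1%:M by rewrite mulmxVp // row_base_free.
have SD : S *m D = S.
  have /submxP[X ->] : (S <= D)%MS by rewrite eq_row_base.
  by rewrite -mulmxA DD.
have DTS (t : 'rV[R]_d) : t *m D = t -> t *m T *m S = t.
  by move=> tD; apply: mulmxKpV; rewrite eq_row_base -tD submxMl.
exists (\rank D), (fun x => F x *m T), (fun t => s (t *m S)); split.
  split.
  - by move=> x y _ _; rewrite FD mulmxDl.
  - apply: continuous_subspaceT; apply: additive_continuous => [x y|W /nbhs0_normP[e [e0 he]]].
      by rewrite FD mulmxDl.
    have [c [c0 hc]] := rV_mulmx_le T.
    apply: filterS (F_nbhs (divr_gt0 e0 c0)) => x /= hx; apply: he.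
    by apply: le_lt_trans (hc _) _; rewrite mulrC -ltr_pdivlMr.
  - apply: additive_continuous => [t t'|W nW]; first by rewrite mulmxDl sD.
    have [e [e0 he]] := s_small nW; have [c [c0 hc]] := rV_mulmx_le S.
    apply: filterS (nbhs0_norm _ (divr_gt0 e0 c0)) => t /= ht; apply: he.
    by apply: le_lt_trans (hc _) _; rewrite mulrC -ltr_pdivlMr.
  - move=> t; rewrite /im /= /vp sK -mulmxA SD; split => //.
    by rewrite -mulmxA ST mulmx1.
  - move=> x hx; have Fx : F x *m D = F x.
      by have := congr1 F hx; rewrite /vp sK.
    by rewrite DTS // -{2}hx /vp Fx.
move=> a; exists (S *m Bm a *m T); split.
  by move=> t; rewrite hBm sK !mulmxA.
move=> z; rewrite map_char_poly -eigenvalue_root_char => /eigenvalueP[u hu u0].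
apply/normc_eq1; have [q [hq hz]] := dD a; apply: hq.
have [Q hQ] := mxroots_linear (toC (Bm a)) q.
(* [hz] speaks of real vectors only; written as a matrix identity it applies to complex
   eigenvectors. *)
have DQ : toC D *m Q = 0.
  apply/row_matrixP => i; rewrite row_mul row0 -map_row -hQ.
  by have := hz (delta_mx 0 i); rewrite -rowE.
have SBTS : S *m Bm a *m T *m S = S *m Bm a.
  apply: mulmxKpV; rewrite eq_row_base.
  by rewrite -{1}SD -mulmxA cD mulmxA submxMl.
(* An eigenvector in the coordinates of the image of [D] becomes one of [Bm a] annihilated by the
   list [q], which must then contain its eigenvalue. *)
pose w := u *m toC S.
apply: (mxroots_eigen (B := toC (Bm a)) (v := w)).
- rewrite /w -mulmxA -map_mxM -SBTS map_mxM mulmxA hu.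
  by rewrite -scalemxAl.
- apply: contraNneq u0 => w0; have := congr1 (mulmx^~ (toC T)) w0.
  by rewrite /w /= -mulmxA -map_mxM ST map_mx1 mulmx1 mul0mx => ->.
- by rewrite hQ /w -SD map_mxM -!mulmxA DQ !mulmx0.
Qed.

Lemma pL_equivariant : equivariant act pL.
Proof.
apply: equivariantP => [x y|W nW|a x].
- by rewrite /pL /pV FD sD; zmod.
- have [V [nV sV VV]] := nbhs0_split nW.
  have [e [e0 he]] := s_small nV.
  by apply: filterS (filterI nV (F_nbhs e0)) => x [Vx Fx]; apply: VV => //; exact/sV/he.
- by rewrite /pL /pV F_act -hBm (actB hact).
Qed.

(** Omega^sharp passes from [M] to [L] by pulling [U] back along [pL]. *)
Lemma omega_ell U : alg_submodule act U -> U `<=` L ->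
  (exists C, osub L C /\ C `<=` U) ->
  (forall N, alg_submodule act N -> U `<=` N -> N `<=` L -> finite_index U N ->
     N `<=` U) -> L `<=` U.
Proof.
move=> mU UL [C [oC CU]] hU x Lx.
have ep := pL_equivariant.
suff : U (pL x) by rewrite pL_id.
apply: (omega_full hs.2 (U := [set y | U (pL y)])).
- split; first split.
  + by rewrite /= (eqv0 ep); exact: (sg0 mU.1).
  + by move=> y z /= hy hz; rewrite (eqvB _ _ ep); exact: (sgB mU.1).
  + by move=> a y /= hy; rewrite (eqv_act ep); exact: mU.2.
- have [W [nW WC]] := osub_nbhs oC.
  apply: (sg_open (W := [set y | W (pL y)])).
  + split; first by rewrite /= (eqv0 ep); exact: (sg0 mU.1).
    by move=> y z /= hy hz; rewrite (eqvB _ _ ep); exact: (sgB mU.1).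
  + exact: (eqv_nbhs ep).
  + by move=> y Wy; apply/CU/WC; split => //; exact: pL_ell.
move=> N mN UN [Fs [fF [FN NF]]].
have pp y : pL (pL y) = pL y by rewrite pL_id //; exact: pL_ell.
have pN y : N y -> N (pL y).
  move=> Ny; have -> : pL y = y - (y - pL y) by zmod.
  apply: (sgB mN.1) => //; apply: UN => /=.
  by rewrite (eqvB _ _ ep) pp subrr; exact: (sg0 mU.1).
have key : N `&` L `<=` U.
  apply: hU.
  - split; first exact: (sgI mN.1 sL).
    by move=> a y [Ny py]; split; [exact: mN.2|exact: mL.2].
  - by move=> u Uu; split; [apply: UN; rewrite /= pL_id //; exact: UL|exact: UL].
  - by move=> y [].
  - exists (pL @` Fs); split; first exact: finite_image.
    split; first by move=> _ [f Ff <-]; split; [apply: pN; exact: FN|exact: pL_ell].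
    move=> y [Ny Ly]; have [f Ff Uf] := NF y Ny.
    by exists (pL f); [exists f|rewrite -{1}(pL_id Ly) -(eqvB _ _ ep)].
by move=> y Ny; apply: key; split; [exact: pN|exact: pL_ell].
Qed.

Lemma para_ell N : N `<=` L -> compact_parafinite act N -> N `<=` [set 0].
Proof. by move=> _; exact: (parafinite_eq0 hs.1). Qed.

Local Notation cona := (con act L).
Local Notation leva := (lev act L).
Let conDec := @con_lev_dec A M act hM hact L mL cL basisL ellL para_ell omega_ell.
Let conDirect := @con_lev_direct A M act hM hact L mL cL basisL ellL para_ell.
Let conCont := @con_lev_continuous A M act hM hact L mL cL basisL ellL para_ell.
Let mcon := @con_submodule A M act hact L mL.
Let mlev := @lev_submodule A M act hact L mL basisL ellL.
Let con_ell := @con_L A M act hact L mL basisL.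
Let lev_ell := @lev_L A M act hact L.

(** Without reference to compact open subgroups, it becomes plain that equivariant maps preserve
    contraction. *)
Lemma conP a x : cona a x <-> L x /\ forall W, nbhs (0 : M) W ->
  exists n0, forall n, (n0 <= n)%N -> W (act (a *+ n) x).
Proof.
split=> [h|[Lx h] C oC].
  split; first exact: con_ell h.
  move=> W /basisL[C [oC CW]]; have [n0 hn] := h C oC.
  by exists n0 => n /hn /CW.
have [W [nW WC]] := osub_nbhs oC.
have [n0 hn] := h W nW; exists n0 => n nn; apply: WC; split; first exact: hn.
exact: mL.2.
Qed.

Lemma eqv_ell p x : equivariant act p -> L x -> L (p x).
Proof.
move=> ep [K [sK' cK Kx]]; exists (p @` K); split; last by exists x.
- split; first by exists 0; [exact: sg0|exact: (eqv0 ep)].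
  by move=> _ _ [y Ky <-] [z Kz <-]; exists (y - z); [exact: sgB|exact: (eqvB _ _ ep)].
- by apply: compact_image => //; exact: eqv_cont ep.
Qed.

Lemma eqv_con p a x : equivariant act p -> cona a x -> cona a (p x).
Proof.
move=> ep /conP[Lx h]; apply/conP; split; first exact: eqv_ell.
move=> W nW; have [n0 hn] := h _ (eqv_nbhs ep nW).
by exists n0 => n nn; rewrite -(eqv_act ep); exact: hn.
Qed.

Lemma eqv_lev p a x : equivariant act p -> leva a x -> leva a (p x).
Proof.
move=> ep [C [oC [h1 h2]]].
have [||D [oD hD]] := ellL (X := p @` C).
- by apply: compact_image; [exact: eqv_cont ep|exact: osub_compact oC].
- by move=> _ [y Cy <-]; apply: eqv_ell => //; exact: (osub_L oC).
exists D; split => //; split => n; apply: hD; rewrite -(eqv_act ep).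
  by exists (act (a *+ n) x).
by exists (act ((- a) *+ n) x).
Qed.

(** The composite of [s], [p] and [pL] is a continuous homomorphism from R^d to [L], hence 0. *)
Lemma eqv_pL p x : equivariant act p -> pL (p x) = p (pL x).
Proof.
move=> ep; have epL := pL_equivariant.
have {1}-> : x = pL x + pV x by rewrite /pL; zmod.
rewrite (eqvD ep) (eqvD epL) pL_id; last by apply: eqv_ell => //; exact: pL_ell.
rewrite /pV (_ : pL (p (s (F x))) = 0) ?addr0 //.
apply: (@hom_ell0 d (fun t => pL (p (s t)))).
- by move=> t t'; rewrite sD (eqvD ep) (eqvD epL).
- move=> t; apply: (continuous_comp (f := s) (g := fun x => pL (p x))).
    exact: (ess_cont es).
  exact: (eqv_cont (equivariant_comp epL ep)).
- by move=> t; exact: pL_ell.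
Qed.

Lemma con_lev_uniq a u w v u' w' v' : cona a u -> cona (- a) w -> leva a v ->
  cona a u' -> cona (- a) w' -> leva a v' -> u + w + v = u' + w' + v' ->
  [/\ u = u', w = w' & v = v'].
Proof.
move=> hu hw hv hu' hw' hv' e.
have [] := @conDirect a (u - u') (w - w') (v - v').
- exact: (sgB (mcon a).1).
- exact: (sgB (mcon (- a)).1).
- exact: (sgB (mlev a).1).
- have -> : u - u' + (w - w') + (v - v') = (u + w + v) - (u' + w' + v') by zmod.
  by rewrite e subrr.
by move=> /subr0_eq-> /subr0_eq-> /subr0_eq->.
Qed.

Lemma con_proj a : exists pu pw pv : M -> M,
  [/\ equivariant act pu, equivariant act pw, equivariant act pv &
   forall x, [/\ cona a (pu x), cona (- a) (pw x), leva a (pv x) &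
     pu x + pw x + pv x = pL x]].
Proof.
have /choice[h hh] : forall x, exists t : M * M * M,
    [/\ cona a t.1.1, cona (- a) t.1.2, leva a t.2 & t.1.1 + t.1.2 + t.2 = pL x].
  move=> x; have [u [w [v [hu hw hv e]]]] := conDec a (pL_ell x).
  by exists (u, w, v).
have ep := pL_equivariant.
have hD x y : [/\ (h (x + y)).1.1 = (h x).1.1 + (h y).1.1,
    (h (x + y)).1.2 = (h x).1.2 + (h y).1.2 & (h (x + y)).2 = (h x).2 + (h y).2].
  have [a1 a2 a3 a4] := hh (x + y); have [b1 b2 b3 b4] := hh x; have [c1 c2 c3 c4] := hh y.
  apply: (con_lev_uniq a1 a2 a3).
  - exact: (sgD (mcon a).1).
  - exact: (sgD (mcon (- a)).1).
  - exact: (sgD (mlev a).1).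
  - by rewrite a4 (eqvD ep) -b4 -c4; zmod.
have ha b x : [/\ (h (act b x)).1.1 = act b (h x).1.1,
    (h (act b x)).1.2 = act b (h x).1.2 & (h (act b x)).2 = act b (h x).2].
  have [a1 a2 a3 a4] := hh (act b x); have [b1 b2 b3 b4] := hh x.
  apply: (con_lev_uniq a1 a2 a3).
  - exact: (mcon a).2.
  - exact: (mcon (- a)).2.
  - exact: (mlev a).2.
  - by rewrite a4 (eqv_act ep) -b4 !(actD hact).
have hc W : nbhs (0 : M) W -> nbhs (0 : M) [set x | [/\ W (h x).1.1, W (h x).1.2 & W (h x).2]].
  move=> nW; have [V [nV hV]] := conCont a nW.
  apply: filterS (eqv_nbhs ep nV) => x Vx.
  by have [b1 b2 b3 b4] := hh x; apply: hV => //; rewrite b4.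
exists (fun x => (h x).1.1), (fun x => (h x).1.2), (fun x => (h x).2); split => //.
- apply: equivariantP => [x y|W nW|b x]; [by have [] := hD x y| |by have [] := ha b x].
  by apply: filterS (hc W nW) => x [].
- apply: equivariantP => [x y|W nW|b x]; [by have [] := hD x y| |by have [] := ha b x].
  by apply: filterS (hc W nW) => x [].
- apply: equivariantP => [x y|W nW|b x]; [by have [] := hD x y| |by have [] := ha b x].
  by apply: filterS (hc W nW) => x [].
Qed.

Lemma pL_eproj : eproj act pL.
Proof.
by split; [exact: pL_equivariant|move=> x; rewrite pL_id //; exact: pL_ell].
Qed.

Lemma ell_dec (l : seq A) : exists pP pE : M -> M,
  [/\ eproj act pP, eproj act pE, forall x, pP x + pE x = pL x,
      (forall x, pP (pE x) = 0) /\ (forall x, pE (pP x) = 0) &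
      polycontractable act (im pP) /\ forall a, a \in l -> forall x, leva a (pE x)].
Proof.
elim: l => [|a l [pP [pE [[eP PP] [eE EE] PE [zPE zEP] [poly hl]]]]].
  exists (fun=> 0), pL; split => //.
  - by split; [exact: (equivariant0 hact)|].
  - exact: pL_eproj.
  - by move=> x; rewrite add0r.
  - by split => // x; rewrite (eqv0 pL_equivariant).
  - by split => //; exact: polycontractable0.
have [pu [pw [pv [eu ew ev hp]]]] := con_proj a.
(* Applying [p] to the splitting of [x] gives a splitting of [p x] of the same kind, and there is
   only one. *)
have comm p x : equivariant act p ->
    [/\ pu (p x) = p (pu x), pw (p x) = p (pw x) & pv (p x) = p (pv x)].
  move=> ep; have [a1 a2 a3 a4] := hp (p x); have [b1 b2 b3 b4] := hp x.
  apply: (con_lev_uniq a1 a2 a3).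
  - exact: eqv_con.
  - exact: eqv_con.
  - exact: eqv_lev.
  - by rewrite a4 eqv_pL // -b4 !(eqvD ep).
have con0 b : cona b 0 := sg0 (mcon b).1.
have lev0 b : leva b 0 := sg0 (mlev b).1.
have onu x : cona a x -> [/\ pu x = x, pw x = 0 & pv x = 0].
  move=> hx; have [a1 a2 a3 a4] := hp x; apply: (con_lev_uniq a1 a2 a3) => //.
  by rewrite a4 !addr0 pL_id //; exact: con_ell hx.
have onw x : cona (- a) x -> [/\ pu x = 0, pw x = x & pv x = 0].
  move=> hx; have [a1 a2 a3 a4] := hp x; apply: (con_lev_uniq a1 a2 a3) => //.
  by rewrite a4 add0r addr0 pL_id //; exact: con_ell hx.
have onv x : leva a x -> [/\ pu x = 0, pw x = 0 & pv x = x].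
  move=> hx; have [a1 a2 a3 a4] := hp x; apply: (con_lev_uniq a1 a2 a3) => //.
  by rewrite a4 !add0r pL_id //; exact: lev_ell hx.
pose qu x := pu (pE x); pose qw x := pw (pE x); pose qv x := pv (pE x).
have eqqu : equivariant act qu := equivariant_comp eu eE.
have eqqw : equivariant act qw := equivariant_comp ew eE.
have eqqv : equivariant act qv := equivariant_comp ev eE.
have Equ x : pE (qu x) = qu x by have [h _ _] := comm pE (pE x) eE; rewrite /qu -h EE.
have Eqw x : pE (qw x) = qw x by have [_ h _] := comm pE (pE x) eE; rewrite /qw -h EE.
have Eqv x : pE (qv x) = qv x by have [_ _ h] := comm pE (pE x) eE; rewrite /qv -h EE.
have cqu x : cona a (qu x) by have [] := hp (pE x).
have cqw x : cona (- a) (qw x) by have [] := hp (pE x).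
have cqv x : leva a (qv x) by have [] := hp (pE x).
have pru : eproj act qu.
  by split => // x; rewrite /qu Equ; have [] := onu _ (cqu x).
have prw : eproj act qw.
  by split => // x; rewrite /qw Eqw; have [] := onw _ (cqw x).
have prv : eproj act qv.
  by split => // x; rewrite /qv Eqv; have [] := onv _ (cqv x).
have Pz x : pE x = x -> pP x = 0 by move=> <-.
have pEsum x : pE x = qu x + qw x + qv x.
  have [_ _ _ e] := hp (pE x); rewrite /qu /qw /qv e pL_id //.
  rewrite -(EE x); apply: eqv_ell => //; have := PE (pE x); rewrite zPE add0r EE => ->.
  exact: pL_ell.
have conU : contractable act (im qu).
  apply: (contractable_im hM hact (a := a) eqqu) => K W cK Kq nW.
  apply: (con_uniform hM hact mL cL basisL para_ell (K := K)) => //.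
  by move=> x Kx; have <- : qu x = x by exact: Kq.
have conW : contractable act (im qw).
  apply: (contractable_im hM hact (a := - a) eqqw) => K W cK Kq nW.
  apply: (con_uniform hM hact mL cL basisL para_ell (K := K)) => //.
  by move=> x Kx; have <- : qw x = x by exact: Kq.
have polyU := polycontractable1 hM hact pru conU.
have polyW := polycontractable1 hM hact prw conW.
have z1 x : pP (qu x) = 0 by exact: Pz.
have z2 x : qu (pP x) = 0 by rewrite /qu zEP (eqv0 eu).
have poly2 := polycontractable_add (conj eP PP) pru z1 z2 poly polyU.
pose p2 x := pP x + qu x.
have e2 : equivariant act p2 := equivariant_add hact eP eqqu.
have pr2 : eproj act p2.
  split => // x; rewrite /p2 (eqvD eP) (eqvD eqqu) PP z1 z2.
  by rewrite (pru.2) addr0 add0r.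
have z3 x : p2 (qw x) = 0.
  rewrite /p2 Pz // add0r /qu Eqw.
  by have [] := onw _ (cqw x).
have z4 x : qw (p2 x) = 0.
  rewrite /p2 (eqvD eqqw) {1}/qw zEP (eqv0 ew) add0r /qw Equ.
  by have [] := onu _ (cqu x).
have poly3 := polycontractable_add pr2 prw z3 z4 poly2 polyW.
pose p3 x := p2 x + qw x.
have e3 : equivariant act p3 := equivariant_add hact e2 eqqw.
exists p3, qv; split => //.
- split => // x; rewrite /p3 (eqvD e2) (eqvD eqqw) pr2.2 z3 z4 prw.2.
  by rewrite addr0 add0r.
- by move=> x; rewrite /p3 /p2 -PE pEsum; zmod.
- split=> x.
    rewrite /p3 /p2 Pz // add0r {1}/qu {1}/qw !Eqv.
    by have [-> -> _] := onv _ (cqv x); rewrite addr0.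
  rewrite /p3 /p2 !(eqvD eqqv) {1 2 3}/qv zEP (eqv0 ev) Equ Eqw.
  by have [_ _ ->] := onu _ (cqu x); have [_ _ ->] := onw _ (cqw x); rewrite !addr0.
- split => // b; rewrite inE => /predU1P[->//|bl] x.
  exact: (eqv_lev ev (hl b bl x)).
Qed.

(** * Compact generation of A and the amorphic part *)

Fixpoint zspan (l : seq A) (a : A) : Prop :=
  if l is b :: l' then exists k : int, zspan l' (a - b *~ k) else a = 0.

Lemma zspan_sg l : is_subgroup (zspan l).
Proof.
elim: l => [|b l IH] /=; first by split => // x y -> ->; rewrite subrr.
split; first by exists 0; rewrite mulr0z subr0; exact: IH.1.
move=> x y [k hk] [k' hk']; exists (k - k').
have -> : x - y - b *~ (k - k') = (x - b *~ k) - (y - b *~ k') by rewrite mulrzBr; zmod.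
exact: IH.2.
Qed.

Lemma zspan_mem l a : a \in l -> zspan l a.
Proof.
elim: l => //= b l IH; rewrite inE => /predU1P[->|/IH h].
  by exists 1; rewrite mulr1z subrr; exact: (zspan_sg l).1.
by exists 0; rewrite mulr0z subr0.
Qed.

(** The orbit of [X] under the first generator lies in a compact subset of [E], to which induction
    applies with the remaining generators; commutativity of [A] keeps just one pass per
    generator. *)
Lemma zspan_bounded l (E X : set M) : alg_submodule act E -> closed E -> E `<=` L ->
  (forall a, a \in l -> E `<=` leva a) -> compact X -> X `<=` E ->
  exists D, osub L D /\ forall a x, zspan l a -> X x -> D (act a x).
Proof.
move=> mE cE EL; elim: l X => [|b l IH] X hl cX XE /=.
  have [D [oD XD]] := ellL cX (fun x Xx => EL x (XE x Xx)).
  by exists D; split => // a x -> Xx; rewrite (act0 hact); exact: XD.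
have [|C [oC XC]] := lev_bounded hM hact mL cL basisL ellL para_ell (a := b) cX.
  by move=> x /XE; exact: (hl b (mem_head _ _)).
have [|||D [oD hD]] := IH (C `&` E).
- by move=> a al; have := hl a; rewrite inE al orbT; exact.
- apply: (subclosed_compact _ (osub_compact oC)); last by move=> x [].
  by apply: closedI => //; exact: (osub_closed hM oC).
- by move=> x [].
exists D; split => // a x [k hk] Xx.
have -> : act a x = act (a - b *~ k) (act (b *~ k) x) by rewrite (actA hact) subrK.
apply: hD => //; split; last by apply: mE.2; exact: XE.
have [h1 h2] := XC x Xx; case: k hk => k _; first exact: h1.
by have := h2 k.+1; rewrite mulNrn NegzE mulrNz.
Qed.

Definition stab (C : set M) : set A :=
  [set a | forall x, C x -> C (act a x) /\ C (act (- a) x)].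

Lemma stab_sg C : is_subgroup (stab C).
Proof.
split; first by move=> x Cx; rewrite oppr0 (act0 hact).
move=> a b ha hb x Cx; rewrite -(actA hact) opprB -(actA hact); split.
  by apply: (ha _ _).1; exact: (hb _ Cx).2.
by apply: (hb _ _).1; exact: (ha _ Cx).2.
Qed.

(** A tube argument: joint continuity of the action gives a neighbourhood of 0 in [A] near each
    point of the compact [C], and finitely many of them suffice. *)
Lemma stab_nbhs C : osub L C -> nbhs (0 : A) (stab C).
Proof.
move=> oC; have sC := osub_sg oC.
have half : nbhs (0 : A) [set a | forall x, C x -> C (act a x)].
  have [W [nW WC]] := osub_nbhs oC.
  have /compact_near_coveringP cov := osub_compact oC.
  have : \forall a \near (0 : A), C `<=` [set x | C x -> C (act a x)].
    apply: cov => x Cx.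
    have nx : nbhs x [set y | W (y - x)].
      by apply/nbhs_shift; apply: filterS nW => y /=; rewrite addrC addKr.
    have hW : nbhs (act (0 : A, x).1 (0 : A, x).2) [set y | W (y - x)] by rewrite /= (act0 hact).
    have [_ _ _ cact] := hact.
    have := cact (0, x); move=> /(_ _ hW)[[P Q] /= [nP nQ] PQ].
    exists (Q, P) => // -[y a] [/= Qy Pa] Cy.
    have := PQ (a, y) (conj Pa Qy); rewrite /= => Wy.
    rewrite -(subrK x (act a y)); apply: sgD => //; apply: WC; split => //.
    by apply: (sgB sL); [apply: mL.2|]; exact: (osub_L oC).
  by apply: filterS => a h x Cx; exact: h.
have half' : nbhs (0 : A) [set a | forall x, C x -> C (act (- a) x)].
  have := @opp_continuous A 0 [set a | forall x, C x -> C (act a x)].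
  by rewrite oppr0; apply.
by apply: filterS (filterI half half') => a [h h'] x Cx; split; [exact: h|exact: h'].
Qed.

(** Since [stab C] is open, the compact generating set is covered modulo it by a finite list [l];
    then [zspan l + stab C] is a subgroup containing that set. *)
Lemma cg_zspan C : compactly_generated A -> osub L C ->
  exists l : seq A, forall a, exists b, zspan l b /\ stab C (a - b).
Proof.
move=> [K [cK hK]] oC; have sS := stab_sg C.
have [l [_ hl]] := compact_net cK (@subset_refl _ K) (stab_nbhs oC).
exists l => a; pose H := addS (zspan l) (stab C).
have [b [c [hb hc ->]]] : H a.
  rewrite (hK H) //; first exact: (sg_addS (zspan_sg l) sS).
  move=> k Kk; have [y yl hy] := hl k Kk; exists y, (k - y); split => //.
    exact: zspan_mem.
  by rewrite addrC subrK.
by exists b; rewrite addrC addKr.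
Qed.

(* Up to the open stabilizer of C, A is generated by l, whose elements have bounded
   orbits on im pE: hence C generates a compact submodule. *)
Lemma im_compact_open C (l : seq A) pE : osub L C ->
  (forall a, exists b, zspan l b /\ stab C (a - b)) -> eproj act pE ->
  (forall x, L (pE x)) -> (forall a, a \in l -> forall x, leva a (pE x)) ->
  exists N, [/\ alg_submodule act N, N `<=` im pE, compact N & open_in (im pE) N].
Proof.
move=> oC hC [eE EE] EL hl.
have [mE cE] := im_submodule hM hact eE.
have imL : im pE `<=` L by move=> x <-.
pose X := C `&` im pE.
have cX : compact X.
  apply: (subclosed_compact _ (osub_compact oC)); last by move=> x [].
  by apply: closedI => //; exact: (osub_closed hM oC).
have [||D [oD hD]] := zspan_bounded (l := l) mE cE imL _ cX.
- by move=> a al x <-; exact: hl.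
- by move=> x [].
(* [Y] is invariant under all of [A]: the part of an element of [A] outside [zspan l] may be taken
   in [stab C], which maps [X] into itself. *)
pose Y := [set y | exists a x, [/\ zspan l a, X x & y = act a x]].
have aY a y : Y y -> Y (act a y).
  move=> [b [x [hb [Cx Ex] ->]]]; have [c [hc sc]] := hC a.
  exists (c + b), (act (a - c) x); split.
  - exact: (sgD (zspan_sg l)).
  - by split; [exact: (sc x Cx).1|exact: mE.2].
  - by rewrite !(actA hact); congr (act _ x); zmod.
have XY x : X x -> Y x.
  by move=> Xx; exists 0, x; split => //; [exact: (zspan_sg l).1|rewrite (act0 hact)].
(* The closed subgroup generated by [Y]; it lies in the compact group [D] and contains [X], so it is
   compact and relatively open. *)
pose N := [set x | forall H, is_subgroup H -> closed H -> Y `<=` H -> H x].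
have sN : is_subgroup N.
  split=> [H sH _ _|x y hx hy H sH cH YH]; first exact: (sg0 sH).
  by apply: (sgB sH); [exact: hx|exact: hy].
have cN : closed N.
  move=> x cx H sH cH YH; apply: (cH); apply: closureS cx => y hy; exact: (hy H sH cH YH).
have ND : N `<=` D.
  move=> x; apply; [exact: osub_sg oD|exact: (osub_closed hM oD)|].
  by move=> _ [a [y [ha Xy ->]]]; exact: hD.
have NE : N `<=` im pE.
  move=> x; apply => //; first exact: mE.1.
  by move=> _ [a [y [ha [_ Ey] ->]]]; exact: mE.2.
have XN : X `<=` N by move=> x /XY Yx H _ _; apply.
exists N; split => //.
- split => // a x Nx H sH cH YH.
  apply: (Nx [set y | H (act a y)]); [exact: (sg_act hact)|exact: (closed_act hact)|].
  by move=> y Yy; apply/YH/aY.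
- exact: (subclosed_compact cN (osub_compact oD)).
have [W [nW WC]] := osub_nbhs oC.
apply: (sg_open_in mE.1 sN NE nW) => x [Wx Ex]; apply: XN.
by split => //; apply: WC; split => //; exact: imL.
Qed.

Lemma PEV_exists : compactly_generated A -> exists P E V : set M, PEV_decomposition act P E V.
Proof.
move=> cg; have [C [oC _]] : exists C, osub L C /\ C `<=` setT.
  by apply: basisL; exact: filterT.
have [l hl] := cg_zspan cg oC.
have [pP [pE [prP prE PE [zPE zEP] [polyP levE]]]] := ell_dec l.
have [eP PP] := prP; have [eE EE] := prE.
have [||P0 [D [PD [PP0 DD] [PDz DPz] [cP cD] [poly0 dD]]]] := @euclid_dec 1%:M.
- by rewrite mulmx1.
- by move=> a; rewrite mul1mx mulmx1.
have prV := vp_eproj cP PP0; have prD := vp_eproj cD DD.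
have LP x : L (pP x).
  by rewrite -(PP x) -[pP (pP x)]addr0 -(zEP x) PE; exact: pL_ell.
have LE x : L (pE x).
  by rewrite -(EE x) -[pE (pE x)]add0r -(zPE x) PE; exact: pL_ell.
have vpL X x : L x -> vp X x = 0 by move=> /F_ell h; rewrite /vp h mul0mx s0.
have pLv X x : pL (vp X x) = 0 by exact: pL_s.
have pPv X x : pP (vp X x) = 0.
  have h : pP (vp X x) + pE (vp X x) = 0 by rewrite PE.
  have := congr1 pP h; rewrite (eqvD eP) PP zPE addr0 (eqv0 eP) //.
have pEv X x : pE (vp X x) = 0.
  by have := PE (vp X x); rewrite pPv add0r pLv.
have z1 x : vp P0 (pP x) = 0 by apply: vpL.
have z2 x : pP (vp P0 x) = 0 by exact: pPv.
have polyT := polycontractable_add prV prP z1 z2 poly0 polyP.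
(* The contracted parts of the Euclidean summand and of [L] are joined into one polycontractable
   summand. *)
pose q x := vp P0 x + pP x.
have eq : equivariant act q := equivariant_add hact prV.1 eP.
have qq x : q (q x) = q x.
  by rewrite /q (eqvD prV.1) (eqvD eP) prV.2 PP z1 z2 addr0 add0r.
exists (im q), (im pE), (im (vp D)).
have sum x : x = q x + pE x + vp D x.
  have -> : q x + pE x + vp D x = (vp P0 x + vp D x) + (pP x + pE x) by rewrite /q; zmod.
  by rewrite -vpD PD vp1 PE /pL; zmod.
split.
- exact: im_submodule.
- exact: im_submodule.
- exact: (im_submodule hM hact prD.1).
- have sum3 (y : 'I_3 -> M) : \sum_(i < 3) y i = y ord0 + y (lift ord0 ord0) + y ord_max.
    rewrite !big_ord_recl big_ord0 addr0 addrA; congr (_ + _ + y _).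
    exact: val_inj.
  split => //.
  + move=> y z hy hz; rewrite !sum3 => e.
    have y0 := hy ord0; have y1 := hy (lift ord0 ord0); have y2 := hy ord_max.
    have t0 := hz ord0; have t1 := hz (lift ord0 ord0); have t2 := hz ord_max.
    rewrite /im /= in y0 y1 y2 t0 t1 t2.
    have kE u v w : q u = u -> pE v = v -> vp D w = w -> pE (u + v + w) = v.
      move=> hu hv hw; rewrite !(eqvD eE) hv -hu -hw pEv /q (eqvD eE) pEv zEP.
      by rewrite !addr0 add0r.
    have kD u v w : q u = u -> pE v = v -> vp D w = w -> vp D (u + v + w) = w.
      move=> hu hv hw; rewrite !(eqvD prD.1) hw -hu -hv [vp D (pE v)]vpL //.
      rewrite /q (eqvD prD.1) [vp D (pP u)]vpL // vp_comp PDz vp0.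
      by rewrite !add0r.
    have e1 : y (lift ord0 ord0) = z (lift ord0 ord0).
      by rewrite -(kE _ _ _ y0 y1 y2) e (kE _ _ _ t0 t1 t2).
    have e2 : y ord_max = z ord_max.
      by rewrite -(kD _ _ _ y0 y1 y2) e (kD _ _ _ t0 t1 t2).
    have e0 : y ord0 = z ord0 by move: e; rewrite e1 e2 => /addIr /addIr.
    apply: funext => -[[|[|[|i]]] hi] //.
    * by rewrite (_ : Ordinal hi = ord0) //; exact: val_inj.
    * by rewrite (_ : Ordinal hi = lift ord0 ord0) //; exact: val_inj.
    * by rewrite (_ : Ordinal hi = ord_max) //; exact: val_inj.
  + exists (fun i => nth id [:: q; pE; vp D] i); split.
    * move=> -[[|[|[|i]]] hi] //= x _; rewrite /im /=; [exact: qq|exact: EE|exact: prD.2].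
    * by move=> x _; rewrite sum3 /=.
    * move=> -[[|[|[|i]]] hi] //=; apply: continuous_subspaceT.
      - exact: (eqv_cont eq).
      - exact: (eqv_cont eE).
      - exact: (eqv_cont prD.1).
- split.
  + exact: polyT.
  + split; first exact: (sheer_summand hM hact prE hs).
    exact: (im_compact_open oC hl prE LE levE).
  + exact: distal_im.
Qed.

(** * Uniqueness: vanishing of equivariant maps between parts of different kinds *)

Definition tends0 a x := forall W, nbhs (0 : M) W ->
  exists n0, forall n, (n0 <= n)%N -> W (act (a *+ n) x).

Lemma contracting_tends0 a S x : contracting_on act a S -> S x -> tends0 a x.
Proof.
move=> [_ h] Sx W nW; have [|n0 hn] := h [set x] _ (@compact_set1 _ x) W nW.
  by move=> _ ->.
by exists n0 => n nn; rewrite -(iter_act hact); exact: hn.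
Qed.

Lemma eqv_tends0 p a x : equivariant act p -> tends0 a x -> tends0 a (p x).
Proof.
move=> ep h W nW; have [n0 hn] := h _ (eqv_nbhs ep nW).
by exists n0 => n nn; rewrite -(eqv_act ep); exact: hn.
Qed.

Lemma tends0_periodic a x k : (0 < k)%N -> act (a *+ k) x = x -> tends0 a x -> x = 0.
Proof.
move=> k0 e h; apply: (nbhs0_eq0 hM) => W nW; have [n0 hn] := h W nW.
have per m : act (a *+ (k * m)) x = x.
  elim: m => [|m IH]; first by rewrite muln0 mulr0n (act0 hact).
  by rewrite mulnS -(actMnD hact) IH.
by rewrite -(per n0); apply: hn; exact: leq_pmull.
Qed.

(** Elements of a compact submodule have bounded orbits, so they are level, and level elements are
    not contracted unless they vanish. *)
Lemma compact_tends0_eq0 C a x : alg_submodule act C -> compact C -> C x ->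
  tends0 a x -> x = 0.
Proof.
move=> mC cC Cx h.
have CL : C `<=` L := compact_sg_ell mC.1 cC.
have [D [oD CD]] := ellL cC CL.
apply: (con_lev0 hM hact mL cL basisL para_ell (a := a)).
  by apply/conP; split; [exact: CL|].
by exists D; split => //; split => n; apply: CD; exact: mC.2.
Qed.

(* A finite submodule of E / ker p consists of classes whose images under p are torsion
   and periodic under every element of A. *)
Lemma omega_ker (E C : set M) p : alg_submodule act E -> Omega_sharp act E = E ->
  equivariant act p -> alg_submodule act C -> open_in E C ->
  (forall x, C x -> p x = 0) ->
  (forall x, E x -> (exists k, (0 < k)%N /\ p x *+ k = 0) ->
    (forall a, exists k, (0 < k)%N /\ act (a *+ k) (p x) = p x) -> p x = 0) ->
  forall x, E x -> p x = 0.
Proof.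
move=> mE hE ep mC oC pC hp x Ex.
pose U := [set x | E x /\ p x = 0].
have sU : is_subgroup U.
  split; first by split; [exact: (sg0 mE.1)|exact: (eqv0 ep)].
  move=> y z [Ey py] [Ez pz]; split; first exact: (sgB mE.1).
  by rewrite (eqvB _ _ ep) py pz subrr.
have mU : alg_submodule act U.
  split => // a y [Ey py]; split; first exact: mE.2.
  by rewrite (eqv_act ep) py (actr0 hact).
have [W [nW WC]] := open_in_nbhs oC (sg0 mC.1).
have : Omega_sharp act E x by rewrite hE.
suff h : purely_discrete_quotient act E U by move=> /(_ U h)[].
split => //; first by move=> y [].
  apply: (sg_open_in mE.1 sU _ nW) => [y []//|y Wy].
  by split; [exact: Wy.2|exact/pC/WC].
move=> N mN UN NE fN y Ny; split; first exact: NE.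
apply: hp; first exact: NE.
  have [i [j [ij [_]]]] := finite_index_recur sU fN (fun n => sgMn n mN.1 Ny).
  have -> : y *+ i - y *+ j = - (y *+ (j - i)).
    by rewrite mulrnBr ?(ltnW ij) // opprB.
  have pMn n : p (y *+ n) = p y *+ n.
    by elim: n => [|n IH]; rewrite ?mulr0n ?(eqv0 ep) // !mulrS (eqvD ep) IH.
  rewrite (eqvN _ ep) pMn => /eqP; rewrite oppr_eq0 => /eqP e.
  by exists (j - i)%N; rewrite subn_gt0.
move=> a; have [i [j [ij [_]]]] := finite_index_recur sU fN (fun n => mN.2 (a *+ n) _ Ny).
rewrite (eqvB _ _ ep) !(eqv_act ep) => /subr0_eq e.
exists (j - i)%N; rewrite subn_gt0; split => //.
by rewrite -(actMnl hact) ?(ltnW ij) // -e (actMnK hact).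
Qed.

(** The orbit of [x] reaches the compact open submodule [C], and invariance under the inverse puts
    [x] itself into [C]. *)
Lemma amorphic_tends0_eq0 E a x : alg_submodule act E -> amorphic act E -> E x ->
  tends0 a x -> x = 0.
Proof.
move=> mE [_ [C [mC CE cC oC]]] Ex h.
have [W [nW WC]] := open_in_nbhs oC (sg0 mC.1).
have [n0 hn] := h W nW.
have Cx : C x.
  rewrite -(actMnK hact a n0 x); apply: mC.2; apply: WC; split; first exact: hn.
  exact: mE.2.
exact: (compact_tends0_eq0 mC cC Cx h).
Qed.

(** [p] kills [C], whose image is a compact submodule of contracted vectors; beyond [C], [omega_ker]
    leaves only periodic contracted vectors, which vanish. *)
Lemma amorphic_hom_tends0 E a p : alg_submodule act E -> amorphic act E ->
  equivariant act p -> (forall x, tends0 a (p x)) -> forall x, E x -> p x = 0.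
Proof.
move=> mE [[_ oE] [C [mC CE cC oC]]] ep h.
apply: (omega_ker mE oE ep mC oC) => [x Cx|x Ex _ /(_ a)[k [k0 e]]].
  have [mD cD] := eqv_compact_submodule ep mC cC.
  by apply: (compact_tends0_eq0 mD cD _ (h x)); exists x.
exact: (tends0_periodic k0 e (h x)).
Qed.

Section Chart.
Variables (V : set M) (m : nat) (f : M -> 'rV[R]_m) (g : 'rV[R]_m -> M).
Hypothesis sV : is_subgroup V.
Hypothesis fg : euclidean_chart V f g.

Lemma chartD t t' : g (t + t') = g t + g t'.
Proof.
case: fg => fD _ _ gK fK.
have [Vt ft] := gK t; have [Vt' ft'] := gK t'.
by rewrite -{1}ft -{1}ft' -fD // fK //; exact: (sgD sV).
Qed.

Lemma chart_cont : continuous g. Proof. by case: fg. Qed.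
Lemma chart_id x : V x -> g (f x) = x. Proof. by case: fg => _ _ _ _; exact. Qed.

(** An equivariant image of a Euclidean module has no [L] component, by [hom_ell0] applied through
    the chart. *)
Lemma chart_pL p x : equivariant act p -> V x -> p x = s (F (p x)).
Proof.
move=> ep Vx; apply/subr0_eq; rewrite -(chart_id Vx).
have epL := equivariant_comp pL_equivariant ep.
apply: (@hom_ell0 m (fun t => pL (p (g t)))).
- by move=> t t'; rewrite chartD (eqvD epL).
- move=> t; apply: (continuous_comp (f := g) (g := fun x => pL (p x))).
    exact: chart_cont.
  exact: (eqv_cont epL).
- by move=> t; exact: pL_ell.
Qed.

(** The image of a small ball falls into the compact open submodule [C], hence the whole image does;
    as [C] lies in [L], the map vanishes. *)
Lemma chart_hom_amorphic E p : alg_submodule act E -> amorphic act E ->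
  equivariant act p -> (forall x, E (p x)) -> forall x, V x -> p x = 0.
Proof.
move=> mE [_ [C [mC CE cC oC]]] ep pE x Vx; rewrite -(chart_id Vx).
have hD t t' : p (g (t + t')) = p (g t) + p (g t') by rewrite chartD (eqvD ep).
have hc : continuous (fun t => p (g t)).
  move=> t; apply: (continuous_comp (f := g) (g := p)); first exact: chart_cont.
  exact: (eqv_cont ep).
have [W [nW WC]] := open_in_nbhs oC (sg0 mC.1).
apply: (hom_ell0 hD hc) => t; apply: (compact_sg_ell mC.1 cC).
apply: (rV_hom_sub hD hc mC.1 nW) => t' Wt; apply: WC; split => //; exact: pE.
Qed.

(** The image of [C] is compact, hence in [L] and in the Euclidean complement at once; what
    [omega_ker] leaves is torsion in a real vector space. *)
Lemma amorphic_hom_chart E p : alg_submodule act E -> amorphic act E ->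
  equivariant act p -> (forall x, V (p x)) -> forall x, E x -> p x = 0.
Proof.
move=> mE [[_ oE] [C [mC CE cC oC]]] ep pV'.
have key x : p x = s (F (p x)) by exact: (chart_pL (equivariant_id act) (pV' x)).
apply: (omega_ker mE oE ep mC oC) => [x Cx|x Ex [k [k0 e]] _].
  have [mD cD] := eqv_compact_submodule ep mC cC.
  rewrite key F_ell ?s0 //; apply: (compact_sg_ell mD.1 cD); by exists x.
have FMn y n : F (y *+ n) = F y *+ n.
  by elim: n => [|n IH]; rewrite ?mulr0n ?F0 // !mulrS FD IH.
have := congr1 F e; rewrite FMn F0 -scaler_nat => /eqP.
rewrite scaler_eq0 pnatr_eq0 gtn_eqF //= => /eqP h.
by rewrite key h s0.
Qed.

Hypothesis distal : forall a, exists B : 'M[R]_m, (forall v, f (act a (g v)) = v *m B) /\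
  (forall z : R[i], root (map_poly (real_complex R) (char_poly B)) z -> `|z| = 1).
Hypothesis mV : alg_submodule act V.

(** In coordinates [p] becomes a matrix [Y] intertwining [B] with [Bm a]; so the roots of the
    characteristic polynomial of [B], of modulus 1, annihilate [F (p x)], and [mxiter_unit_eq0]
    applies. *)
Lemma distal_tends0 p a x : equivariant act p -> V x -> tends0 a (p x) -> p x = 0.
Proof.
move=> ep Vx h; have [B [hB hroot]] := distal a.
have [Y hY] : exists Y : 'M[R]_(m, d), forall t, F (p (g t)) = t *m Y.
  apply: additive_rV_matrix => [t t'|t]; first by rewrite chartD (eqvD ep) FD.
  apply: (continuous_comp (f := fun t => p (g t)) (g := F)); last exact: (esF_cont es).
  apply: (continuous_comp (f := g) (g := p)); first exact: chart_cont.
  exact: (eqv_cont ep).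
have gB t : act a (g t) = g (t *m B).
  rewrite -hB chart_id //; apply: mV.2.
  by have [_ _ _ gK _] := fg; exact: (gK t).1.
have BY : B *m Y = Y *m Bm a.
  by apply/row_matrixP => i; rewrite !rowE !mulmxA -!hY -gB (eqv_act ep) F_act.
have [q [hq hz]] := mxroots_char B.
suff h0 : F (p x) = 0 by rewrite (chart_pL ep Vx) h0 s0.
have Fx : F (p x) = f x *m Y by rewrite -hY chart_id.
apply: (map_mx_inj (f := real_complex R)).
rewrite map_mx0; apply: (mxiter_unit_eq0 (B := toC (Bm a)) (s := q)).
- by move=> z /hq /hroot /normc_eq1.
- rewrite Fx map_mxM (mxroots_mul (B := toC B)) ?hz ?mul0mx //.
  by rewrite -!map_mxM BY.
move=> e e0; have d1 : 0 < d%:R + 1 :> R by rewrite ltr_wpDl.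
have [n0 hn] := h _ (F_nbhs (divr_gt0 e0 d1)).
exists n0 => n nn; rewrite -toC_mxiter; apply: le_lt_trans (cnorm_real_le _) _.
have -> : mxiter (Bm a) n (F (p x)) = F (act (a *+ n) (p x)).
  elim: n {nn} => [|n IH]; first by rewrite mulr0n (act0 hact).
  by rewrite mulrS -(actA hact) F_act -IH.
have := hn n nn; rewrite /= ltr_pdivlMr // => h1; apply: le_lt_trans h1.
by rewrite mulrC ler_wpM2l // lerDl.
Qed.

End Chart.

Lemma PEV_proj P E V : PEV_decomposition act P E V ->
  exists (n : nat) (q : 'I_n -> M -> M) (a : 'I_n -> A) (pE pV : M -> M),
  [/\ forall i, equivariant act (q i) /\ forall x, tends0 (a i) (q i x),
      equivariant act pE /\ forall x, E (pE x),
      equivariant act pV /\ forall x, V (pV x),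
      forall x, x = \sum_i q i x + pE x + pV x &
      forall x, P (\sum_i q i x)].
Proof.
move=> [mP mE mV ds [[n [G [hG dsP]]] _ _]].
have [||r [er rF rsum]] := topdirsum_equivariant hact _ ds (equivariant_id act).
- by move=> -[[|[|[|i]]] hi].
- by [].
have [||q [eq qG qsum]] := topdirsum_equivariant hact _ dsP (er ord0).
- by move=> i; exact: (hG i).1.
- by move=> x; exact: (rF ord0 x).
have /choice[a ha] : forall i, exists a, contracting_on act a (G i) by move=> i; exact: (hG i).2.
exists n, q, a, (r (lift ord0 ord0)), (r ord_max); split.
- by move=> i; split => // x; exact: (contracting_tends0 (ha i) (qG i x)).
- by split => // x; exact: (rF (lift ord0 ord0) x).
- by split => // x; exact: (rF ord_max x).
- move=> x; rewrite {1}[x]rsum !big_ord_recl big_ord0 addr0 addrA qsum.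
  by congr (_ + _ + r _ x); exact: val_inj.
- by move=> x; rewrite -qsum; exact: (rF ord0 x).
Qed.

(** Each part of the second decomposition has zero components in the two parts of other kinds of the
    first. Inclusions suffice, since the roles can be exchanged. *)
Lemma PEV_sub P E V P' E' V' : PEV_decomposition act P E V ->
  PEV_decomposition act P' E' V' -> [/\ P' `<=` P, E' `<=` E & V' `<=` V].
Proof.
move=> dec dec'.
have [n [q [a [pE [pV [hq [eE hE] [eV hV] sum hP]]]]]] := PEV_proj dec.
have [mP mE mV _ [_ aE [m [f [g [fg dV]]]]]] := dec.
have [_ mE' mV' _ [[n' [G [hG [_ _ [pi [piG pisum _]]]]]] aE' [m' [f' [g' [fg' dV']]]]]] := dec'.
split=> x hx.
- have tz y b : tends0 b y -> pE y = 0 /\ pV y = 0.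
    move=> ty; split.
      exact: (amorphic_tends0_eq0 mE.1 aE (hE y) (eqv_tends0 eE ty)).
    apply: (distal_tends0 mV.1.1 fg dV mV.1 (equivariant_id act) (hV y)).
    exact: (eqv_tends0 eV ty).
  have z y : P' y -> pE y = 0 /\ pV y = 0.
    move=> Py; rewrite (pisum y Py) (eqv_sum _ _ _ eE) (eqv_sum _ _ _ eV).
    have zi i : pE (pi i y) = 0 /\ pV (pi i y) = 0.
      have [b hb] := (hG i).2.
      exact: (tz _ b (contracting_tends0 hb (piG i y Py))).
    by split; apply: big1 => i _; have [] := zi i.
  by have [z1 z2] := z x hx; rewrite (sum x) z1 z2 !addr0; exact: hP.
- rewrite (sum x) big1; last first.
    move=> i _; have [ei ti] := hq i.
    exact: (amorphic_hom_tends0 mE'.1 aE' ei ti).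
  rewrite add0r (amorphic_hom_chart mV.1.1 fg mE'.1 aE' eV hV hx) addr0.
  exact: hE.
- rewrite (sum x) big1; last first.
    move=> i _; have [ei ti] := hq i.
    exact: (distal_tends0 mV'.1.1 fg' dV' mV'.1 ei hx (ti x)).
  rewrite add0r (chart_hom_amorphic mV'.1.1 fg' mE.1 aE eE hE hx) add0r.
  exact: hV.
Qed.

End SheerModule.

Theorem mainTheorem3 (A M : topologicalZmodType) (act : A -> M -> M) :
  LCA_group A -> compactly_generated A ->
  LCA_group M -> is_action act ->
  sheer act setT ->
  exists P E V : set M, PEV_decomposition act P E V /\
    (forall P' E' V' : set M, PEV_decomposition act P' E' V' ->
       [/\ P' = P, E' = E & V' = V]).
Proof.
move=> _ cg lM hact hs; have hM := lM.1.
have [[d [F [s es]]] cL basisL ellL] := sheer_euclid_split Rdefinitions.R lM hact hs.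
have [Bm hBm] := act_mx hM hact es basisL.
have [P [E [V dec]]] := PEV_exists hM hact hs es cL basisL ellL hBm cg.
exists P, E, V; split => // P' E' V' dec'.
have sub := PEV_sub hM hact hs es cL basisL ellL hBm.
have [PP EE VV] := sub _ _ _ _ _ _ dec dec'.
have [PP' EE' VV'] := sub _ _ _ _ _ _ dec' dec.
by split; apply/seteqP.
Qed.
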